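(* Let $\phi$ be convex in $\mathbb{D}$ with real coefficients in its power series expansion, $\Re\phi(z)>0$ in $\mathbb{D}$ and $\phi(0)=1$. Let $\psi$ be the analytic function in $\mathbb{D}$ with $\psi(0)=1$ satisfying the differential equation $$\psi(z)+\frac{z\psi'(z)}{\psi(z)}=\phi(z),$$ and put $m_r:=\min_{|z|=r}|\psi(z)|$. Let $g\in\mathcal{A}$ and $f\in\mathcal{C}(\phi)$. If $g$ is majorized by $f$ in $\mathbb{D}$, then $$|g'(z)|\le |f'(z)|\quad\text{in } |z|\le r_\psi,$$ where $r_\psi$ is the least positive root of the equation $$(1-r^2)m_r-2r=0.$$ The result is sharp for $m_r=\psi(-r)$.
   Context: $\mathbb{D}=\{z:|z|<1\}$. $\mathcal{A}$ is the class of analytic functions in $\mathbb{D}$ of the form $z+\sum_{k\ge2}a_kz^k$. $\prec$ denotes subordination: $u\prec v$ if $u=v\circ\omega$ with $\omega:\mathbb{D}\to\mathbb{D}$ analytic, $\omega(0)=0$. $\mathcal{C}(\phi)=\{f\in\mathcal{A}: 1+zf''(z)/f'(z)\prec\phi(z)\}$. For $f,g$ analytic in $\mathbb{D}$, $g$ is majorized by $f$ in $\mathbb{D}$ if there is an analytic function $\Phi$ in $\mathbb{D}$ with $|\Phi(z)|\le1$ and $g(z)=\Phi(z)f(z)$ for all $z\in\mathbb{D}$.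
   Formalization: The function g is taken analytic in the disc instead of in 𝒜, for both the inequality and the sharpness: if g and f both lie in 𝒜 and g is majorized by f, then g = f, so the sharpness claim would be false. *)

(* Defs.v *)
From Stdlib Require Import Reals.
From Coquelicot Require Import Coquelicot.

Open Scope R_scope.
Open Scope C_scope.

(** Functions "on the disc" are total functions [C -> C] of which only the
    values on [unit_disc] matter. *)
Definition unit_disc (z : C) : Prop := Cmod z < 1.

Definition analytic_in_disc (f : C -> C) : Prop :=
  forall z : C, unit_disc z -> @ex_derive C_AbsRing C_NormedModule f z.

Definition expands_in_disc (a : nat -> C) (f : C -> C) : Prop :=
  forall z : C, unit_disc z -> @is_pseries C_AbsRing C_NormedModule a z (f z).

(** The class A: analytic functions of the form z + sum_{k >= 2} a_k z^k. *)
Definition class_A (f : C -> C) : Prop :=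
  analytic_in_disc f /\
  exists a : nat -> C,
    a 0%nat = RtoC 0 /\ a 1%nat = RtoC 1 /\ expands_in_disc a f.

Definition subordinate (u v : C -> C) : Prop :=
  exists w : C -> C,
    analytic_in_disc w /\ w (RtoC 0) = RtoC 0 /\
    forall z : C, unit_disc z -> unit_disc (w z) /\ u z = v (w z).

(** Division in [C] is total, so the fact that 1 + z f''(z)/f'(z) makes sense
    on the disc has to be required explicitly. *)
Definition class_C (phi f : C -> C) : Prop :=
  class_A f /\
  (forall z : C, unit_disc z -> C_derive f z <> RtoC 0) /\
  subordinate
    (fun z => RtoC 1 + z * C_derive (C_derive f) z / C_derive f z) phi.

(** Theorems on majorization should take [g] analytic and not in [class_A]:
    if f and g are both in [class_A], then Phi(0) = g'(0)/f'(0) = 1, so Phi is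
    constant by the maximum principle and g = f on the disc. *)
Definition majorized_by (g f : C -> C) : Prop :=
  exists Phi : C -> C,
    analytic_in_disc Phi /\
    forall z : C, unit_disc z -> Cmod (Phi z) <= 1 /\ g z = Phi z * f z.

Definition convex_set (S : C -> Prop) : Prop :=
  forall (u v : C) (t : R),
    S u -> S v -> 0 <= t <= 1 -> S (RtoC (1 - t) * u + RtoC t * v).

(** "Convex" in the sense of geometric function theory: analytic, univalent,
    with convex range. *)
Definition convex_in_disc (phi : C -> C) : Prop :=
  analytic_in_disc phi /\
  (forall z1 z2 : C, unit_disc z1 -> unit_disc z2 -> phi z1 = phi z2 -> z1 = z2) /\
  convex_set (fun w => exists z : C, unit_disc z /\ phi z = w).

Definition real_coefficients (phi : C -> C) : Prop :=
  exists a : nat -> R, expands_in_disc (fun n => RtoC (a n)) phi.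

(** As in [class_C], the quotient has to make sense on the whole disc. *)
Definition solves_ode (phi psi : C -> C) : Prop :=
  forall z : C, unit_disc z ->
    psi z <> RtoC 0 /\ psi z + z * C_derive psi z / psi z = phi z.

(** [m] is the minimum, attained, of |psi| on the circle |z| = r. *)
Definition is_min_modulus (psi : C -> C) (r m : R) : Prop :=
  (exists z : C, Cmod z = r /\ Cmod (psi z) = m) /\
  (forall z : C, Cmod z = r -> (m <= Cmod (psi z))%R).

(** [m r] is only meaningful for [0 <= r < 1], so roots are taken there. *)
Definition positive_root (m : R -> R) (r : R) : Prop :=
  (0 < r < 1 /\ (1 - r ^ 2) * m r - 2 * r = 0)%R.

Definition least_positive_root (m : R -> R) (r : R) : Prop :=
  positive_root m r /\ forall s : R, positive_root m s -> (r <= s)%R.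

Definition derivative_bound (f g : C -> C) (rho : R) : Prop :=
  forall z : C, unit_disc z -> Cmod z <= rho ->
    Cmod (C_derive g z) <= Cmod (C_derive f z).

(* Main.v *)
Require Import Defs.
From Stdlib Require Import Reals Ranalysis5 Lra Lia Psatz Classical ClassicalEpsilon.
From Coquelicot Require Import Coquelicot.

(** The proof has an analytic core, a subordination, and two elementary
    estimates at either end.

    Write [q = f / (z * f')] for [f] in the class of [phi]. The condition on [f]
    says that [z * q' + phi(w) * q = 1] with a Schwarz function [w], and
    [1 / psi] solves the same equation with [w] the identity. The core
    ([class_C_subordination]) is that [1 / q] is subordinate to [psi], so that
    [f(z) * psi(zeta) = z * f'(z)] for some [zeta] with [|zeta| <= |z|]. The
    minimum principle then gives [|f(z)| * m_r <= r * |f'(z)|] on [|z| = r]. If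
    [g = Phi * f], the Schwarz-Pick bound on [Phi'] turns this into
    [|g'| <= |f'|] as soon as [2 * r <= (1 - r^2) * m_r]
    ([majorized_derivative_bound]). As [m_r] is nonincreasing and continuous,
    [(1 - r^2) * m_r - 2 * r] is strictly decreasing and has exactly one root
    in [(0, 1)]. When [m_r = psi(-r)] and [r] is beyond the root, the solution
    [f] of [z * f' / f = psi] and a disc involution [Phi] violate the
    inequality at [-r] ([extremal_majorization]).

    The subordination is proved by three applications of one remark
    ([positive_real_part]): if [1 - z * T' = A * T] and [Re A > 0], then
    [Re T > 0], because at a minimum of [Re T] on a disc [z * T'] is real and
    at most 0. It applies to [1 / psi], to [q], and to
    [T = psi' / (psi * phi')], for which [A = 1 + z * phi'' / phi' + psi] has
    positive real part by convexity of [phi]. The last case says that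
    [Psi = log psi] is close-to-convex relative to [phi], hence univalent
    ([close_to_convex_injective]). As long as [P = log (1 / q)] takes its values
    in the image of [Psi], it lifts to [omega] with [Psi(omega) = P]; at a
    maximum of [|omega / z|] the number [z * omega' / omega] is real and at
    least 1, and if the maximum exceeded 1 the two differential equations would
    push [phi(w)] across the line supporting the convex image under [phi] of
    the disc through [omega] ([lift_bound]). So [|omega(z)| <= |z|], and since
    the image of [Psi] is open the lift never stops ([lift_exists]).

    Analytic functions are given by complex differentiability at each point, so
    the tools come from Goursat's theorem, proved on rectangles by bisection.
    The exponential carries rectangles to annuli, which yields Cauchy's formula
    ([cauchy_formula]) and Taylor series ([taylor]); the maximum principle,
    Schwarz's lemma, the differentiable inverse of a univalent function
    ([inverse_derive]) and the supporting lines of a convex function on subdiscs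
    ([convex_support]) rest on these. *)

Open Scope R_scope.
Arguments Cmod _%_C_scope.
Arguments Re _%_C_scope.
Arguments Im _%_C_scope.

(** * Complex differentiation *)

Lemma RtoC_neq_0 (x : R) : x <> 0 -> RtoC x <> RtoC 0.
Proof. intros Hx E. now apply RtoC_inj in E. Qed.

Lemma Cmod_RtoC (x : R) : 0 <= x -> Cmod (RtoC x) = x.
Proof. intros Hx. rewrite Cmod_R. now apply Rabs_right, Rle_ge. Qed.

Lemma Cmod_scal_R (x : R) (z : C) : 0 <= x -> Cmod (RtoC x * z) = x * Cmod z.
Proof. intros Hx. now rewrite Cmod_mult, Cmod_RtoC. Qed.

Lemma Cmod_minus_sym (z w : C) : Cmod (z - w) = Cmod (w - z).
Proof. rewrite <- Cmod_opp. f_equal. ring. Qed.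

Lemma Rlt_Rmin (x a b : R) : x < Rmin a b -> x < a /\ x < b.
Proof. apply Rmin_Rgt_l. Qed.

Notation is_cderive := (@is_derive C_AbsRing C_NormedModule).
Notation ex_cderive := (@ex_derive C_AbsRing C_NormedModule).
Notation ccontinuous := (@continuous C_UniformSpace C_UniformSpace).

Implicit Types (f g h : C -> C) (z w l df dg : C).

Lemma locally_Cmod (z : C) (P : C -> Prop) :
  locally z P <-> exists d, 0 < d /\ forall w, Cmod (w - z) < d -> P w.
Proof.
split.
- intros H. apply (@locally_norm_le_locally C_AbsRing C_NormedModule z P) in H.
  destruct H as [d Hd]. exists (d : R). split; [apply cond_pos|].
  intros w Hw. apply Hd. exact Hw.
- intros [d [Hd H]].
  assert (Hd2 : 0 < d / sqrt 2) by (apply Rdiv_lt_0_compat; [lra|apply Rlt_sqrt2_0]).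
  exists (mkposreal _ Hd2). intros w Hw. apply H.
  apply C_NormedModule_mixin_compat2 in Hw. simpl in Hw.
  replace d with (sqrt 2 * (d / sqrt 2)).
  exact Hw. field. apply Rgt_not_eq, Rlt_sqrt2_0.
Qed.

Lemma is_cderive_iff (f : C -> C) (z l : C) :
  is_cderive f z l <->
  forall eps, 0 < eps -> exists d, 0 < d /\ forall h : C, Cmod h < d ->
    Cmod (f (z + h)%C - f z - h * l) <= eps * Cmod h.
Proof.
split.
- intros [_ H] eps Heps.
  destruct (H z (fun P HP => HP) (mkposreal eps Heps)) as [d Hd].
  exists d; split; [apply cond_pos|]. intros h Hh.
  specialize (Hd (z + h)%C).
  assert (E : (z + h - z)%C = h) by ring.
  assert (Hb : Cmod (z + h - z) < d) by now rewrite E.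
  specialize (Hd Hb). 
  change (Cmod ((f (z + h)%C - f z) - ((z + h - z) * l)) <= eps * Cmod (z + h - z)) in Hd.
  now rewrite E in Hd.
- intros H. split.
  + apply is_linear_scal_l.
  + intros x Hx eps.
    assert (x = z) as ->.
    { symmetry. exact (is_filter_lim_locally_unique (V := AbsRing_NormedModule C_AbsRing) z x Hx). }
    destruct (H eps (cond_pos eps)) as [d [Hd H']].
    exists (mkposreal d Hd). intros w Hw.
    specialize (H' (w - z)%C Hw).
    assert (E : forall u : C, (z + (u - z))%C = u) by (intros; ring).
    rewrite E in H'. exact H'.
Qed.

Lemma continuous_C_iff (f : C -> C) (z : C) :
  ccontinuous f z <-> forall eps, 0 < eps -> exists d, 0 < d /\ forall w : C, Cmod (w - z) < d ->
    Cmod (f w - f z) < eps.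
Proof.
split.
- intros H eps Heps.
  specialize (H (fun y => Cmod (y - f z) < eps)).
  apply locally_Cmod. apply H. apply locally_Cmod. exists eps; auto.
- intros H P HP. apply locally_Cmod in HP. destruct HP as [e [He HP]].
  destruct (H e He) as [d [Hd H']]. apply locally_Cmod. exists d; split; auto.
Qed.


(** [C] carries two structures of normed module over itself, with the same
    norm and different uniform structures; some rules of differentiation are
    stated for the other one. *)
Lemma is_cderive_AbsRing f z l :
  is_cderive f z l <-> @is_derive C_AbsRing (AbsRing_NormedModule C_AbsRing) f z l.
Proof. split; intros [_ H]; (split; [apply is_linear_scal_l|exact H]). Qed.

Lemma is_cderive_plus f g z df dg : is_cderive f z df -> is_cderive g z dg ->
  is_cderive (fun x => f x + g x)%C z (df + dg)%C.
Proof. exact (is_derive_plus f g z df dg). Qed.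

Lemma is_cderive_opp f z df : is_cderive f z df ->
  is_cderive (fun x => - f x)%C z (- df)%C.
Proof. exact (is_derive_opp f z df). Qed.

Lemma is_cderive_minus f g z df dg : is_cderive f z df -> is_cderive g z dg ->
  is_cderive (fun x => f x - g x)%C z (df - dg)%C.
Proof. exact (is_derive_minus f g z df dg). Qed.

Lemma is_cderive_const a z : is_cderive (fun _ => a) z (RtoC 0).
Proof. exact (@is_derive_const C_AbsRing C_NormedModule a z). Qed.

Lemma is_cderive_id z : is_cderive (fun x => x) z (RtoC 1).
Proof. apply is_cderive_AbsRing. exact (@is_derive_id C_AbsRing z). Qed.

Lemma is_cderive_continuous f z l : is_cderive f z l -> ccontinuous f z.
Proof.
intros H P HP.
destruct (@ex_derive_continuous C_AbsRing C_NormedModule f z (ex_intro _ l H) P HP) as [d Hd].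
apply locally_Cmod. exists d. split; [apply cond_pos|]. intros w Hw. now apply Hd.
Qed.

Lemma is_cderive_mult f g z df dg : is_cderive f z df -> is_cderive g z dg ->
  is_cderive (fun x => f x * g x)%C z (df * g z + f z * dg)%C.
Proof.
rewrite !is_cderive_AbsRing. intros Hf Hg. exact (is_derive_mult f g z df dg Hf Hg Cmult_comm).
Qed.

Lemma is_cderive_comp f g z df dg : is_cderive f (g z) df -> is_cderive g z dg ->
  is_cderive (fun x => f (g x)) z (dg * df)%C.
Proof.
intros Hf Hg. apply is_cderive_AbsRing in Hg.
exact (@is_derive_comp C_AbsRing C_NormedModule f g z df dg Hf Hg).
Qed.

Lemma is_cderive_Cinv z : z <> RtoC 0 -> is_cderive Cinv z (- / (z * z))%C.
Proof.
intros Hz. apply Cmod_gt_0 in Hz as Hm.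
apply is_cderive_iff. intros eps He.
set (m := Cmod z) in *.
assert (Hp : 0 < Rmin (m / 2) (eps * (m * m * m) / 2)).
{ apply Rmin_glb_lt; [lra|]. apply Rdiv_lt_0_compat; [|lra].
  repeat apply Rmult_lt_0_compat; lra. }
exists (Rmin (m / 2) (eps * (m * m * m) / 2)). split; [exact Hp|].
intros h Hh.
apply Rlt_Rmin in Hh as [L1 L2].
assert (L3 : m / 2 <= Cmod (z + h)).
{ assert (m <= Cmod (z + h) + Cmod h).
  { unfold m. replace z with ((z + h) + (- h))%C at 1 by ring.
    rewrite <- (Cmod_opp h). apply Cmod_triangle. } lra. }
assert (Hn : (z + h)%C <> RtoC 0) by (apply Cmod_gt_0; lra).
replace (/ (z + h) - / z - h * (- / (z * z)))%C with (h * h / ((z + h) * (z * z)))%C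
  by (field; auto).
rewrite Cmod_div by (repeat apply Cmult_neq_0; auto).
rewrite !Cmod_mult. fold m.
pose proof (Cmod_ge_0 h) as Ah.
apply Rle_div_l.
{ repeat apply Rmult_gt_0_compat; lra. }
assert (m * m * (m / 2) <= m * m * Cmod (z + h)).
{ apply Rmult_le_compat_l; [nra|lra]. }
assert (Cmod h * Cmod h <= Cmod h * (eps * (m * m * m) / 2)).
{ apply Rmult_le_compat_l; lra. }
assert (eps * Cmod h * (m * m * (m / 2)) <= eps * Cmod h * (m * m * Cmod (z + h))).
{ apply Rmult_le_compat_l; [nra|lra]. }
lra.
Qed.

Lemma is_cderive_inv f z l : is_cderive f z l -> f z <> RtoC 0 ->
  is_cderive (fun x => / f x)%C z (- l / (f z * f z))%C.
Proof.
intros H Hz. 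
replace (- l / (f z * f z))%C with (l * (- / (f z * f z)))%C by (field; auto).
apply (is_cderive_comp Cinv f); auto. now apply is_cderive_Cinv.
Qed.

Lemma is_cderive_div f g z df dg : is_cderive f z df -> is_cderive g z dg ->
  g z <> RtoC 0 ->
  is_cderive (fun x => f x / g x)%C z ((df * g z - f z * dg) / (g z * g z))%C.
Proof.
intros Hf Hg Hz. 
replace ((df * g z - f z * dg) / (g z * g z))%C with
  (df * / g z + f z * (- dg / (g z * g z)))%C by (field; auto).
apply (is_cderive_mult f (fun x => / g x)%C); auto. now apply is_cderive_inv.
Qed.

Lemma is_cderive_scal (a : C) f z l : is_cderive f z l ->
  is_cderive (fun x => a * f x)%C z (a * l)%C.
Proof.
intros H. replace (a * l)%C with (RtoC 0 * f z + a * l)%C by ring.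
apply (is_cderive_mult (fun _ => a)); auto. apply is_cderive_const.
Qed.

Lemma is_cderive_ext_near f g z l d : 0 < d ->
  (forall w : C, Cmod (w - z) < d -> f w = g w) ->
  is_cderive f z l -> is_cderive g z l.
Proof.
intros Hd H Hf. rewrite is_cderive_iff in *. intros eps He.
destruct (Hf eps He) as [d' [Hd' H']]. exists (Rmin d d').
split; [now apply Rmin_glb_lt|]. intros h Hh. apply Rlt_Rmin in Hh as [L1 L2].
rewrite <- !H.
- now apply H'.
- replace (z - z)%C with (RtoC 0) by ring. now rewrite Cmod_0.
- replace (z + h - z)%C with h by ring. exact L1.
Qed.

Lemma is_cderive_unique f z l l' : is_cderive f z l -> is_cderive f z l' -> l = l'.
Proof.
intros H H'. rewrite <- (is_C_derive_unique f z l H). now apply is_C_derive_unique.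
Qed.

Lemma ex_cderive_C_derive f z : ex_cderive f z -> is_cderive f z (C_derive f z).
Proof. intros H. exact (C_derive_correct f z z H). Qed.

(** * Compactness in the plane *)

(** Quartering a rectangle forever. The point is the supremum of the lower
    left corners; the sides are recorded exactly because Goursat's theorem
    compares the predicate with the area. *)
Lemma bisection (B : R -> R -> R -> R -> Prop) (a b c d : R) :
  a <= b -> c <= d ->
  (forall a' b' c' d', a <= a' -> a' <= b' -> b' <= b -> c <= c' -> c' <= d' -> d' <= d ->
     B a' b' c' d' ->
     B a' ((a' + b') / 2) c' ((c' + d') / 2) \/ B ((a' + b') / 2) b' c' ((c' + d') / 2) \/
     B a' ((a' + b') / 2) ((c' + d') / 2) d' \/ B ((a' + b') / 2) b' ((c' + d') / 2) d') ->
  B a b c d ->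
  exists x y, forall n : nat, exists a' b' c' d',
    B a' b' c' d' /\ a <= a' <= x /\ x <= b' <= b /\ c <= c' <= y /\ y <= d' <= d /\
    b' - a' = (b - a) / 2 ^ n /\ d' - c' = (d - c) / 2 ^ n.
Proof.
intros Hab Hcd Hstep H0.
set (BB := fun q : (R * R) * (R * R) => B (fst (fst q)) (snd (fst q)) (fst (snd q)) (snd (snd q))).
set (step := fun q : (R * R) * (R * R) =>
  let '((a', b'), (c', d')) := q in
  let m := (a' + b') / 2 in let n := (c' + d') / 2 in
  if excluded_middle_informative (BB ((a', m), (c', n))) then ((a', m), (c', n)) else
  if excluded_middle_informative (BB ((m, b'), (c', n))) then ((m, b'), (c', n)) else
  if excluded_middle_informative (BB ((a', m), (n, d'))) then ((a', m), (n, d')) else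
  ((m, b'), (n, d'))).
set (q := fix q n := match n with O => ((a, b), (c, d)) | S n => step (q n) end).
set (qa := fun n => fst (fst (q n))). set (qb := fun n => snd (fst (q n))).
set (qc := fun n => fst (snd (q n))). set (qd := fun n => snd (snd (q n))).
assert (I : forall n, BB (q n) /\ a <= qa n /\ qa n <= qb n /\ qb n <= b /\
   c <= qc n /\ qc n <= qd n /\ qd n <= d /\
   qb n - qa n = (b - a) / 2 ^ n /\ qd n - qc n = (d - c) / 2 ^ n /\
   qa n <= qa (S n) /\ qb (S n) <= qb n /\ qc n <= qc (S n) /\ qd (S n) <= qd n).
{ assert (St : forall n, BB (q n) -> a <= qa n -> qa n <= qb n -> qb n <= b ->
     c <= qc n -> qc n <= qd n -> qd n <= d ->
     BB (q (S n)) /\ qa n <= qa (S n) /\ qa (S n) <= qb (S n) /\ qb (S n) <= qb n /\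
     qc n <= qc (S n) /\ qc (S n) <= qd (S n) /\ qd (S n) <= qd n /\
     qb (S n) - qa (S n) = (qb n - qa n) / 2 /\ qd (S n) - qc (S n) = (qd n - qc n) / 2).
  { intros n Hn. unfold qa, qb, qc, qd in *. simpl q. destruct (q n) as [[a' b'] [c' d']].
    simpl in Hn |- *. intros.
    specialize (Hstep a' b' c' d' H H1 H2 H3 H4 H5 Hn).
    unfold BB in *; simpl in *.
    repeat destruct excluded_middle_informative; simpl in *;
     (split; [tauto|]); repeat split; lra. }
  assert (J : forall n, BB (q n) /\ a <= qa n /\ qa n <= qb n /\ qb n <= b /\
   c <= qc n /\ qc n <= qd n /\ qd n <= d /\
   qb n - qa n = (b - a) / 2 ^ n /\ qd n - qc n = (d - c) / 2 ^ n).
  { induction n as [|n IH].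
    - unfold qa, qb, qc, qd; simpl. repeat split; try lra. exact H0.
    - destruct IH as (I1 & I2 & I3 & I4 & I5 & I6 & I7 & I8 & I9).
      destruct (St n) as (J1 & J2 & J3 & J4 & J5 & J6 & J7 & J8 & J9); auto.
      split; [exact J1|]. repeat (split; [lra|]).
      assert (2 ^ n <> 0) by (apply pow_nonzero; lra).
      rewrite J8, J9, I8, I9. simpl. split; field; auto. }
  intros n. destruct (J n) as (I1 & I2 & I3 & I4 & I5 & I6 & I7 & I8 & I9).
  destruct (St n) as (J1 & J2 & J3 & J4 & J5 & J6 & J7 & J8 & J9); auto.
  repeat (split; [assumption|]). assumption. }
assert (N : forall lo hi : nat -> R, (forall n, lo n <= lo (S n)) ->
   (forall n, hi (S n) <= hi n) -> (forall n, lo n <= hi n) ->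
   exists x, forall n, lo n <= x <= hi n).
{ intros lo hi Hlo Hhi Hlh.
  assert (Mlo : forall n k, lo n <= lo (n + k)%nat).
  { intros n k; induction k. rewrite Nat.add_0_r; lra.
    rewrite Nat.add_succ_r. eapply Rle_trans; eauto. }
  assert (Mhi : forall n k, hi (n + k)%nat <= hi n).
  { intros n k; induction k. rewrite Nat.add_0_r; lra.
    rewrite Nat.add_succ_r. eapply Rle_trans; eauto. }
  assert (Lh : forall n m, lo n <= hi m).
  { intros n m. apply Rle_trans with (lo (n + m)%nat); auto.
    apply Rle_trans with (hi (n + m)%nat); auto. rewrite Nat.add_comm. auto. }
  destruct (completeness (fun x => exists n, x = lo n)) as [x [Hx1 Hx2]].
  - exists (hi O). intros x [n ->]. auto.
  - exists (lo O). now exists O.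
  - exists x. intros n. split.
    + apply Hx1. now exists n.
    + apply Hx2. intros y [m ->]. auto. }
destruct (N qa qb) as [x Hx]; try (intros n; destruct (I n) as (?&?&?&?&?&?&?&?&?&?&?&?&?); assumption).
destruct (N qc qd) as [y Hy]; try (intros n; destruct (I n) as (?&?&?&?&?&?&?&?&?&?&?&?&?); assumption).
exists x, y. intros n. exists (qa n), (qb n), (qc n), (qd n).
destruct (I n) as (I1 & I2 & I3 & I4 & I5 & I6 & I7 & I8 & I9 & _).
specialize (Hx n). specialize (Hy n). repeat (split; [assumption || lra|]). assumption.
Qed.

Lemma pow_unbounded x K : 1 < x -> exists n, K < x ^ n.
Proof.
intros Hx. destruct (Pow_x_infinity x ltac:(rewrite Rabs_right; lra) (Rabs K + 1)) as [N HN].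
exists N. specialize (HN N (Nat.le_refl N)).
rewrite Rabs_right in HN by (apply Rle_ge, pow_le; lra). pose proof (Rle_abs K). lra.
Qed.

Lemma pow2_small (L eps : R) : 0 < eps -> exists n : nat, L / 2 ^ n < eps.
Proof.
intros He. destruct (pow_unbounded 2 (L / eps)) as [n Hn]; [lra|]. exists n.
assert (0 < 2 ^ n) by (apply pow_lt; lra).
apply Rlt_div_l; auto. apply Rlt_div_l in Hn; auto. lra.
Qed.

Lemma Cmod_le_sum z : Cmod z <= Rabs (Re z) + Rabs (Im z).
Proof.
pose proof (Cmod2_alt z). pose proof (Cmod_ge_0 z).
pose proof (Rabs_pos (Re z)). pose proof (Rabs_pos (Im z)).
rewrite <- (pow2_abs (Re z)), <- (pow2_abs (Im z)) in H. nra.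
Qed.

Lemma im_le_Cmod z : Rabs (Im z) <= Cmod z.
Proof.
pose proof (Cmod2_alt z). pose proof (Cmod_ge_0 z).
pose proof (Rabs_pos (Im z)). rewrite <- (pow2_abs (Im z)) in H. nra.
Qed.

(** Bisection of a square containing [K]. Extreme values and uniformity on
    compact sets both follow with a suitable notion of a bad set. *)
Lemma compact_cluster (K : C -> Prop) (r : R) (B : (C -> Prop) -> Prop) :
  (forall z, K z -> Cmod z <= r) ->
  (forall z, (forall eps, 0 < eps -> exists w, K w /\ Cmod (w - z) < eps) -> K z) ->
  (forall S T : C -> Prop, (forall z, S z -> T z) -> B S -> B T) ->
  (forall S T : C -> Prop, B (fun z => S z \/ T z) -> B S \/ B T) ->
  ~ B (fun _ => False) -> B K ->
  exists z, K z /\ forall eps, 0 < eps -> B (fun w => K w /\ Cmod (w - z) < eps).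
Proof.
intros Hbd Hcl Hmon Hun Hemp HK.
destruct (classic (exists z, K z)) as [[z0 Hz0]|Hno].
2:{ exfalso. apply Hemp. apply Hmon with K; auto. intros z Hz; apply Hno; now exists z. }
assert (Hr : 0 <= r) by (eapply Rle_trans; [apply Cmod_ge_0|apply (Hbd z0 Hz0)]).
destruct (bisection (fun a b c d => B (fun w => K w /\ a <= Re w <= b /\ c <= Im w <= d))
  (-r) r (-r) r) as [x [y Hxy]].
- lra.
- lra.
- intros a b c d _ H1 _ _ H2 _ H.
  set (m := (a + b) / 2). set (n := (c + d) / 2).
  assert (H' : B (fun w => ((K w /\ a <= Re w <= m /\ c <= Im w <= n) \/
                    (K w /\ m <= Re w <= b /\ c <= Im w <= n)) \/
                   ((K w /\ a <= Re w <= m /\ n <= Im w <= d) \/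
                    (K w /\ m <= Re w <= b /\ n <= Im w <= d)))).
  { revert H. apply Hmon. intros w [Hw [Hx Hy]].
    destruct (Rle_or_lt (Re w) m); destruct (Rle_or_lt (Im w) n).
    - left; left; repeat split; tauto || lra.
    - right; left; repeat split; tauto || lra.
    - left; right; repeat split; tauto || lra.
    - right; right; repeat split; tauto || lra. }
  apply Hun in H'. destruct H' as [H'|H']; apply Hun in H'; tauto.
- revert HK. apply Hmon. intros w Hw. split; [exact Hw|].
  specialize (Hbd w Hw). pose proof (re_le_Cmod w) as H1. pose proof (im_le_Cmod w) as H2.
  apply Rabs_le_between in H1. apply Rabs_le_between in H2. lra.
- assert (HB : forall eps, 0 < eps -> B (fun w => K w /\ Cmod (w - (x, y)) < eps)).
  { intros eps He. destruct (pow2_small (r - - r) (eps / 2) ltac:(lra)) as [n Hn].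
    destruct (Hxy n) as (a & b & c & d & HB & H1 & H2 & H3 & H4 & H5 & H6).
    revert HB. apply Hmon. intros w [Hw [Hx Hy]]. split; [exact Hw|].
    eapply Rle_lt_trans; [apply Cmod_le_sum|].
    assert (Rabs (Re (w - (x, y))) < eps / 2).
    { change (Re (w - (x, y))) with (Re w - x). apply Rabs_lt_between. lra. }
    assert (Rabs (Im (w - (x, y))) < eps / 2).
    { change (Im (w - (x, y))) with (Im w - y). apply Rabs_lt_between. lra. }
    lra. }
  exists (x, y). split; [|exact HB].
  apply Hcl. intros eps He. apply NNPP. intros Hn. apply Hemp.
  generalize (HB eps He). apply Hmon. intros w Hw. apply Hn. now exists w.
Qed.

Lemma Cmod_lt_perturb z w : Cmod w - Cmod (w - z) <= Cmod z <= Cmod w + Cmod (w - z).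
Proof.
split.
- assert (Cmod w <= Cmod (w - z) + Cmod z); [|lra].
  eapply Rle_trans; [|apply Cmod_triangle]. right; f_equal; ring.
- rewrite Cmod_minus_sym.
  eapply Rle_trans; [|apply Cmod_triangle]. right; f_equal; ring.
Qed.

Lemma closed_disc_closed r z :
  (forall eps, 0 < eps -> exists w, Cmod w <= r /\ Cmod (w - z) < eps) -> Cmod z <= r.
Proof.
intros H. apply Rnot_lt_le. intros Hl.
destruct (H (Cmod z - r)) as [w [H1 H2]]; [lra|].
pose proof (Cmod_lt_perturb z w). lra.
Qed.

Lemma circle_closed r z :
  (forall eps, 0 < eps -> exists w, Cmod w = r /\ Cmod (w - z) < eps) -> Cmod z = r.
Proof.
intros H. apply cond_eq. intros eps He.
destruct (H eps He) as [w [H1 H2]].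
pose proof (Cmod_lt_perturb z w). apply Rabs_lt_between. lra.
Qed.

(** A set is bad when it has points at least as high as any given point of
    [K]; one half of a bad set is bad. *)
Lemma compact_max (K : C -> Prop) (r : R) (F : C -> R) :
  (forall z, K z -> Cmod z <= r) ->
  (forall z, (forall eps, 0 < eps -> exists w, K w /\ Cmod (w - z) < eps) -> K z) ->
  (exists z, K z) ->
  (forall z, K z -> forall eps, 0 < eps -> exists d, 0 < d /\
     forall w, K w -> Cmod (w - z) < d -> Rabs (F w - F z) < eps) ->
  exists z, K z /\ forall w, K w -> F w <= F z.
Proof.
intros Hbd Hcl [z0 Hz0] HF.
destruct (compact_cluster K r (fun S => forall z, K z -> exists w, S w /\ K w /\ F z <= F w))
  as [z [Hz H]]; auto.
- intros S T HST HS z Hz. destruct (HS z Hz) as [w Hw]. exists w. intuition.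
- intros S T H. apply NNPP. intros Hn. apply not_or_and in Hn as [H1 H2].
  apply not_all_ex_not in H1 as [z1 H1]. apply not_all_ex_not in H2 as [z2 H2].
  apply imply_to_and in H1 as [K1 H1]. apply imply_to_and in H2 as [K2 H2].
  destruct (Rle_or_lt (F z1) (F z2)) as [L|L].
  + destruct (H z2 K2) as [w [[Hw|Hw] [Kw Fw]]].
    * apply H1. exists w. split; [|split]; auto; lra.
    * apply H2. exists w. split; [|split]; auto; lra.
  + destruct (H z1 K1) as [w [[Hw|Hw] [Kw Fw]]].
    * apply H1. exists w. split; [|split]; auto; lra.
    * apply H2. exists w. split; [|split]; auto; lra.
- intros H. destruct (H z0 Hz0) as [w Hw]. tauto.
- intros z Hz. exists z. split; [|split]; auto; lra.
- exists z. split; [exact Hz|]. intros w Hw. apply Rnot_lt_le. intros Hl.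
  destruct (HF z Hz (F w - F z)) as [d [Hd Hc]]; [lra|].
  destruct (H d Hd w Hw) as [u [[Ku Hu] [_ Fu]]].
  specialize (Hc u Ku Hu). apply Rabs_lt_between in Hc. lra.
Qed.

(** A set is bad when no single [e] serves all its points, and one half of a
    bad set is bad. *)
Lemma compact_uniform (r : R) (A : C -> R -> Prop) :
  (forall z e e', 0 < e' -> e' <= e -> A z e -> A z e') ->
  (forall a, Cmod a <= r -> exists e, 0 < e /\
     forall z, Cmod z <= r -> Cmod (z - a) < e -> A z e) ->
  exists e, 0 < e /\ forall z, Cmod z <= r -> A z e.
Proof.
intros Hm HA. apply NNPP. intros Hn.
destruct (compact_cluster (fun z => Cmod z <= r) r
  (fun S => ~ exists e, 0 < e /\ forall z, S z -> Cmod z <= r -> A z e)) as [z [Hz H]]; auto.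
- apply closed_disc_closed.
- intros S T HST HS [e [He H]]. apply HS. exists e. intuition.
- intros S T H. apply NNPP. intros Hc. apply not_or_and in Hc as [H1 H2].
  apply NNPP in H1. apply NNPP in H2.
  destruct H1 as [e1 [He1 H1]]. destruct H2 as [e2 [He2 H2]]. apply H.
  assert (0 < Rmin e1 e2) by now apply Rmin_glb_lt.
  exists (Rmin e1 e2). split; [auto|]. intros z [Hz|Hz] Kz.
  + apply Hm with e1; auto. apply Rmin_l.
  + apply Hm with e2; auto. apply Rmin_r.
- intros H. apply H. exists 1. split; [lra|tauto].
- intros [e [He H]]. apply Hn. exists e. split; auto.
- destruct (HA z Hz) as [e [He H']]. apply (H e He). exists e. split; [auto|].
  intros w [Hw1 Hw2] _. auto.
Qed.

Lemma disc_max r (F : C -> R) : 0 <= r ->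
  (forall z, Cmod z <= r -> forall eps, 0 < eps -> exists d, 0 < d /\
     forall w, Cmod (w - z) < d -> Rabs (F w - F z) < eps) ->
  exists z, Cmod z <= r /\ forall w, Cmod w <= r -> F w <= F z.
Proof.
intros Hr HF. apply (compact_max (fun z => Cmod z <= r) r); auto.
- apply closed_disc_closed.
- exists 0. now rewrite Cmod_0.
- intros z Hz eps He. destruct (HF z Hz eps He) as [d [Hd H]]. exists d; split; auto.
Qed.

Lemma Rabs_Cmod_minus z w : Rabs (Cmod z - Cmod w) <= Cmod (z - w).
Proof. pose proof (Cmod_lt_perturb w z). apply Rabs_le_between. lra. Qed.

Lemma ccontinuous_Cmod f z : ccontinuous f z ->
  forall eps, 0 < eps -> exists d, 0 < d /\
     forall w, Cmod (w - z) < d -> Rabs (Cmod (f w) - Cmod (f z)) < eps.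
Proof.
intros H eps He. rewrite continuous_C_iff in H. destruct (H eps He) as [d [Hd H']].
exists d. split; auto. intros w Hw. eapply Rle_lt_trans; [apply Rabs_Cmod_minus|]. auto.
Qed.

Lemma ccontinuous_Re f z : ccontinuous f z ->
  forall eps, 0 < eps -> exists d, 0 < d /\
     forall w, Cmod (w - z) < d -> Rabs (Re (f w) - Re (f z)) < eps.
Proof.
intros H eps He. rewrite continuous_C_iff in H. destruct (H eps He) as [d [Hd H']].
exists d. split; auto. intros w Hw. eapply Rle_lt_trans; [|apply (H' w Hw)].
change (Re (f w) - Re (f z)) with (Re (f w - f z)). apply re_le_Cmod.
Qed.

Lemma disc_Cmod_max r f : 0 <= r -> (forall z, Cmod z <= r -> ccontinuous f z) ->
  exists z, Cmod z <= r /\ forall w, Cmod w <= r -> Cmod (f w) <= Cmod (f z).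
Proof. intros Hr H. apply (disc_max r (fun z => Cmod (f z))); auto.
intros z Hz. apply ccontinuous_Cmod; auto. Qed.

Lemma disc_uniform_continuity r f : (forall z, Cmod z <= r -> ccontinuous f z) ->
  forall eps, 0 < eps -> exists d, 0 < d /\
    forall z w, Cmod z <= r -> Cmod w <= r -> Cmod (w - z) < d -> Cmod (f w - f z) < eps.
Proof.
intros H eps He.
destruct (compact_uniform r (fun z e => forall w, Cmod w <= r -> Cmod (w - z) < e ->
   Cmod (f w - f z) < eps)) as [d [Hd H']].
- intros z e e' _ Hle Hz w Hw Hwz. apply Hz; auto. lra.
- intros a Ha. specialize (H a Ha). rewrite continuous_C_iff in H.
  destruct (H (eps / 2)) as [d [Hd H']]; [lra|]. exists (d / 2). split; [lra|].
  intros z Hz Hza w Hw Hwz.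
  replace (f w - f z)%C with ((f w - f a) - (f z - f a))%C by ring.
  eapply Rle_lt_trans; [apply Cmod_triangle|]. rewrite Cmod_opp.
  assert (Cmod (f w - f a) < eps / 2).
  { apply H'. replace (w - a)%C with ((w - z) + (z - a))%C by ring.
    eapply Rle_lt_trans; [apply Cmod_triangle|]. lra. }
  assert (Cmod (f z - f a) < eps / 2) by (apply H'; lra). lra.
- exists d. split; auto. 
Qed.

(** * Integrals of complex-valued functions of a real variable *)

Notation is_Cint := (@is_RInt C_R_NormedModule).
Notation Cint := (@RInt C_R_CompleteNormedModule).
Notation rcontinuous := (@continuous R_UniformSpace C_UniformSpace).

Lemma norm_C_R z : @norm R_AbsRing C_R_NormedModule z = Cmod z.
Proof.
unfold Cmod. rewrite <- (pow2_abs (fst z)), <- (pow2_abs (snd z)). reflexivity.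
Qed.

Lemma is_Cint_intro u a b (l : C) :
  is_RInt (fun t => Re (u t)) a b (Re l) -> is_RInt (fun t => Im (u t)) a b (Im l) ->
  is_Cint u a b l.
Proof.
intros H1 H2. destruct l as [l1 l2].
exact (@is_RInt_fct_extend_pair R_NormedModule R_NormedModule u a b l1 l2 H1 H2).
Qed.

Lemma is_Cint_Re u a b (l : C) : is_Cint u a b l -> is_RInt (fun t => Re (u t)) a b (Re l).
Proof. exact (@is_RInt_fct_extend_fst R_NormedModule R_NormedModule u a b l). Qed.

Lemma is_Cint_Im u a b (l : C) : is_Cint u a b l -> is_RInt (fun t => Im (u t)) a b (Im l).
Proof. exact (@is_RInt_fct_extend_snd R_NormedModule R_NormedModule u a b l). Qed.

Lemma is_Cint_unique u a b (l : C) : is_Cint u a b l -> Cint u a b = l.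
Proof. exact (@is_RInt_unique C_R_CompleteNormedModule u a b l). Qed.

Lemma is_Cint_Cint u a b : (forall t, Rmin a b <= t <= Rmax a b -> rcontinuous u t) ->
  is_Cint u a b (Cint u a b).
Proof.
intros H. apply (@RInt_correct C_R_CompleteNormedModule).
apply (@ex_RInt_continuous C_R_CompleteNormedModule). exact H.
Qed.

Lemma is_Cint_minus u v a b (l m : C) : is_Cint u a b l -> is_Cint v a b m ->
  is_Cint (fun t => u t - v t)%C a b (l - m)%C.
Proof. exact (@is_RInt_minus C_R_NormedModule u v a b l m). Qed.

Lemma is_Cint_scal (k : C) u a b (l : C) : is_Cint u a b l ->
  is_Cint (fun t => k * u t)%C a b (k * l)%C.
Proof.
intros H. assert (H1 := is_Cint_Re _ _ _ _ H). assert (H2 := is_Cint_Im _ _ _ _ H).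
apply is_Cint_intro.
- rewrite re_mult. apply is_RInt_ext with (fun t => minus (scal (Re k) (Re (u t))) (scal (Im k) (Im (u t)))).
  intros t _. now rewrite re_mult.
  apply (@is_RInt_minus R_NormedModule); apply (@is_RInt_scal R_NormedModule); assumption.
- rewrite im_mult. apply is_RInt_ext with (fun t => plus (scal (Re k) (Im (u t))) (scal (Im k) (Re (u t)))).
  intros t _. rewrite im_mult. unfold plus, scal; simpl; unfold mult; simpl. ring.
  replace (Re k * Im l + Re l * Im k)%R with (plus (scal (Re k) (Im l)) (scal (Im k) (Re l))).
  2:{ unfold plus, scal; simpl; unfold mult; simpl. ring. }
  apply (@is_RInt_plus R_NormedModule); apply (@is_RInt_scal R_NormedModule); assumption.
Qed.

Lemma is_Cint_bound u a b (l : C) M : a <= b -> is_Cint u a b l ->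
  (forall t, a <= t <= b -> Cmod (u t) <= M) -> Cmod l <= (b - a) * M.
Proof.
intros Hab Hl HM. rewrite <- norm_C_R.
apply (@norm_RInt_le_const C_R_NormedModule u a b l M Hab); auto.
intros t Ht. rewrite norm_C_R. auto.
Qed.

Lemma is_Cint_Chasles u a b c (l m : C) : is_Cint u a b l -> is_Cint u b c m ->
  is_Cint u a c (l + m)%C.
Proof. exact (@is_RInt_Chasles C_R_NormedModule u a b c l m). Qed.

Lemma is_Cint_ext u v a b (l : C) : (forall t, Rmin a b < t < Rmax a b -> u t = v t) ->
  is_Cint u a b l -> is_Cint v a b l.
Proof. exact (@is_RInt_ext C_R_NormedModule u v a b l). Qed.

Lemma is_Cint_const a b (k : C) : is_Cint (fun _ => k) a b (RtoC (b - a) * k)%C.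
Proof. rewrite <- scal_R_Cmult. exact (@is_RInt_const C_R_NormedModule a b k). Qed.

(** * Differentiation along a line *)

Lemma rcontinuous_iff (u : R -> C) t :
  rcontinuous u t <-> forall eps, 0 < eps -> exists d, 0 < d /\ forall s, Rabs (s - t) < d ->
    Cmod (u s - u t) < eps.
Proof.
split.
- intros H eps He. specialize (H (fun w => Cmod (w - u t) < eps)).
  destruct H as [d Hd].
  { apply locally_Cmod. exists eps; auto. }
  exists d. split; [apply cond_pos|]. exact Hd.
- intros H P HP. apply locally_Cmod in HP. destruct HP as [e [He HP]].
  destruct (H e He) as [d [Hd H']]. exists (mkposreal d Hd). intros s Hs. apply HP, H'. exact Hs.
Qed.

Lemma rcontinuous_line z v t : rcontinuous (fun s => z + s * v)%C t.
Proof.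
apply rcontinuous_iff. intros eps He. pose proof (Cmod_ge_0 v).
assert (0 < eps / (1 + Cmod v)) by (apply Rdiv_lt_0_compat; lra).
exists (eps / (1 + Cmod v)). split; auto. intros s Hs.
replace (z + s * v - (z + t * v))%C with (RtoC (s - t) * v)%C by (rewrite RtoC_minus; ring).
rewrite Cmod_mult, Cmod_R.
apply Rle_lt_trans with (Rabs (s - t) * (1 + Cmod v)).
apply Rmult_le_compat_l; [apply Rabs_pos|lra].
apply Rlt_div_r in Hs; lra.
Qed.

Lemma rcontinuous_comp f (u : R -> C) t : ccontinuous f (u t) -> rcontinuous u t ->
  rcontinuous (fun s => f (u s)) t.
Proof.
intros Hf Hu. exact (@continuous_comp R_UniformSpace C_UniformSpace C_UniformSpace u f t Hu Hf).
Qed.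

(** The pairing with [k] reduces a complex function on a line to a real one,
    to which the mean value theorem and the fundamental theorem apply. *)
Lemma is_derive_line (k : C) f z v t l : is_cderive f (z + RtoC t * v)%C l ->
  is_derive (fun s => Re (k * f (z + RtoC s * v)%C)) t (Re (k * (v * l))).
Proof.
intros H. apply is_derive_Reals. intros eps He.
rewrite is_cderive_iff in H. pose proof (Cmod_ge_0 v). pose proof (Cmod_ge_0 k).
assert (Hkv : 0 <= Cmod k * Cmod v) by now apply Rmult_le_pos.
set (e := eps / (2 * (1 + Cmod k * Cmod v))).
assert (He' : 0 < e) by (apply Rdiv_lt_0_compat; lra).
destruct (H e He') as [d [Hd H']].
assert (Hd' : 0 < d / (1 + Cmod v)) by (apply Rdiv_lt_0_compat; lra).
exists (mkposreal _ Hd'). intros s Hs0 Hs. simpl in Hs.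
assert (Hsv : Cmod (s * v) < d).
{ rewrite Cmod_mult, Cmod_R. apply Rlt_div_r in Hs; [|lra].
  pose proof (Rabs_pos s). nra. }
specialize (H' _ Hsv).
replace (Re (k * f (z + (t + s)%R * v)%C) - Re (k * f (z + t * v)%C))%R with
   (Re (k * (f ((z + t * v) + s * v)%C - f (z + t * v)%C - s * v * l)) + s * Re (k * (v * l)))%R.
2:{ replace (z + (t + s)%R * v)%C with ((z + t * v) + s * v)%C by (rewrite RtoC_plus; ring).
    rewrite <- re_scal_l. unfold Rminus. rewrite <- re_opp, <- !re_plus. f_equal. ring. }
set (D := (f ((z + t * v) + s * v)%C - f (z + t * v)%C - s * v * l)%C) in *.
replace ((Re (k * D) + s * Re (k * (v * l))) / s - Re (k * (v * l))) with (Re (k * D) / s)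
  by (field; auto).
assert (HD : Rabs (Re (k * D)) <= Cmod k * (e * Cmod (s * v))).
{ eapply Rle_trans; [apply re_le_Cmod|]. rewrite Cmod_mult. apply Rmult_le_compat_l; auto. }
rewrite Cmod_mult, Cmod_R in HD.
unfold Rdiv. rewrite Rabs_mult, Rabs_inv.
assert (Ps : 0 < Rabs s) by now apply Rabs_pos_lt.
apply Rlt_div_l; auto.
apply Rle_lt_trans with (eps / 2 * Rabs s); [|nra].
eapply Rle_trans; [apply HD|].
replace (Cmod k * (e * (Rabs s * Cmod v))) with ((e * (Cmod k * Cmod v)) * Rabs s) by ring.
apply Rmult_le_compat_r; [lra|].
replace (eps / 2) with (e * (1 + Cmod k * Cmod v)) by (unfold e; field; lra).
apply Rmult_le_compat_l; lra.
Qed.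

Lemma Re_1_mult z : Re (1 * z) = Re z.
Proof. f_equal; ring. Qed.

(** Both coordinates come from the pairing, with [k = 1] and [k = - Ci]. *)
Lemma is_Cint_line f (df : C -> C) z v a b :
  (forall t, Rmin a b <= t <= Rmax a b -> is_cderive f (z + t * v)%C (df (z + t * v)%C)) ->
  (forall t, Rmin a b <= t <= Rmax a b -> ccontinuous df (z + t * v)%C) ->
  is_Cint (fun t => v * df (z + t * v))%C a b (f (z + b * v) - f (z + a * v))%C.
Proof.
intros Hd Hc.
assert (G : forall k : C, is_RInt (fun t => Re (k * (v * df (z + t * v)%C))) a b
   (minus (Re (k * f (z + b * v)%C)) (Re (k * f (z + a * v)%C)))).
{ intros k.
  apply (@is_RInt_derive R_CompleteNormedModule (fun t => Re (k * f (z + t * v)%C))).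
  - intros t Ht. apply is_derive_line. auto.
  - intros t Ht.
    assert (Cc : ccontinuous (fun w => k * (v * df w))%C (z + t * v)%C).
    { apply (@continuous_comp C_UniformSpace C_UniformSpace C_UniformSpace df (fun w => k * (v * w))%C). now apply Hc.
      eapply is_cderive_continuous. apply is_cderive_scal, is_cderive_scal, is_cderive_id. }
    assert (Cr := rcontinuous_comp _ _ t Cc (rcontinuous_line z v t)). 
    intros P [e He]. rewrite rcontinuous_iff in Cr. destruct (Cr e (cond_pos e)) as [d [Hd' H]].
    exists (mkposreal d Hd'). intros s Hs. apply He. specialize (H s Hs).
    eapply Rle_lt_trans; [|apply H]. eapply Rle_trans; [|apply re_le_Cmod]. right. reflexivity. }
apply is_Cint_intro.
- specialize (G (RtoC 1)). rewrite !Re_1_mult in G.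
  eapply is_RInt_ext; [|exact G]. intros t _. cbv beta. now rewrite Re_1_mult.
- specialize (G (- Ci)%C).
  assert (E : forall w, Re (- Ci * w) = Im w).
  { intros w. rewrite re_mult. simpl. ring. }
  rewrite !E in G.
  eapply is_RInt_ext; [|exact G]. intros t _. cbv beta. now rewrite E.
Qed.

(** * Goursat's theorem on rectangles *)

Definition pt (x y : R) : C := (x + y * Ci)%C.

Definition in_rect (a b c d : R) (w : C) : Prop :=
  exists x y, a <= x <= b /\ c <= y <= d /\ w = pt x y.

(** The contour integral along the boundary, counterclockwise; on vertical
    sides [dz] is [Ci * dy]. *)
Definition rect_integral h (a b c d : R) : C :=
  (Cint (fun x => h (pt x c)) a b - Cint (fun x => h (pt x d)) a b
   + Ci * (Cint (fun y => h (pt b y)) c d - Cint (fun y => h (pt a y)) c d))%C.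

Lemma pt_h x y : pt x y = (y * Ci + x * 1)%C.
Proof. unfold pt. ring. Qed.

Lemma pt_dist x y x' y' : Cmod (pt x y - pt x' y') <= Rabs (x - x') + Rabs (y - y').
Proof.
unfold pt. replace (x + y * Ci - (x' + y' * Ci))%C with (RtoC (x - x') + RtoC (y - y') * Ci)%C.
2:{ rewrite !RtoC_minus. ring. }
eapply Rle_trans; [apply Cmod_triangle|]. rewrite Cmod_mult, !Cmod_R, Cmod_Ci. lra.
Qed.

Lemma is_Cint_pt_h h a b y : a <= b ->
  (forall x, a <= x <= b -> ccontinuous h (pt x y)) ->
  is_Cint (fun x => h (pt x y)) a b (Cint (fun x => h (pt x y)) a b).
Proof.
intros Hab H. apply is_Cint_Cint. intros x Hx.
rewrite Rmin_left, Rmax_right in Hx by auto.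
apply (rcontinuous_comp h (fun x => pt x y)). auto.
apply (@continuous_ext R_UniformSpace C_UniformSpace (fun x => RtoC y * Ci + x * 1)%C).
intros t; now rewrite pt_h. apply rcontinuous_line.
Qed.

Lemma is_Cint_pt_v h c d x : c <= d ->
  (forall y, c <= y <= d -> ccontinuous h (pt x y)) ->
  is_Cint (fun y => h (pt x y)) c d (Cint (fun y => h (pt x y)) c d).
Proof.
intros Hcd H. apply is_Cint_Cint. intros y Hy.
rewrite Rmin_left, Rmax_right in Hy by auto.
apply (rcontinuous_comp h (fun y => pt x y)). auto. apply rcontinuous_line.
Qed.

Lemma rect_integral_primitive (G k : C -> C) a b c d : a <= b -> c <= d ->
  (forall w, in_rect a b c d w -> is_cderive G w (k w)) ->
  (forall w, in_rect a b c d w -> ccontinuous k w) ->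
  rect_integral k a b c d = 0.
Proof.
intros Hab Hcd HG Hk.
assert (Hh : forall y, c <= y <= d ->
  Cint (fun x => k (pt x y)) a b = (G (pt b y) - G (pt a y))%C).
{ intros y Hy. apply is_Cint_unique.
  assert (I := is_Cint_line G k (y * Ci) (RtoC 1) a b).
  rewrite Rmin_left, Rmax_right in I by auto.
  rewrite !pt_h. eapply is_Cint_ext; [|apply I].
  - intros t _. simpl. rewrite Cmult_1_l. now rewrite pt_h.
  - intros t Ht. rewrite <- pt_h. apply HG. exists t, y; auto.
  - intros t Ht. rewrite <- pt_h. apply Hk. exists t, y; auto. }
assert (Hv : forall x, a <= x <= b ->
  (Ci * Cint (fun y => k (pt x y)) c d = G (pt x d) - G (pt x c))%C).
{ intros x Hx.
  assert (I := is_Cint_line G k (RtoC x) Ci c d).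
  rewrite Rmin_left, Rmax_right in I by auto.
  assert (I' : is_Cint (fun y => Ci * k (pt x y))%C c d (G (pt x d) - G (pt x c))%C).
  { apply I; intros t Ht; [apply HG|apply Hk]; exists x, t; auto. }
  rewrite <- (is_Cint_unique _ _ _ _ I'). symmetry. apply is_Cint_unique, is_Cint_scal.
  apply is_Cint_pt_v; auto. intros y Hy. apply Hk. exists x, y; auto. }
unfold rect_integral. rewrite !Hh by lra.
replace (Ci * (Cint (fun y => k (pt b y)) c d - Cint (fun y => k (pt a y)) c d))%C with
 (Ci * Cint (fun y => k (pt b y)) c d - Ci * Cint (fun y => k (pt a y)) c d)%C by ring.
rewrite !Hv by lra. ring.
Qed.

Lemma rect_integral_bound k a b c d M : a <= b -> c <= d ->
  (forall w, in_rect a b c d w -> ccontinuous k w) ->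
  (forall w, in_rect a b c d w -> Cmod (k w) <= M) ->
  Cmod (rect_integral k a b c d) <= 2 * ((b - a) + (d - c)) * M.
Proof.
intros Hab Hcd Hk HM.
assert (Hh : forall y, c <= y <= d -> Cmod (Cint (fun x => k (pt x y)) a b) <= (b - a) * M).
{ intros y Hy. eapply is_Cint_bound; [exact Hab| |].
  apply is_Cint_pt_h; auto. intros x Hx; apply Hk; exists x, y; auto.
  intros x Hx. apply HM; exists x, y; auto. }
assert (Hv : forall x, a <= x <= b -> Cmod (Cint (fun y => k (pt x y)) c d) <= (d - c) * M).
{ intros x Hx. eapply is_Cint_bound; [exact Hcd| |].
  apply is_Cint_pt_v; auto. intros y Hy; apply Hk; exists x, y; auto.
  intros y Hy. apply HM; exists x, y; auto. }
unfold rect_integral. eapply Rle_trans; [apply Cmod_triangle|].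
rewrite Cmod_mult, Cmod_Ci, Rmult_1_l.
unfold Cminus. 
pose proof (Cmod_triangle (Cint (fun x => k (pt x c)) a b) (- Cint (fun x => k (pt x d)) a b)).
pose proof (Cmod_triangle (Cint (fun y => k (pt b y)) c d) (- Cint (fun y => k (pt a y)) c d)).
rewrite Cmod_opp in H, H0.
pose proof (Hh c ltac:(lra)). pose proof (Hh d ltac:(lra)).
pose proof (Hv a ltac:(lra)). pose proof (Hv b ltac:(lra)). lra.
Qed.

Lemma rect_integral_minus f g a b c d : a <= b -> c <= d ->
  (forall w, in_rect a b c d w -> ccontinuous f w) ->
  (forall w, in_rect a b c d w -> ccontinuous g w) ->
  rect_integral (fun w => f w - g w)%C a b c d =
  (rect_integral f a b c d - rect_integral g a b c d)%C.
Proof.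
intros Hab Hcd Hf Hg.
assert (Hh : forall y, c <= y <= d -> Cint (fun x => f (pt x y) - g (pt x y))%C a b =
   (Cint (fun x => f (pt x y)) a b - Cint (fun x => g (pt x y)) a b)%C).
{ intros y Hy. apply is_Cint_unique, is_Cint_minus; apply is_Cint_pt_h; auto;
   intros x Hx; [apply Hf|apply Hg]; exists x, y; auto. }
assert (Hv : forall x, a <= x <= b -> Cint (fun y => f (pt x y) - g (pt x y))%C c d =
   (Cint (fun y => f (pt x y)) c d - Cint (fun y => g (pt x y)) c d)%C).
{ intros x Hx. apply is_Cint_unique, is_Cint_minus; apply is_Cint_pt_v; auto;
   intros y Hy; [apply Hf|apply Hg]; exists x, y; auto. }
unfold rect_integral. rewrite !Hh, !Hv by lra. ring.
Qed.

Lemma rect_integral_quarter h a b c d : a <= b -> c <= d ->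
  (forall w, in_rect a b c d w -> ccontinuous h w) ->
  let m := (a + b) / 2 in let n := (c + d) / 2 in
  rect_integral h a b c d =
  (rect_integral h a m c n + rect_integral h m b c n
   + (rect_integral h a m n d + rect_integral h m b n d))%C.
Proof.
intros Hab Hcd Hc m n.
assert (a <= m <= b) by (unfold m; lra). assert (c <= n <= d) by (unfold n; lra).
assert (Hh : forall y, c <= y <= d -> Cint (fun x => h (pt x y)) a b =
   (Cint (fun x => h (pt x y)) a m + Cint (fun x => h (pt x y)) m b)%C).
{ intros y Hy. apply is_Cint_unique. eapply is_Cint_Chasles; apply is_Cint_pt_h; try lra;
   intros x Hx; apply Hc; exists x, y; repeat split; lra. }
assert (Hv : forall x, a <= x <= b -> Cint (fun y => h (pt x y)) c d =
   (Cint (fun y => h (pt x y)) c n + Cint (fun y => h (pt x y)) n d)%C).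
{ intros x Hx. apply is_Cint_unique. eapply is_Cint_Chasles; apply is_Cint_pt_v; try lra;
   intros y Hy; apply Hc; exists x, y; repeat split; lra. }
unfold rect_integral. rewrite !(Hh c), !(Hh d), !(Hv a), !(Hv b) by lra. ring.
Qed.

(** Quartering keeps a proportion of the boundary integral relative to the
    area; near the limit point the function is affine up to an error that is
    small relative to the diameter. *)
Theorem goursat h a b c d : a < b -> c < d ->
  (forall w, in_rect a b c d w -> ex_cderive h w) ->
  rect_integral h a b c d = 0.
Proof.
intros Hab Hcd Hh.
assert (Hcont : forall w, in_rect a b c d w -> ccontinuous h w).
{ intros w Hw. destruct (Hh w Hw) as [l Hl]. eapply is_cderive_continuous; eauto. }
apply NNPP. intros Hn. apply Cmod_gt_0 in Hn.
set (e := Cmod (rect_integral h a b c d) / ((b - a) * (d - c))).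
assert (Harea : 0 < (b - a) * (d - c)) by (apply Rmult_lt_0_compat; lra).
assert (He : 0 < e) by (apply Rdiv_lt_0_compat; auto).
destruct (bisection (fun a b c d => e * ((b - a) * (d - c)) <= Cmod (rect_integral h a b c d)) a b c d)
  as [x [y Hxy]]; try lra.
- intros a' b' c' d' H1 H2 H3 H4 H5 H6 HB.
  apply NNPP. intros HH. 
  apply not_or_and in HH as [N1 HH]. apply not_or_and in HH as [N2 HH].
  apply not_or_and in HH as [N3 N4].
  apply Rnot_le_lt in N1. apply Rnot_le_lt in N2. apply Rnot_le_lt in N3. apply Rnot_le_lt in N4.
  rewrite rect_integral_quarter in HB; auto.
  2:{ intros w (x & y & Hx & Hy & ->). apply Hcont. exists x, y. repeat split; lra. }
  cbv zeta in HB.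
  match type of HB with _ <= Cmod (?A + ?B + (?C + ?D)) => 
    pose proof (Cmod_triangle (A + B) (C + D)); pose proof (Cmod_triangle A B);
    pose proof (Cmod_triangle C D) end.
  nra.
- right. unfold e. field. lra.
- assert (Hp : in_rect a b c d (pt x y)).
  { destruct (Hxy O) as (a' & b' & c' & d' & _ & H). exists x, y. repeat split; lra. }
  destruct (Hh _ Hp) as [l Hl]. set (p := pt x y) in *.
  set (LL := (b - a) + (d - c)).
  assert (HLL : 0 < LL) by (unfold LL; lra).
  (* in every rectangle of these proportions, the perimeter times [e'] times
     the diameter is at most half of [e] times the area *)
  set (e' := e * ((b - a) * (d - c)) / (4 * (LL * LL))).
  assert (HLL2 : 0 < 4 * (LL * LL)) by nra.
  assert (He' : 0 < e') by (apply Rdiv_lt_0_compat; nra).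
  rewrite is_cderive_iff in Hl. destruct (Hl e' He') as [dl [Hdl Hl']].
  destruct (pow2_small LL dl Hdl) as [n Hn'].
  destruct (Hxy n) as (a' & b' & c' & d' & HB & H1 & H2 & H3 & H4 & H5 & H6).
  assert (P2 : 0 < 2 ^ n) by (apply pow_lt; lra).
  set (q := / 2 ^ n) in *.
  assert (Hq : 0 < q) by now apply Rinv_0_lt_compat.
  unfold Rdiv in H5, H6, Hn'. fold q in H5, H6, Hn'.
  assert (Hsub : forall w, in_rect a' b' c' d' w -> in_rect a b c d w).
  { intros w (u & v & Hu & Hv & ->). exists u, v; repeat split; lra. }
  set (A := fun w => (h p + (w - p) * l)%C).
  assert (CA : forall w, ccontinuous A w).
  { intros w. unfold A. eapply is_cderive_continuous.
    apply is_cderive_plus; [apply is_cderive_const|].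
    apply (is_cderive_mult (fun w => w - p)%C (fun w => l)); [|apply is_cderive_const].
    apply is_cderive_minus; [apply is_cderive_id|apply is_cderive_const]. }
  assert (HA : rect_integral A a' b' c' d' = 0).
  { (* an affine function has a quadratic primitive *)
    apply rect_integral_primitive with (G := fun w => (h p * w + l * / 2 * ((w - p) * (w - p)))%C); try lra.
    - intros w _. unfold A.
      assert (T2 : RtoC 2 <> 0) by (apply RtoC_neq_0; lra).
      replace (h p + (w - p) * l)%C with
        (h p * 1 + l * / 2 * ((1 - 0) * (w - p) + (w - p) * (1 - 0)))%C by (field; auto).
      apply is_cderive_plus. apply is_cderive_scal, is_cderive_id.
      apply is_cderive_scal.
      apply (is_cderive_mult (fun w => w - p)%C (fun w => w - p)%C);
       (apply is_cderive_minus; [apply is_cderive_id|apply is_cderive_const]).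
    - intros w _. apply CA. }
  assert (E : rect_integral h a' b' c' d' = rect_integral (fun w => h w - A w)%C a' b' c' d').
  { rewrite rect_integral_minus; try lra. rewrite HA. ring. auto. auto. }
  rewrite E in HB.
  assert (Bd : Cmod (rect_integral (fun w => h w - A w)%C a' b' c' d') <=
     2 * ((b' - a') + (d' - c')) * (e' * (LL * q))).
  { apply rect_integral_bound; try lra.
    - intros w Hw. apply (@continuous_minus C_UniformSpace C_AbsRing C_NormedModule); auto.
    - intros w (u & v & Hu & Hv & ->).
      assert (Hd : Cmod (pt u v - p) <= LL * q).
      { eapply Rle_trans; [apply pt_dist|].
        assert (Rabs (u - x) <= b' - a') by (apply Rabs_le_between; lra).
        assert (Rabs (v - y) <= d' - c') by (apply Rabs_le_between; lra).
        unfold LL. rewrite Rmult_plus_distr_r. lra. }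
      assert (Hd2 : Cmod (pt u v - p) < dl) by lra.
      specialize (Hl' _ Hd2). unfold A.
      replace (p + (pt u v - p))%C with (pt u v) in Hl' by ring.
      replace (h (pt u v) - (h p + (pt u v - p) * l))%C with
       (h (pt u v) - h p - (pt u v - p) * l)%C by ring.
      eapply Rle_trans; [apply Hl'|]. apply Rmult_le_compat_l; lra. }
  rewrite H5, H6 in HB, Bd.
  replace (2 * ((b - a) * q + (d - c) * q) * (e' * (LL * q))) with
    (e * ((b - a) * (d - c)) / 2 * (q * q)) in Bd.
  2:{ unfold e'. fold LL. replace ((b - a) * q + (d - c) * q) with (LL * q) by (unfold LL; ring).
      field. lra. }
  assert (0 < e * ((b - a) * (d - c)) * (q * q)).
  { apply Rmult_lt_0_compat; apply Rmult_lt_0_compat; assumption. }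
  nra.
Qed.

(** * The complex exponential *)

Definition cis (t : R) : C := (cos t, sin t).
Definition Cexp z : C := (RtoC (exp (Re z)) * cis (Im z))%C.

Lemma Cmod_cis t : Cmod (cis t) = 1.
Proof.
unfold Cmod, cis; simpl. rewrite !Rmult_1_r.
replace (cos t * cos t + sin t * sin t) with 1. apply sqrt_1.
pose proof (sin2_cos2 t). unfold Rsqr in H. lra.
Qed.

Lemma cis_plus s t : cis (s + t) = (cis s * cis t)%C.
Proof. unfold cis, Cmult; simpl. rewrite cos_plus, sin_plus. f_equal; ring. Qed.

Lemma Cexp_plus z w : Cexp (z + w) = (Cexp z * Cexp w)%C.
Proof.
unfold Cexp. rewrite re_plus, im_plus, exp_plus, cis_plus, RtoC_mult. ring.
Qed.

Lemma Cexp_0 : Cexp 0 = 1.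
Proof.
unfold Cexp, cis; simpl. rewrite exp_0, cos_0, sin_0. unfold Cmult, RtoC; simpl. f_equal; ring.
Qed.

Lemma Cexp_neq_0 z : Cexp z <> 0.
Proof.
intros H. apply C1_nz. rewrite <- Cexp_0.
replace (RtoC 0) with (z + - z)%C by ring. rewrite Cexp_plus, H. ring.
Qed.

Lemma Cexp_opp z : Cexp (- z) = (/ Cexp z)%C.
Proof.
assert (H : (Cexp z * Cexp (- z))%C = 1).
{ rewrite <- Cexp_plus, <- Cexp_0. f_equal. ring. }
replace (Cexp (- z)) with (/ Cexp z * (Cexp z * Cexp (- z)))%C.
rewrite H. ring. field. apply Cexp_neq_0.
Qed.

Lemma Cmod_Cexp z : Cmod (Cexp z) = exp (Re z).
Proof.
unfold Cexp. rewrite Cmod_mult, Cmod_cis, Cmod_R, Rmult_1_r.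
apply Rabs_right, Rle_ge, Rlt_le, exp_pos.
Qed.

Lemma derivable_first_order (u : R -> R) (x l eps : R) : derivable_pt_lim u x l -> 0 < eps ->
  exists d, 0 < d /\ forall h : R, Rabs h < d -> Rabs (u (x + h) - u x - l * h) <= eps * Rabs h.
Proof.
intros Hu He. destruct (Hu eps He) as [d Hd]. exists d. split; [apply cond_pos|]. intros h Hh.
destruct (Req_dec h 0) as [->|Hn].
- rewrite Rplus_0_r. replace (u x - u x - l * 0) with 0 by ring. rewrite Rabs_R0. lra.
- replace (u (x + h) - u x - l * h) with (((u (x + h) - u x) / h - l) * h) by (field; auto).
  rewrite Rabs_mult. apply Rmult_le_compat_r; [apply Rabs_pos|]. left. auto.
Qed.

Lemma exp_le_mono x y : x <= y -> exp x <= exp y.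
Proof. intros [H| ->]; [left; now apply exp_increasing|right; reflexivity]. Qed.

(** The addition theorem reduces differentiability to the origin, where it
    follows from the derivatives of [exp], [cos] and [sin] at 0. *)
Lemma is_cderive_Cexp_0 : is_cderive Cexp (RtoC 0) (RtoC 1).
Proof.
apply is_cderive_iff. intros eps0 He0.
(* the errors add up to at most [9 * eps * Cmod h] *)
set (eps := Rmin 1 (eps0 / 9)).
assert (He : 0 < eps) by (apply Rmin_glb_lt; lra).
assert (He1 : eps <= 1) by apply Rmin_l.
assert (He9 : 9 * eps <= eps0) by (pose proof (Rmin_r 1 (eps0 / 9)); unfold eps; lra).
destruct (derivable_first_order exp 0 1 eps) as [d1 [Hd1 H1]]; auto.
{ rewrite <- exp_0. apply derivable_pt_lim_exp. }
destruct (derivable_first_order cos 0 0 eps) as [d2 [Hd2 H2]]; auto.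
{ rewrite <- Ropp_0, <- sin_0 at 2. apply derivable_pt_lim_cos. }
destruct (derivable_first_order sin 0 1 eps) as [d3 [Hd3 H3]]; auto.
{ rewrite <- cos_0. apply derivable_pt_lim_sin. }
exists (Rmin eps (Rmin d1 (Rmin d2 d3))).
split.
{ apply Rmin_glb_lt; [exact He|]. repeat apply Rmin_glb_lt; auto. }
intros h Hh.
apply Rlt_Rmin in Hh as [L0 Hh]. apply Rlt_Rmin in Hh as [L1 Hh]. apply Rlt_Rmin in Hh as [L2 L3].
pose proof (re_le_Cmod h) as Hx. pose proof (im_le_Cmod h) as Hy.
destruct h as [x y]. simpl in Hx, Hy. set (m := Cmod (x, y)) in *.
assert (E1 : Rabs (exp x - 1 - x) <= eps * m).
{ specialize (H1 x ltac:(lra)). rewrite Rplus_0_l, exp_0, Rmult_1_l in H1. nra. }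
assert (E2 : Rabs (cos y - 1) <= eps * m).
{ specialize (H2 y ltac:(lra)). rewrite Rplus_0_l, cos_0, Rmult_0_l, Rminus_0_r in H2. nra. }
assert (E3 : Rabs (sin y - y) <= eps * m).
{ specialize (H3 y ltac:(lra)). rewrite Rplus_0_l, sin_0, Rmult_1_l, Rminus_0_r in H3. nra. }
assert (Hm : 0 <= m) by apply Cmod_ge_0.
assert (E4 : 0 < exp x <= 3).
{ split; [apply exp_pos|]. apply Rle_trans with (exp 1); [|apply exp_le_3].
  apply exp_le_mono. apply Rabs_le_between in Hx. lra. }
assert (E5 : Rabs (exp x - 1) <= 2 * m).
{ replace (exp x - 1) with ((exp x - 1 - x) + x) by ring.
  eapply Rle_trans; [apply Rabs_triang|]. nra. }
eapply Rle_trans; [apply Cmod_le_sum|].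
rewrite Cplus_0_l, Cexp_0.
replace (Re (Cexp (x, y) - 1 - (x, y) * 1)) with ((exp x - 1 - x) + exp x * (cos y - 1)).
2:{ unfold Cexp, cis, Cmult, Cminus, Cplus, Copp, RtoC; simpl. ring. }
replace (Im (Cexp (x, y) - 1 - (x, y) * 1)) with (exp x * (sin y - y) + (exp x - 1) * y).
2:{ unfold Cexp, cis, Cmult, Cminus, Cplus, Copp, RtoC; simpl. ring. }
assert (F1 := Rabs_triang (exp x - 1 - x) (exp x * (cos y - 1))).
assert (F2 := Rabs_triang (exp x * (sin y - y)) ((exp x - 1) * y)).
rewrite !Rabs_mult, (Rabs_right (exp x)) in F1, F2 by lra.
assert (exp x * Rabs (cos y - 1) <= 3 * (eps * m)).
{ apply Rmult_le_compat; try lra; apply Rabs_pos. }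
assert (exp x * Rabs (sin y - y) <= 3 * (eps * m)).
{ apply Rmult_le_compat; try lra; apply Rabs_pos. }
assert (Rabs (exp x - 1) * Rabs y <= (2 * m) * eps).
{ apply Rmult_le_compat; try lra; apply Rabs_pos. }
assert (9 * eps * m <= eps0 * m) by (apply Rmult_le_compat_r; lra).
fold m. rewrite (Rabs_mult (exp x - 1) y) in F2. lra.
Qed.

Lemma is_cderive_Cexp z : is_cderive Cexp z (Cexp z).
Proof.
assert (H := is_cderive_Cexp_0). rewrite is_cderive_iff in *. intros eps He.
pose proof (Cmod_ge_0 (Cexp z)).
destruct (H (eps / (1 + Cmod (Cexp z)))) as [d [Hd H']].
{ apply Rdiv_lt_0_compat; lra. }
exists d. split; auto. intros h Hh. specialize (H' h Hh).
rewrite Cplus_0_l, Cexp_0 in H'.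
replace (Cexp (z + h) - Cexp z - h * Cexp z)%C with (Cexp z * (Cexp h - 1 - h * 1))%C
  by (rewrite Cexp_plus; ring).
rewrite Cmod_mult. pose proof (Cmod_ge_0 h).
apply Rle_trans with (Cmod (Cexp z) * (eps / (1 + Cmod (Cexp z)) * Cmod h)).
apply Rmult_le_compat_l; auto.
replace (Cmod (Cexp z) * (eps / (1 + Cmod (Cexp z)) * Cmod h)) with
  ((eps * Cmod h) * (Cmod (Cexp z) / (1 + Cmod (Cexp z)))) by (field; lra).
rewrite <- (Rmult_1_r (eps * Cmod h)) at 2. apply Rmult_le_compat_l; [nra|].
apply Rle_div_l; lra.
Qed.

(** * Integrals over circles and Cauchy's formula *)

(** The integral is taken against the angle, so that it is [2 * PI] times
    the mean value over the circle. *)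
Definition circle_integral f (r : R) : C := Cint (fun t => f (r * cis t)%C) 0 (2 * PI).

Lemma Cmod_circle r t : 0 <= r -> Cmod (r * cis t) = r.
Proof. intros Hr. rewrite Cmod_mult, Cmod_cis, Cmod_RtoC; lra. Qed.

Lemma Re_pt x y : Re (pt x y) = x.
Proof. unfold pt; simpl. ring. Qed.
Lemma Im_pt x y : Im (pt x y) = y.
Proof. unfold pt; simpl. ring. Qed.

Lemma Cexp_pt x y : Cexp (pt x y) = (RtoC (exp x) * cis y)%C.
Proof. unfold Cexp. now rewrite Re_pt, Im_pt. Qed.

Lemma rcontinuous_cis r t : rcontinuous (fun s => RtoC r * cis s)%C t.
Proof.
apply (@continuous_ext R_UniformSpace C_UniformSpace
  (fun s => RtoC r * Cexp (0 + s * Ci))%C).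
- intros s. f_equal. change (Cexp (pt 0 s) = cis s). rewrite Cexp_pt, exp_0. ring.
- apply (rcontinuous_comp (fun w => RtoC r * Cexp w)%C); [|apply rcontinuous_line].
  eapply is_cderive_continuous. apply is_cderive_scal, is_cderive_Cexp.
Qed.

Lemma two_PI_pos : 0 < 2 * PI.
Proof. pose proof PI_RGT_0. lra. Qed.

Lemma is_circle_integral f r : 0 <= r -> (forall z, Cmod z = r -> ccontinuous f z) ->
  is_Cint (fun t => f (r * cis t)%C) 0 (2 * PI) (circle_integral f r).
Proof.
intros Hr H. apply is_Cint_Cint. intros t _.
apply (rcontinuous_comp f (fun t => RtoC r * cis t)%C).
apply H. now apply Cmod_circle. apply rcontinuous_cis.
Qed.

Lemma circle_integral_ext f g r : 0 <= r -> (forall z, Cmod z = r -> f z = g z) ->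
  circle_integral f r = circle_integral g r.
Proof.
intros Hr H. apply (@RInt_ext C_R_CompleteNormedModule). intros t _. apply H. now apply Cmod_circle.
Qed.

Lemma circle_integral_bound f r M : 0 <= r -> (forall z, Cmod z = r -> ccontinuous f z) ->
  (forall z, Cmod z = r -> Cmod (f z) <= M) -> Cmod (circle_integral f r) <= 2 * PI * M.
Proof.
intros Hr Hc HM. replace (2 * PI) with (2 * PI - 0) by ring.
eapply is_Cint_bound. pose proof two_PI_pos; lra.
now apply is_circle_integral. intros t _. apply HM. now apply Cmod_circle.
Qed.

Lemma circle_integral_minus f g r : 0 <= r -> (forall z, Cmod z = r -> ccontinuous f z) ->
  (forall z, Cmod z = r -> ccontinuous g z) ->
  circle_integral (fun z => f z - g z)%C r = (circle_integral f r - circle_integral g r)%C.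
Proof.
intros Hr Hf Hg. apply is_Cint_unique.
apply (is_Cint_minus (fun t => f (r * cis t)%C) (fun t => g (r * cis t)%C));
 now apply is_circle_integral.
Qed.

Lemma circle_integral_scal k f r : 0 <= r -> (forall z, Cmod z = r -> ccontinuous f z) ->
  circle_integral (fun z => k * f z)%C r = (k * circle_integral f r)%C.
Proof.
intros Hr Hf. apply is_Cint_unique.
apply (is_Cint_scal k (fun t => f (r * cis t)%C)). now apply is_circle_integral.
Qed.

Lemma circle_integral_const k r : circle_integral (fun _ => k) r = (RtoC (2 * PI) * k)%C.
Proof.
apply is_Cint_unique. replace (2 * PI) with (2 * PI - 0) at 2 by ring. apply is_Cint_const.
Qed.

(** In the coordinate [log z] an annulus is a rectangle whose horizontal
    sides carry the same values. *)
Lemma circle_integral_annulus f r1 r2 : 0 < r1 <= r2 ->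
  (forall z, r1 <= Cmod z <= r2 -> ex_cderive f z) ->
  circle_integral f r1 = circle_integral f r2.
Proof.
intros [H1 H12] Hf. destruct (Rle_lt_or_eq_dec _ _ H12) as [Hlt| ->]; [|reflexivity].
assert (G := goursat (fun w => f (Cexp w)) (ln r1) (ln r2) 0 (2 * PI)
  (ln_increasing _ _ H1 Hlt) two_PI_pos).
assert (Hd : forall w, in_rect (ln r1) (ln r2) 0 (2 * PI) w -> ex_cderive (fun w => f (Cexp w)) w).
{ intros w (x & y & Hx & Hy & ->).
  destruct (Hf (Cexp (pt x y))) as [l Hl].
  - rewrite Cmod_Cexp, Re_pt. rewrite <- (exp_ln r1), <- (exp_ln r2) by lra.
    split; apply exp_le_mono; lra.
  - eexists. apply is_cderive_comp; [exact Hl|apply is_cderive_Cexp]. }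
specialize (G Hd). unfold rect_integral in G.
assert (E : Cint (fun x => f (Cexp (pt x 0))) (ln r1) (ln r2) =
            Cint (fun x => f (Cexp (pt x (2 * PI)))) (ln r1) (ln r2)).
{ apply (@RInt_ext C_R_CompleteNormedModule). intros x _. rewrite !Cexp_pt.
  unfold cis. now rewrite cos_2PI, sin_2PI, cos_0, sin_0. }
rewrite E in G.
assert (Er : forall r, 0 < r -> circle_integral f r = Cint (fun y => f (Cexp (pt (ln r) y))) 0 (2 * PI)).
{ intros r Hr. apply (@RInt_ext C_R_CompleteNormedModule). intros t _.
  rewrite Cexp_pt, exp_ln; auto. }
rewrite !Er by lra.
set (A := Cint (fun y => f (Cexp (pt (ln r1) y))) 0 (2 * PI)) in *.
set (B := Cint (fun y => f (Cexp (pt (ln r2) y))) 0 (2 * PI)) in *.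
set (X := Cint (fun x => f (Cexp (pt x (2 * PI)))) (ln r1) (ln r2)) in *.
assert (G2 : (Ci * (B - A) = 0)%C) by (rewrite <- G; ring).
replace A with (B - (- Ci) * (Ci * (B - A)))%C.
rewrite G2. ring.
replace (- Ci * (Ci * (B - A)))%C with (- (Ci * Ci) * (B - A))%C by ring.
replace (Ci * Ci)%C with (- RtoC 1)%C by (unfold Ci, Cmult, RtoC, Copp; simpl; f_equal; ring).
ring.
Qed.

Lemma Cmod_small_0 z : (forall eps, 0 < eps -> Cmod z <= eps) -> z = 0.
Proof.
intros H. apply Cmod_eq_0. apply Rle_antisym; [|apply Cmod_ge_0].
apply le_epsilon. intros eps He. rewrite Rplus_0_l. auto.
Qed.

(** The integral over the circle of radius [r] is constant on either side of
    [Cmod a], it is continuous in [r], and it tends to 0 at the centre. *)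
Lemma circle_integral_vanish (k : C -> C) a r : 0 < r < 1 -> r <> Cmod a ->
  (forall z, Cmod z < 1 -> ccontinuous k z) -> k 0 = 0 ->
  (forall z, Cmod z < 1 -> z <> a -> ex_cderive k z) ->
  circle_integral k r = 0.
Proof.
intros Hr Hra Hc H0 Hd. apply Cmod_small_0. intros eps0 He0.
pose proof two_PI_pos as HPI.
set (eps := eps0 / (2 * (2 * PI))).
assert (He : 0 < eps) by (apply Rdiv_lt_0_compat; lra).
destruct (disc_uniform_continuity r k) with (eps := eps) as [d [Hd0 Hu]]; auto.
{ intros z Hz. apply Hc. lra. }
assert (Hann : forall r1 r2, 0 < r1 <= r2 -> r2 <= r -> (r2 < Cmod a \/ Cmod a < r1) ->
  circle_integral k r1 = circle_integral k r2).
{ intros r1 r2 H1 H2 H3. apply circle_integral_annulus; auto. intros z Hz. apply Hd; [lra|].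
  intros ->. lra. }
assert (HS : forall p, 0 < p <= r -> (p < Cmod a \/ Cmod a = 0) ->
   Cmod (circle_integral k p) <= 2 * PI * eps).
{ intros p Hp Hpa. set (p' := Rmin p (d / 2)).
  assert (0 < p') by (apply Rmin_glb_lt; lra).
  assert (p' <= p) by apply Rmin_l. assert (p' <= d / 2) by apply Rmin_r.
  rewrite <- (Hann p' p) by lra. apply circle_integral_bound; [lra| |].
  intros z Hz; apply Hc; lra.
  intros z Hz. left. replace (k z) with (k z - k 0)%C by (rewrite H0; ring).
  apply Hu; [rewrite Cmod_0; lra|lra|]. replace (z - 0)%C with z by ring. lra. }
assert (E : 2 * PI * eps + 2 * PI * eps = eps0) by (unfold eps; field; lra).
assert (0 < 2 * PI * eps) by (apply Rmult_lt_0_compat; auto).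
pose proof (Cmod_ge_0 a) as Ha.
destruct (Rle_lt_dec (Cmod a) 0) as [Ha0|Ha0].
{ assert (Cmod a = 0) by lra. pose proof (HS r). lra. }
destruct (Rlt_le_dec r (Cmod a)) as [Hlt|Hle].
{ pose proof (HS r). lra. }
set (p2 := Rmin r (Cmod a + d / 3)). set (p1 := Rmax (Cmod a / 2) (Cmod a - d / 3)).
assert (Cmod a < p2) by (apply Rmin_glb_lt; lra).
assert (p2 <= r) by apply Rmin_l. assert (p2 <= Cmod a + d / 3) by apply Rmin_r.
assert (Cmod a / 2 <= p1) by apply Rmax_l. assert (Cmod a - d / 3 <= p1) by apply Rmax_r.
assert (p1 < Cmod a) by (apply Rmax_lub_lt; lra).
rewrite <- (Hann p2 r) by lra.
assert (Hp1 := HS p1 ltac:(lra) ltac:(lra)).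
assert (Cr : forall p, 0 < p <= r -> is_Cint (fun t => k (p * cis t)%C) 0 (2 * PI) (circle_integral k p)).
{ intros p Hp. apply is_circle_integral; [lra|]. intros z Hz; apply Hc; lra. }
assert (Hdiff : Cmod (circle_integral k p2 - circle_integral k p1) <= (2 * PI - 0) * eps).
{ eapply is_Cint_bound. lra. apply is_Cint_minus; apply Cr; lra.
  intros t _. left. apply Hu; try (rewrite Cmod_circle; lra).
  replace (p2 * cis t - p1 * cis t)%C with (RtoC (p2 - p1) * cis t)%C
    by (rewrite RtoC_minus; ring).
  rewrite Cmod_circle; lra. }
replace (circle_integral k p2) with
  ((circle_integral k p2 - circle_integral k p1) + circle_integral k p1)%C by ring.
eapply Rle_trans; [apply Cmod_triangle|]. lra.
Qed.

Lemma Cminus_neq_0 z w : z <> w -> (z - w)%C <> 0.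
Proof. apply Cminus_eq_contra. Qed.

Lemma ccontinuous_plus f g z : ccontinuous f z -> ccontinuous g z ->
  ccontinuous (fun w => f w + g w)%C z.
Proof. exact (@continuous_plus C_UniformSpace C_AbsRing C_NormedModule f g z). Qed.

Lemma ccontinuous_minus f g z : ccontinuous f z -> ccontinuous g z ->
  ccontinuous (fun w => f w - g w)%C z.
Proof. exact (@continuous_minus C_UniformSpace C_AbsRing C_NormedModule f g z). Qed.

Lemma ccontinuous_const a z : ccontinuous (fun _ => a) z.
Proof. eapply is_cderive_continuous, is_cderive_const. Qed.

Lemma ccontinuous_comp f g z : ccontinuous f (g z) -> ccontinuous g z ->
  ccontinuous (fun w => f (g w)) z.
Proof. intros Hf Hg. exact (@continuous_comp C_UniformSpace C_UniformSpace C_UniformSpace g f z Hg Hf). Qed.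

Lemma ccontinuous_scal a f z : ccontinuous f z -> ccontinuous (fun w => a * f w)%C z.
Proof.
intros H. apply (ccontinuous_comp (fun w => a * w)%C f); auto.
eapply is_cderive_continuous, is_cderive_scal, is_cderive_id.
Qed.

Lemma is_cderive_cauchy_kernel a z : z <> a -> is_cderive (fun w => w / (w - a))%C z
  ((1 * (z - a) - z * (1 - 0)) / ((z - a) * (z - a)))%C.
Proof.
intros H. apply (is_cderive_div (fun w => w) (fun w => w - a)%C).
apply is_cderive_id. apply is_cderive_minus; [apply is_cderive_id|apply is_cderive_const].
now apply Cminus_neq_0.
Qed.

Lemma Cmod_neq z a : Cmod z <> Cmod a -> z <> a.
Proof. congruence. Qed.

(** Blow the circle up to infinity. *)
Lemma circle_integral_cauchy_kernel a r : Cmod a < r ->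
  circle_integral (fun w => w / (w - a))%C r = RtoC (2 * PI).
Proof.
intros Har. pose proof (Cmod_ge_0 a) as Ha. pose proof two_PI_pos as HPI.
assert (H : (circle_integral (fun w => w / (w - a))%C r - RtoC (2 * PI) = 0)%C).
{ apply Cmod_small_0. intros eps0 He0. set (eps := eps0 / (2 * PI)).
  assert (He : 0 < eps) by (apply Rdiv_lt_0_compat; lra).
  set (R1 := Rmax r (Cmod a + Cmod a / eps)).
  assert (r <= R1) by apply Rmax_l. assert (Cmod a + Cmod a / eps <= R1) by apply Rmax_r.
  rewrite (circle_integral_annulus _ r R1) by
   (try lra; intros z Hz; eexists; apply is_cderive_cauchy_kernel; apply Cmod_neq; lra).
  replace (RtoC (2 * PI)) with (circle_integral (fun _ => RtoC 1) R1)
    by (rewrite circle_integral_const; ring).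
  rewrite <- circle_integral_minus.
  2: lra.
  2: { intros z Hz. eapply is_cderive_continuous, is_cderive_cauchy_kernel, Cmod_neq; lra. }
  2: { intros; apply ccontinuous_const. }
  replace eps0 with (2 * PI * eps) by (unfold eps; field; lra).
  apply circle_integral_bound. lra.
  - intros z Hz. apply ccontinuous_minus; [|apply ccontinuous_const].
    eapply is_cderive_continuous, is_cderive_cauchy_kernel, Cmod_neq; lra.
  - intros z Hz. assert (Hza : (z - a)%C <> 0) by (apply Cminus_neq_0, Cmod_neq; lra).
    replace (z / (z - a) - 1)%C with (a / (z - a))%C by (field; auto).
    rewrite Cmod_div by auto. pose proof (Cmod_lt_perturb (z - a) z).
    replace (z - (z - a))%C with a in H1 by ring.
    apply Rle_div_l; [lra|]. 
    assert (Cmod a <= eps * (R1 - Cmod a)).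
    { apply Rle_trans with (eps * (Cmod a / eps)). right; field; lra. apply Rmult_le_compat_l; lra. }
    nra. }
replace (circle_integral (fun w => w / (w - a))%C r) with
 ((circle_integral (fun w => w / (w - a))%C r - RtoC (2 * PI)) + RtoC (2 * PI))%C by ring.
rewrite H. ring.
Qed.

Lemma analytic_ccontinuous f z : analytic_in_disc f -> Cmod z < 1 -> ccontinuous f z.
Proof. intros Hf Hz. destruct (Hf z Hz) as [l Hl]. eapply is_cderive_continuous; eauto. Qed.

(** The function [w * (f w - f a) / (w - a)], extended by [a * f' a] at [a],
    is continuous, vanishes at 0 and is differentiable off [a], so its circle
    integrals vanish. *)
Theorem cauchy_formula f a r : analytic_in_disc f -> Cmod a < r -> r < 1 ->
  circle_integral (fun w => f w * (w / (w - a)))%C r = (RtoC (2 * PI) * f a)%C.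
Proof.
intros Hf Har Hr1. pose proof (Cmod_ge_0 a) as Ha.
assert (Da := ex_cderive_C_derive f a (Hf a (Rlt_trans _ _ _ Har Hr1))).
assert (Hfc : forall z, Cmod z < 1 -> ccontinuous f z).
{ intros z Hz. now apply analytic_ccontinuous. }
set (Q := fun w => if Ceq_dec w a then C_derive f a else ((f w - f a) / (w - a))%C).
assert (Qd : forall w, Cmod w < 1 -> w <> a -> ex_cderive Q w).
{ intros w Hw Hwa. destruct (Hf w Hw) as [l Hl].
  assert (Hwa' := Cminus_neq_0 _ _ Hwa).
  eexists. apply (is_cderive_ext_near (fun w => (f w - f a) / (w - a))%C Q w _ (Cmod (w - a))).
  - now apply Cmod_gt_0.
  - intros u Hu. unfold Q. destruct (Ceq_dec u a) as [->|]; auto.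
    exfalso. rewrite Cmod_minus_sym in Hu. lra.
  - apply (is_cderive_div (fun w => f w - f a)%C (fun w => w - a)%C); auto.
    apply is_cderive_minus; [exact Hl|apply is_cderive_const].
    apply is_cderive_minus; [apply is_cderive_id|apply is_cderive_const]. }
assert (Qc : ccontinuous Q a).
{ apply continuous_C_iff. intros eps He. rewrite is_cderive_iff in Da.
  destruct (Da (eps / 2)) as [d [Hd H]]; [lra|]. exists d; split; auto.
  intros w Hw. unfold Q. destruct (Ceq_dec a a) as [_|]; [|congruence].
  destruct (Ceq_dec w a) as [->|Hwa].
  - replace (C_derive f a - C_derive f a)%C with (RtoC 0) by ring. now rewrite Cmod_0.
  - specialize (H _ Hw). replace (a + (w - a))%C with w in H by ring.
    assert (Hwa' := Cminus_neq_0 _ _ Hwa).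
    replace ((f w - f a) / (w - a) - C_derive f a)%C with
      ((f w - f a - (w - a) * C_derive f a) / (w - a))%C by (field; auto).
    rewrite Cmod_div by auto. apply Cmod_gt_0 in Hwa'. apply Rlt_div_l; [auto|]. nra. }
(* off [a] this is the function above, in a form that is visibly continuous
   at [a] *)
assert (V := circle_integral_vanish (fun w => (f w - f a) + a * Q w)%C a r).
rewrite <- (circle_integral_cauchy_kernel a r Har).
assert (Hne : forall z, Cmod z = r -> z <> a) by (intros z Hz ->; lra).
assert (Hk : forall z, Cmod z = r -> ccontinuous (fun w => w / (w - a))%C z).
{ intros z Hz. eapply is_cderive_continuous, is_cderive_cauchy_kernel; auto. }
assert (Hfk : forall z, Cmod z = r -> ccontinuous (fun w => f w * (w / (w - a)))%C z).
{ intros z Hz. destruct (Hf z ltac:(unfold unit_disc; lra)) as [l Hl].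
  eapply is_cderive_continuous. 
  apply (is_cderive_mult f (fun w => w / (w - a))%C); [exact Hl|].
  apply is_cderive_cauchy_kernel; auto. }
assert (V' : circle_integral (fun w => f w * (w / (w - a)) - f a * (w / (w - a)))%C r = 0).
{ rewrite <- V.
  - apply circle_integral_ext; [lra|]. intros z Hz. unfold Q.
    destruct (Ceq_dec z a) as [E|E]; [now apply Hne in E|]. field. now apply Cminus_neq_0.
  - lra.
  - lra.
  - intros z Hz. apply ccontinuous_plus.
    apply ccontinuous_minus; [auto|apply ccontinuous_const].
    apply ccontinuous_scal. destruct (Ceq_dec z a) as [->|E]; auto.
    destruct (Qd z Hz E) as [l Hl]. eapply is_cderive_continuous; eauto.
  - unfold Q. destruct (Ceq_dec 0 a) as [<-|E]. ring. field.
    intros E'. apply E. replace a with (0 - (0 - a))%C by ring. rewrite E'. ring.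
  - intros z Hz E. destruct (Qd z Hz E) as [l Hl]. destruct (Hf z Hz) as [l' Hl'].
    eexists. apply is_cderive_plus.
    apply is_cderive_minus; [exact Hl'|apply is_cderive_const].
    apply is_cderive_scal; exact Hl. }
rewrite (circle_integral_minus (fun w => f w * (w / (w - a)))%C (fun w => f a * (w / (w - a)))%C) in V'; auto; try lra.
2:{ intros z Hz. apply ccontinuous_scal; auto. }
rewrite circle_integral_scal in V'; auto; try lra.
rewrite Cmult_comm.
set (X := circle_integral (fun w => f w * (w / (w - a)))%C r) in *.
set (Y := (f a * circle_integral (fun w => w / (w - a)) r)%C) in *.
replace X with ((X - Y) + Y)%C by ring. rewrite V'. ring.
Qed.

(** * Power series *)

(** The sum of the first [n] terms: the empty sum is included, which [sum_n]
    excludes. *)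
Fixpoint csum (b : nat -> C) (n : nat) : C :=
  match n with O => RtoC 0 | S n => (csum b n + b n)%C end.

Definition cseries (b : nat -> C) (l : C) : Prop :=
  forall eps, 0 < eps -> exists N, forall n, (N <= n)%nat -> Cmod (csum b n - l) < eps.

Lemma csum_sum_n (b : nat -> C) n : csum b (S n) = @sum_n C_AbsRing b n.
Proof.
induction n.
- rewrite sum_O. simpl. ring.
- rewrite sum_Sn, <- IHn. reflexivity.
Qed.

Lemma pow_n_Cpow z n : @pow_n C_AbsRing z n = (z ^ n)%C.
Proof. induction n; simpl. reflexivity. rewrite IHn. reflexivity. Qed.

Lemma csum_ext b c n : (forall k, b k = c k) -> csum b n = csum c n.
Proof. intros H; induction n; simpl; congruence. Qed.

Lemma is_pseries_cseries (a : nat -> C) z l :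
  @is_pseries C_AbsRing C_NormedModule a z l <-> cseries (fun n => a n * z ^ n)%C l.
Proof.
assert (E : forall n, @sum_n C_NormedModule
   (fun k => @scal C_AbsRing C_NormedModule (pow_n z k) (a k)) n = csum (fun n => a n * z ^ n)%C (S n)).
{ intros n. rewrite csum_sum_n. apply sum_n_ext. intros k. rewrite pow_n_Cpow.
  change (z ^ k * a k = a k * z ^ k)%C. ring. }
unfold is_pseries, is_series. split.
- intros H eps He.
  destruct (H (fun w => Cmod (w - l) < eps)) as [N HN].
  { apply locally_Cmod. exists eps; auto. }
  exists (S N). intros n Hn. destruct n as [|n]; [lia|]. rewrite <- E. apply HN. lia.
- intros H P HP. apply locally_Cmod in HP. destruct HP as [e [He HP]].
  destruct (H e He) as [N HN]. exists N. intros n Hn. apply HP. rewrite E. apply HN. lia.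
Qed.

Lemma cseries_ext b c l : (forall n, b n = c n) -> cseries b l -> cseries c l.
Proof.
intros H Hb eps He. destruct (Hb eps He) as [N HN]. exists N. intros n Hn.
rewrite <- (csum_ext b c n H). auto.
Qed.

Lemma csum_plus b c n : csum (fun k => b k + c k)%C n = (csum b n + csum c n)%C.
Proof. induction n; simpl. ring. rewrite IHn. ring. Qed.

Lemma csum_scal k b n : csum (fun i => k * b i)%C n = (k * csum b n)%C.
Proof. induction n; simpl. ring. rewrite IHn. ring. Qed.

Lemma cseries_plus b c l m : cseries b l -> cseries c m -> cseries (fun k => b k + c k)%C (l + m)%C.
Proof.
intros Hb Hc eps He. destruct (Hb (eps / 2)) as [N1 H1]; [lra|]. destruct (Hc (eps / 2)) as [N2 H2]; [lra|].
exists (max N1 N2). intros n Hn. rewrite csum_plus.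
replace (csum b n + csum c n - (l + m))%C with ((csum b n - l) + (csum c n - m))%C by ring.
eapply Rle_lt_trans; [apply Cmod_triangle|].
specialize (H1 n ltac:(lia)). specialize (H2 n ltac:(lia)). lra.
Qed.

Lemma cseries_scal k b l : cseries b l -> cseries (fun i => k * b i)%C (k * l)%C.
Proof.
intros Hb eps He. pose proof (Cmod_ge_0 k).
destruct (Hb (eps / (1 + Cmod k))) as [N H1]. { apply Rdiv_lt_0_compat; lra. }
exists N. intros n Hn. rewrite csum_scal.
replace (k * csum b n - k * l)%C with (k * (csum b n - l))%C by ring. rewrite Cmod_mult.
specialize (H1 n Hn). pose proof (Cmod_ge_0 (csum b n - l)).
apply Rle_lt_trans with ((1 + Cmod k) * Cmod (csum b n - l)); [nra|].
apply Rlt_div_r in H1; lra.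
Qed.

Lemma cseries_minus b c l m : cseries b l -> cseries c m -> cseries (fun k => b k - c k)%C (l - m)%C.
Proof.
intros Hb Hc. apply (cseries_scal (- 1)%C) in Hc.
replace (l - m)%C with (l + - 1 * m)%C by ring.
eapply cseries_ext; [|apply cseries_plus; [apply Hb|apply Hc]]. intros; simpl; ring.
Qed.

Lemma cseries_unique b l m : cseries b l -> cseries b m -> l = m.
Proof.
intros Hl Hm. apply Ceq_minus. apply Cmod_small_0. intros eps He.
destruct (Hl (eps / 2)) as [N1 H1]; [lra|]. destruct (Hm (eps / 2)) as [N2 H2]; [lra|].
specialize (H1 (max N1 N2) ltac:(lia)). specialize (H2 (max N1 N2) ltac:(lia)).
set (s := csum b (max N1 N2)) in *.
replace (l - m)%C with ((s - m) + - (s - l))%C by ring.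
eapply Rle_trans; [apply Cmod_triangle|]. rewrite Cmod_opp. lra.
Qed.

Lemma cseries_bounded b l : cseries b l -> exists M, 0 < M /\ forall n, Cmod (b n) <= M.
Proof.
intros H. destruct (H 1 Rlt_0_1) as [N HN].
assert (HB : forall n, exists M, 0 < M /\ forall k, (k < n)%nat -> Cmod (b k) <= M).
{ induction n as [|n [M [HM IH]]]. exists 1; split; [lra|lia].
  exists (M + Cmod (b n)). pose proof (Cmod_ge_0 (b n)). split; [lra|].
  intros k Hk. destruct (Nat.eq_dec k n) as [->|]; [lra|]. specialize (IH k ltac:(lia)). lra. }
destruct (HB N) as [M [HM IH]]. exists (M + 2). split; [lra|]. intros n.
destruct (Nat.lt_ge_cases n N) as [L|L]. specialize (IH n L); lra.
pose proof (HN n L) as H1. pose proof (HN (S n) ltac:(lia)) as H2. simpl in H2.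
replace (b n) with ((csum b n + b n - l) + - (csum b n - l))%C by ring.
eapply Rle_trans; [apply Cmod_triangle|]. rewrite Cmod_opp. lra.
Qed.

Lemma geometric_sum_le K q n : 0 <= K -> 0 <= q < 1 ->
  forall b : nat -> C, (forall k, Cmod (b k) <= K * q ^ k) -> Cmod (csum b n) <= K / (1 - q).
Proof.
intros HK Hq b Hb.
assert (H : Cmod (csum b n) <= K * (1 - q ^ n) / (1 - q)).
{ induction n; simpl.
  - rewrite Cmod_0. right. field. lra.
  - eapply Rle_trans; [apply Cmod_triangle|]. specialize (Hb n).
    apply Rle_trans with (K * (1 - q ^ n) / (1 - q) + K * q ^ n); [lra|]. right. field. lra. }
eapply Rle_trans; [apply H|]. unfold Rdiv. apply Rmult_le_compat_r.
left; apply Rinv_0_lt_compat; lra. assert (0 <= q ^ n) by (apply pow_le; lra). nra.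
Qed.

Lemma cseries_le b l B : cseries b l -> (forall n, Cmod (csum b n) <= B) -> Cmod l <= B.
Proof.
intros H HB. apply le_epsilon. intros eps He. destruct (H eps He) as [N HN].
specialize (HN N ltac:(lia)). specialize (HB N).
replace l with (csum b N + - (csum b N - l))%C by ring.
eapply Rle_trans; [apply Cmod_triangle|]. rewrite Cmod_opp. lra.
Qed.

Lemma Re_csum b n : Re (csum b (S n)) = sum_n (fun k => Re (b k)) n.
Proof.
induction n. rewrite sum_O. change (Re (0 + b O) = Re (b O)). f_equal; ring.
rewrite sum_Sn, <- IHn. reflexivity.
Qed.

Lemma Im_csum b n : Im (csum b (S n)) = sum_n (fun k => Im (b k)) n.
Proof.
induction n. rewrite sum_O. change (Im (0 + b O) = Im (b O)). f_equal; ring.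
rewrite sum_Sn, <- IHn. reflexivity.
Qed.

Lemma cseries_geometric b K q : 0 <= q < 1 -> (forall n, Cmod (b n) <= K * q ^ n) ->
  exists l, cseries b l.
Proof.
intros Hq Hb.
assert (Hg : ex_series (fun n => K * q ^ n)).
{ apply (@ex_series_scal R_AbsRing R_NormedModule K). apply ex_series_geom.
  rewrite Rabs_right; lra. }
destruct (@ex_series_le R_AbsRing R_CompleteNormedModule (fun n => Re (b n)) (fun n => K * q ^ n)) as [x Hx].
{ intros n. eapply Rle_trans; [apply re_le_Cmod|apply Hb]. }
{ exact Hg. }
destruct (@ex_series_le R_AbsRing R_CompleteNormedModule (fun n => Im (b n)) (fun n => K * q ^ n)) as [y Hy].
{ intros n. eapply Rle_trans; [apply im_le_Cmod|apply Hb]. }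
{ exact Hg. }
exists (x, y). intros eps He.
destruct (Hx (fun s => Rabs (s - x) < eps / 2)) as [N1 H1].
{ exists (mkposreal (eps / 2) ltac:(lra)). intros s Hs. exact Hs. }
destruct (Hy (fun s => Rabs (s - y) < eps / 2)) as [N2 H2].
{ exists (mkposreal (eps / 2) ltac:(lra)). intros s Hs. exact Hs. }
exists (S (max N1 N2)). intros n Hn. destruct n as [|n]; [lia|].
eapply Rle_lt_trans; [apply Cmod_le_sum|].
specialize (H1 n ltac:(lia)). specialize (H2 n ltac:(lia)). cbv beta in H1, H2.
change (sum_n (fun n => Re (b n)) n) with (@sum_n R_AbelianGroup (fun n => Re (b n)) n) in H1.
rewrite <- Re_csum in H1. rewrite <- Im_csum in H2.
change (Re (csum b (S n) - (x, y))) with (Re (csum b (S n)) - x).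
change (Im (csum b (S n) - (x, y))) with (Im (csum b (S n)) - y). lra.
Qed.

(** Bernoulli's inequality, used twice, with [t ^ 3 >= q]. *)
Lemma square_geometric q : 0 <= q < 1 ->
  exists K t, 0 <= K /\ 0 <= t < 1 /\ forall n, (INR n * INR n) * q ^ n <= K * t ^ n.
Proof.
intros Hq. set (t := (2 + q) / 3).
assert (Ht : 2 / 3 <= t < 1) by (unfold t; lra).
assert (Htq : q <= t * t * t).
{ assert (E : q = 1 - 3 * (1 - t)) by (unfold t; field).
  assert (0 <= (1 - t) * (1 - t) * (t + 2)) by (apply Rmult_le_pos; [nra|lra]).
  rewrite E. lra. }
assert (HB : forall n, INR n * t ^ n <= / (1 - t)).
{ intros n. assert (Hb := poly n ((1 - t) / t)).
  assert (0 < t ^ n) by (apply pow_lt; lra).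
  replace (1 + (1 - t) / t) with (/ t) in Hb by (field; lra).
  rewrite pow_inv in Hb.
  assert (Hp : 0 < (1 - t) / t) by (apply Rdiv_lt_0_compat; lra). specialize (Hb Hp).
  pose proof (pos_INR n).
  assert (Hc : INR n * ((1 - t) / t) * t ^ n <= 1).
  { apply Rle_trans with (/ t ^ n * t ^ n); [|right; field; lra]. apply Rmult_le_compat_r; lra. }
  assert (INR n * (1 - t) * t ^ n <= INR n * ((1 - t) / t) * t ^ n).
  { apply Rmult_le_compat_r; [lra|]. apply Rmult_le_compat_l; [lra|].
    apply Rle_div_r; nra. }
  apply Rle_trans with ((INR n * (1 - t) * t ^ n) / (1 - t)). right; field; lra.
  apply Rle_div_l; [lra|]. replace (/ (1 - t) * (1 - t)) with 1 by (field; lra). lra. }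
exists (/ (1 - t) * / (1 - t)), t.
assert (0 < / (1 - t)) by (apply Rinv_0_lt_compat; lra).
split; [nra|]. split; [lra|]. intros n.
assert (Hpq : q ^ n <= t ^ n * t ^ n * t ^ n).
{ rewrite <- !Rpow_mult_distr. apply pow_incr. lra. }
pose proof (pos_INR n). assert (0 < t ^ n) by (apply pow_lt; lra).
apply Rle_trans with ((INR n * t ^ n) * (INR n * t ^ n) * t ^ n).
- replace ((INR n * t ^ n) * (INR n * t ^ n) * t ^ n) with ((INR n * INR n) * (t ^ n * t ^ n * t ^ n)) by ring.
  apply Rmult_le_compat_l; nra.
- apply Rmult_le_compat_r; [lra|]. specialize (HB n).
  apply Rmult_le_compat; nra.
Qed.

Lemma expands_bound a f R1 : expands_in_disc a f -> 0 <= R1 < 1 ->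
  exists M, 0 < M /\ forall n, Cmod (a n) * R1 ^ n <= M.
Proof.
intros H HR. assert (H1 : unit_disc (RtoC R1)) by (unfold unit_disc; rewrite Cmod_RtoC; lra).
specialize (H _ H1). apply is_pseries_cseries in H. destruct (cseries_bounded _ _ H) as [M [HM Hb]].
exists M. split; auto. intros n. specialize (Hb n). simpl in Hb.
rewrite Cmod_mult, Cmod_pow, Cmod_R, Rabs_right in Hb by lra. exact Hb.
Qed.

(** The quadratic remainder [D n] of the n-th power obeys
    [D (n + 1) = (z + u) * D n + n * z ^ (n - 1) * u ^ 2]. *)
Lemma pow_second_order z u r n : 0 < r -> Cmod z <= r -> Cmod (z + u) <= r ->
  Cmod ((z + u) ^ n - z ^ n - u * (RtoC (INR n) * z ^ pred n)) * (r * r)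
   <= INR n * INR n * r ^ n * (Cmod u * Cmod u).
Proof.
intros Hr Hz Hzu. induction n as [|n IH].
- simpl. replace (1 - 1 - u * (0 * 1))%C with (RtoC 0) by ring. rewrite Cmod_0. lra.
- set (D := ((z + u) ^ n - z ^ n - u * (RtoC (INR n) * z ^ pred n))%C) in *.
  replace ((z + u) ^ S n - z ^ S n - u * (RtoC (INR (S n)) * z ^ pred (S n)))%C with
   ((z + u) * D + RtoC (INR n) * z ^ pred n * (u * u))%C.
  2:{ unfold D. rewrite S_INR, RtoC_plus. destruct n as [|n].
      - simpl. ring.
      - simpl pred. rewrite !Cpow_S. ring. }
  assert (Hn : Cmod (RtoC (INR n) * z ^ pred n) * r <= INR n * r ^ n).
  { rewrite Cmod_mult, Cmod_pow, Cmod_R, Rabs_right by (apply Rle_ge, pos_INR).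
    rewrite Rmult_assoc. destruct n as [|n]. simpl; lra.
    apply Rmult_le_compat_l; [apply pos_INR|]. simpl pred. simpl. rewrite Rmult_comm.
    apply Rmult_le_compat_l; [lra|]. apply pow_incr. split; [apply Cmod_ge_0|auto]. }
  pose proof (Cmod_ge_0 u). pose proof (Cmod_ge_0 D). pose proof (pos_INR n).
  assert (0 < r ^ n) by now apply pow_lt.
  eapply Rle_trans; [apply Rmult_le_compat_r; [nra|apply Cmod_triangle]|].
  rewrite (Cmod_mult (z + u) D), (Cmod_mult _ (u * u)), (Cmod_mult u u).
  set (E := Cmod (RtoC (INR n) * z ^ pred n)) in *.
  assert (T1 : Cmod (z + u) * (Cmod D * (r * r)) <= r * (INR n * INR n * r ^ n * (Cmod u * Cmod u))).
  { apply Rmult_le_compat; auto. apply Cmod_ge_0. nra. }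
  assert (T2 : (E * r) * (r * (Cmod u * Cmod u)) <= (INR n * r ^ n) * (r * (Cmod u * Cmod u))).
  { apply Rmult_le_compat_r; auto. nra. }
  rewrite S_INR. simpl (r ^ S n).
  assert (0 <= (INR n + 1) * (r * r ^ n * (Cmod u * Cmod u))).
  { apply Rmult_le_pos; [lra|]. apply Rmult_le_pos; nra. }
  nra.
Qed.

(** The decay of the coefficients at a radius between [r] and 1 absorbs the
    factor [n ^ 2]. *)
Lemma expands_square_bound a f r : expands_in_disc a f -> 0 < r < 1 ->
  exists K t, 0 <= K /\ 0 <= t < 1 /\ forall n, Cmod (a n) * (INR n * INR n * r ^ n) <= K * t ^ n.
Proof.
intros Hf Hr. set (R1 := (r + 1) / 2). assert (HR1 : r < R1 < 1) by (unfold R1; lra).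
destruct (expands_bound a f R1 Hf) as [M [HM Hb]]; [lra|].
assert (Hq : 0 <= r / R1 < 1).
{ split. apply Rlt_le, Rdiv_lt_0_compat; lra. apply Rlt_div_l; lra. }
destruct (square_geometric (r / R1) Hq) as [K [t [HK [Ht HKt]]]].
exists (M * K), t. split; [nra|]. split; [auto|]. intros n.
assert (HR : 0 < R1 ^ n) by (apply pow_lt; lra). assert (Hrn : 0 < r ^ n) by (apply pow_lt; lra).
assert (Ha : Cmod (a n) <= M / R1 ^ n) by (apply Rle_div_r; auto).
specialize (HKt n). unfold Rdiv in HKt. rewrite Rpow_mult_distr, pow_inv in HKt.
pose proof (pos_INR n).
apply Rle_trans with (M / R1 ^ n * (INR n * INR n * r ^ n)).
- apply Rmult_le_compat_r; auto. apply Rmult_le_pos; nra.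
- replace (M / R1 ^ n * (INR n * INR n * r ^ n)) with (M * (INR n * INR n * (r ^ n * / R1 ^ n))) by (field; lra).
  rewrite (Rmult_assoc M K). apply Rmult_le_compat_l; lra.
Qed.

(** The remainders of the terms sum to a multiple of the square of the
    increment. *)
Lemma power_series_derivative a f : expands_in_disc a f ->
  exists df : C -> C, expands_in_disc (fun n => RtoC (INR (S n)) * a (S n))%C df /\
    forall z, unit_disc z -> is_cderive f z (df z).
Proof.
intros Hf.
assert (Hex : forall z, unit_disc z ->
  exists l, cseries (fun n => a n * (RtoC (INR n) * z ^ pred n))%C l).
{ intros z Hz. unfold unit_disc in Hz. pose proof (Cmod_ge_0 z).
  set (r := (Cmod z + 1) / 2).
  assert (Hr : 0 < r < 1) by (unfold r; lra). assert (Cmod z <= r) by (unfold r; lra).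
  destruct (expands_square_bound a f r Hf Hr) as [K [t [HK [Ht HKt]]]].
  apply (cseries_geometric _ (K / r) t Ht). intros n.
  rewrite Cmod_mult, Cmod_scal_R, Cmod_pow by apply pos_INR.
  pose proof (pos_INR n).
  assert (Hz' : INR n * Cmod z ^ pred n <= INR n * INR n * r ^ n / r).
  { destruct n as [|n]. simpl; lra. simpl pred.
    assert (1 <= INR (S n)) by (rewrite S_INR; pose proof (pos_INR n); lra).
    replace (INR (S n) * INR (S n) * r ^ S n / r) with (INR (S n) * (INR (S n) * r ^ n)) by (simpl; field; lra).
    apply Rmult_le_compat_l; [lra|].
    assert (Cmod z ^ n <= r ^ n) by (apply pow_incr; lra).
    assert (0 < r ^ n) by (apply pow_lt; lra). nra. }
  apply Rle_trans with (Cmod (a n) * (INR n * INR n * r ^ n / r)).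
  { apply Rmult_le_compat_l; auto. apply Cmod_ge_0. }
  unfold Rdiv. rewrite <- Rmult_assoc, (Rmult_comm K), (Rmult_assoc (/ r)), Rmult_comm.
  apply Rmult_le_compat_l; auto. left; apply Rinv_0_lt_compat; lra. }
set (df := fun z => epsilon (inhabits (RtoC 0)) (fun l => cseries (fun n => a n * (RtoC (INR n) * z ^ pred n))%C l)).
assert (Hdf : forall z, unit_disc z -> cseries (fun n => a n * (RtoC (INR n) * z ^ pred n))%C (df z)).
{ intros z Hz. apply epsilon_spec. auto. }
exists df. split.
- intros z Hz. apply is_pseries_cseries.
  intros eps He. destruct (Hdf z Hz eps He) as [N HN]. exists N. intros n Hn.
  assert (E : csum (fun n => RtoC (INR (S n)) * a (S n) * z ^ n)%C n =
     csum (fun n => a n * (RtoC (INR n) * z ^ pred n))%C (S n)).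
  { clear. induction n. simpl. ring.
    change (csum (fun n => RtoC (INR (S n)) * a (S n) * z ^ n)%C (S n)) with
      (csum (fun n => RtoC (INR (S n)) * a (S n) * z ^ n)%C n + RtoC (INR (S n)) * a (S n) * z ^ n)%C.
    rewrite IHn.
    change (csum (fun n => a n * (RtoC (INR n) * z ^ pred n))%C (S (S n))) with
     (csum (fun n => a n * (RtoC (INR n) * z ^ pred n))%C (S n) + a (S n) * (RtoC (INR (S n)) * z ^ n))%C.
    ring. }
  rewrite E. apply HN. lia.
- intros z Hz. assert (Hz' := Hz). unfold unit_disc in Hz'. pose proof (Cmod_ge_0 z) as Hz0.
  set (r := (Cmod z + 1) / 2).
  assert (Hr : 0 < r < 1) by (unfold r; lra). assert (Hzr : Cmod z < r) by (unfold r; lra).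
  destruct (expands_square_bound a f r Hf Hr) as [K [t [HK [Ht HKt]]]].
  set (B := K / (r * r) / (1 - t)).
  assert (HB : 0 <= B).
  { unfold B. apply Rle_div_r; [lra|]. rewrite Rmult_0_l. apply Rle_div_r; nra. }
  assert (Hmain : forall u, Cmod u < r - Cmod z ->
     Cmod (f (z + u)%C - f z - u * df z) <= B * (Cmod u * Cmod u)).
  { intros u Hu. assert (Hzu : Cmod (z + u) <= r) by (eapply Rle_trans; [apply Cmod_triangle|lra]).
    assert (S1 := Hf (z + u)%C ltac:(unfold unit_disc; lra)). apply is_pseries_cseries in S1.
    assert (S2 := Hf z Hz). apply is_pseries_cseries in S2.
    assert (S3 := cseries_scal u _ _ (Hdf z Hz)).
    assert (S4 := cseries_minus _ _ _ _ (cseries_minus _ _ _ _ S1 S2) S3). simpl in S4.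
    set (uu := Cmod u * Cmod u). assert (Huu : 0 <= uu) by (apply Rmult_le_pos; apply Cmod_ge_0).
    replace (B * uu) with ((K / (r * r) * uu) / (1 - t)) by (unfold B; field; lra).
    apply (cseries_le _ _ _ S4). intros n. apply geometric_sum_le; auto.
    { apply Rmult_le_pos; auto. apply Rle_div_r; nra. }
    intros k.
    replace (a k * (z + u) ^ k - a k * z ^ k - u * (a k * (RtoC (INR k) * z ^ pred k)))%C with
     (a k * ((z + u) ^ k - z ^ k - u * (RtoC (INR k) * z ^ pred k)))%C by ring.
    rewrite Cmod_mult.
    assert (HD := pow_second_order z u r k ltac:(lra) ltac:(lra) Hzu). fold uu in HD.
    set (D := Cmod ((z + u) ^ k - z ^ k - u * (RtoC (INR k) * z ^ pred k))) in *.
    apply Rle_div_r in HD; [|nra].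
    apply Rle_trans with (Cmod (a k) * (INR k * INR k * r ^ k * uu / (r * r))).
    { apply Rmult_le_compat_l; auto. apply Cmod_ge_0. }
    replace (Cmod (a k) * (INR k * INR k * r ^ k * uu / (r * r))) with
     (uu / (r * r) * (Cmod (a k) * (INR k * INR k * r ^ k))) by (field; lra).
    replace (K / (r * r) * uu * t ^ k) with (uu / (r * r) * (K * t ^ k)) by (field; lra).
    apply Rmult_le_compat_l; auto. apply Rle_div_r; nra. }
  apply is_cderive_iff. intros eps He. exists (Rmin (r - Cmod z) (eps / (1 + B))).
  split. { apply Rmin_glb_lt; [lra|]. apply Rdiv_lt_0_compat; lra. }
  intros u Hu.
  apply Rlt_Rmin in Hu as [L1 L2].
  apply Rlt_div_r in L2; [|lra].
  eapply Rle_trans; [now apply Hmain|]. pose proof (Cmod_ge_0 u). 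
  rewrite <- Rmult_assoc. apply Rmult_le_compat_r; nra.
Qed.

(** * Taylor expansion *)

Lemma is_cderive_pow f z l n : is_cderive f z l -> exists l', is_cderive (fun w => f w ^ n)%C z l'.
Proof.
intros H. induction n as [|n [l' IH]].
- exists 0. apply (is_cderive_const (RtoC 1)).
- eexists. apply (is_cderive_mult f (fun w => f w ^ n)%C); eauto.
Qed.

(** The radius 1/2 is arbitrary: [f w / w ^ n] has the same integral over
    every circle around 0. *)
Definition taylor_coeff f (n : nat) : C :=
  (circle_integral (fun w => f w * (/ w) ^ n) (1 / 2) / RtoC (2 * PI))%C.

Lemma remainder_kernel_continuous f z n w : analytic_in_disc f -> Cmod z < Cmod w -> Cmod w < 1 ->
  ccontinuous (fun w => f w * ((z * / w) ^ n * (w / (w - z))))%C w.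
Proof.
intros Hf Hzw Hw. destruct (Hf w Hw) as [l Hl]. pose proof (Cmod_ge_0 z).
assert (N1 : w <> 0) by (apply Cmod_gt_0; lra). assert (N2 : w <> z) by (intros ->; lra).
destruct (is_cderive_pow (fun w => z * / w)%C w _ n (is_cderive_scal z _ _ _ (is_cderive_Cinv w N1))) as [l' Hl'].
eapply is_cderive_continuous. apply (is_cderive_mult f); [exact Hl|].
apply (is_cderive_mult (fun w => (z * / w) ^ n)%C (fun w => w / (w - z))%C); [exact Hl'|].
now apply is_cderive_cauchy_kernel.
Qed.

(** The kernel [w / (w - z)] is expanded in a finite geometric sum in [z / w]. *)
Lemma taylor_remainder f z r n : analytic_in_disc f -> Cmod z < r -> r < 1 ->
  circle_integral (fun w => f w * ((z * / w) ^ n * (w / (w - z))))%C r =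
  (RtoC (2 * PI) * (f z - csum (fun k => taylor_coeff f k * z ^ k) n))%C.
Proof.
intros Hf Hz Hr. pose proof (Cmod_ge_0 z) as Hz0. pose proof two_PI_pos as HPI.
assert (HPI' : RtoC (2 * PI) <> 0) by (apply RtoC_neq_0; lra).
assert (Hne : forall w, Cmod w = r -> w <> 0 /\ w <> z).
{ intros w Hw. split. apply Cmod_gt_0; lra. intros ->; lra. }
assert (Hdi : forall n w, 0 < Cmod w < 1 -> ex_cderive (fun w => f w * (/ w) ^ n)%C w).
{ intros k w Hw. destruct (Hf w (proj2 Hw)) as [l Hl].
  destruct (is_cderive_pow Cinv w _ k (is_cderive_Cinv w ltac:(apply Cmod_gt_0; lra))) as [l' Hl'].
  eexists. apply (is_cderive_mult f (fun w => (/ w) ^ k)%C); eauto. }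
assert (Hc : forall n w, Cmod w = r -> ccontinuous (fun w => f w * ((z * / w) ^ n * (w / (w - z))))%C w).
{ intros k w Hw. apply remainder_kernel_continuous; auto; lra. }
induction n as [|n IH].
- simpl csum. rewrite (circle_integral_ext _ (fun w => f w * (w / (w - z)))%C) by
   (try lra; intros; simpl; ring).
  rewrite cauchy_formula; auto. f_equal. ring.
- assert (E : circle_integral (fun w => f w * ((z * / w) ^ S n * (w / (w - z))))%C r =
     (circle_integral (fun w => f w * ((z * / w) ^ n * (w / (w - z))))%C r
      - z ^ n * circle_integral (fun w => f w * (/ w) ^ n)%C r)%C).
  { rewrite <- circle_integral_scal.
    2: lra.
    2: { intros w Hw. destruct (Hdi n w ltac:(lra)) as [l Hl]. eapply is_cderive_continuous; eauto. }
    rewrite <- circle_integral_minus; auto; try lra.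
    2: { intros w Hw. destruct (Hdi n w ltac:(lra)) as [l Hl].
         apply ccontinuous_scal. eapply is_cderive_continuous; eauto. }
    apply circle_integral_ext; [lra|]. intros w Hw. destruct (Hne w Hw) as [N1 N2].
    rewrite Cpow_S, !Cpow_mult_l. field. split; auto. now apply Cminus_neq_0. }
  rewrite E, IH. simpl csum.
  assert (E2 : circle_integral (fun w => f w * (/ w) ^ n)%C r = (RtoC (2 * PI) * taylor_coeff f n)%C).
  { unfold taylor_coeff.
    replace (circle_integral (fun w => f w * (/ w) ^ n)%C r) with
      (circle_integral (fun w => f w * (/ w) ^ n)%C (1 / 2)). field; auto.
    destruct (Rle_dec r (1 / 2)).
    - symmetry. apply circle_integral_annulus; [lra|]. intros w Hw. apply Hdi. lra.
    - apply circle_integral_annulus; [lra|]. intros w Hw. apply Hdi. lra. }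
  rewrite E2. ring.
Qed.

Theorem taylor f : analytic_in_disc f -> expands_in_disc (taylor_coeff f) f.
Proof.
intros Hf z Hz. unfold unit_disc in Hz. apply is_pseries_cseries.
pose proof (Cmod_ge_0 z) as Hz0. pose proof two_PI_pos as HPI.
set (r := (Cmod z + 1) / 2).
assert (Hr : Cmod z < r < 1) by (unfold r; lra).
destruct (disc_Cmod_max r f) as [w0 [Hw0 Hmax]]; [lra| |].
{ intros w Hw. apply analytic_ccontinuous; auto. lra. }
set (M := Cmod (f w0)) in *. assert (HM : 0 <= M) by apply Cmod_ge_0.
set (q := Cmod z / r).
assert (Hq : 0 <= q < 1).
{ split. apply Rle_div_r; lra. apply Rlt_div_l; lra. }
set (L := M * (r / (r - Cmod z))).
assert (HL : 0 <= L). { apply Rmult_le_pos; auto. apply Rle_div_r; lra. }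
assert (Hrem : forall n, Cmod (csum (fun k => taylor_coeff f k * z ^ k)%C n - f z) <= L * q ^ n).
{ intros n. 
  assert (E := taylor_remainder f z r n Hf (proj1 Hr) (proj2 Hr)).
  apply Rmult_le_reg_l with (2 * PI); auto.
  replace (2 * PI * Cmod (csum (fun k => taylor_coeff f k * z ^ k)%C n - f z)) with
   (Cmod (circle_integral (fun w => f w * ((z * / w) ^ n * (w / (w - z))))%C r)).
  2:{ rewrite E, Cmod_scal_R by lra. f_equal. rewrite <- Cmod_opp. f_equal. ring. }
  apply circle_integral_bound; [lra| |].
  - intros w Hw. apply remainder_kernel_continuous; auto; lra.
  - intros w Hw.
    assert (N1 : w <> 0) by (apply Cmod_gt_0; lra). assert (N2 : w <> z) by (intros ->; lra).
    apply Cminus_neq_0 in N2.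
    rewrite !Cmod_mult, Cmod_pow, Cmod_mult, Cmod_div, Cmod_inv, Hw by auto.
    fold (Cmod z / r). fold q.
    assert (Hd : r - Cmod z <= Cmod (w - z)).
    { pose proof (Cmod_lt_perturb (w - z) w). replace (w - (w - z))%C with z in H by ring. lra. }
    assert (Hqn : 0 <= q ^ n) by (apply pow_le; lra).
    unfold L. replace (M * (r / (r - Cmod z)) * q ^ n) with (M * (q ^ n * (r / (r - Cmod z)))) by ring.
    apply Rmult_le_compat; [apply Cmod_ge_0| |apply Hmax; lra|].
    apply Rmult_le_pos; auto. apply Rle_div_r; lra.
    apply Rmult_le_compat_l; auto. apply Rmult_le_compat_l; [lra|]. apply Rinv_le_contravar; lra. }
intros eps He.
destruct (pow_lt_1_zero q ltac:(rewrite Rabs_right; lra) (eps / (1 + L))) as [N HN].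
{ apply Rdiv_lt_0_compat; lra. }
exists N. intros n Hn. eapply Rle_lt_trans; [apply Hrem|].
specialize (HN n Hn). assert (Hqn : 0 <= q ^ n) by (apply pow_le; lra).
rewrite Rabs_right in HN by lra. apply Rlt_div_r in HN; [|lra]. nra.
Qed.

(** * Analytic functions on the disc *)

Lemma unit_disc_0 : unit_disc 0.
Proof. unfold unit_disc. rewrite Cmod_0. lra. Qed.

Lemma disc_near z w : Cmod (w - z) < 1 - Cmod z -> unit_disc w.
Proof.
intros H. unfold unit_disc. pose proof (Cmod_lt_perturb w z). rewrite Cmod_minus_sym in H. lra.
Qed.

Lemma disc_ext f g z l : unit_disc z -> (forall w, unit_disc w -> f w = g w) ->
  is_cderive f z l -> is_cderive g z l.
Proof.
intros Hz H. apply (is_cderive_ext_near f g z l (1 - Cmod z)).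
- unfold unit_disc in Hz. lra.
- intros w Hw. now apply H, disc_near with z.
Qed.

Lemma analytic_ext f g : (forall w, unit_disc w -> f w = g w) ->
  analytic_in_disc f -> analytic_in_disc g.
Proof. intros H Hf z Hz. destruct (Hf z Hz) as [l Hl]. exists l. now apply disc_ext with f. Qed.

Lemma analytic_C_derive_at f z : analytic_in_disc f -> unit_disc z -> is_cderive f z (C_derive f z).
Proof. intros Hf Hz. apply ex_cderive_C_derive; auto. Qed.

(** The derivative is again given by a power series. *)
Lemma analytic_derive f : analytic_in_disc f -> analytic_in_disc (C_derive f).
Proof.
intros Hf. destruct (power_series_derivative _ _ (taylor f Hf)) as [df [He Hd]].
destruct (power_series_derivative _ _ He) as [ddf [_ Hdd]].
apply analytic_ext with df.
- intros w Hw. symmetry. apply is_C_derive_unique. auto.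
- intros z Hz. exists (ddf z). auto.
Qed.

Lemma analytic_const a : analytic_in_disc (fun _ => a).
Proof. intros z _. eexists. apply is_cderive_const. Qed.
Lemma analytic_id : analytic_in_disc (fun z => z).
Proof. intros z _. eexists. apply is_cderive_id. Qed.
Lemma analytic_plus f g : analytic_in_disc f -> analytic_in_disc g ->
  analytic_in_disc (fun z => f z + g z)%C.
Proof. intros Hf Hg z Hz. destruct (Hf z Hz), (Hg z Hz). eexists. apply is_cderive_plus; eauto. Qed.
Lemma analytic_minus f g : analytic_in_disc f -> analytic_in_disc g ->
  analytic_in_disc (fun z => f z - g z)%C.
Proof. intros Hf Hg z Hz. destruct (Hf z Hz), (Hg z Hz). eexists. apply is_cderive_minus; eauto. Qed.
Lemma analytic_mult f g : analytic_in_disc f -> analytic_in_disc g ->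
  analytic_in_disc (fun z => f z * g z)%C.
Proof. intros Hf Hg z Hz. destruct (Hf z Hz), (Hg z Hz). eexists. apply is_cderive_mult; eauto. Qed.
Lemma analytic_div f g : analytic_in_disc f -> analytic_in_disc g ->
  (forall z, unit_disc z -> g z <> 0) ->
  analytic_in_disc (fun z => f z / g z)%C.
Proof. intros Hf Hg H z Hz. destruct (Hf z Hz), (Hg z Hz). eexists. apply is_cderive_div; eauto. Qed.
Lemma analytic_comp f g : analytic_in_disc f -> analytic_in_disc g ->
  (forall z, unit_disc z -> unit_disc (g z)) ->
  analytic_in_disc (fun z => f (g z)).
Proof. intros Hf Hg H z Hz. destruct (Hf _ (H z Hz)), (Hg z Hz). eexists. apply is_cderive_comp; eauto. Qed.

Lemma analytic_pow f n : analytic_in_disc f -> analytic_in_disc (fun z => f z ^ n)%C.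
Proof. intros Hf z Hz. destruct (Hf z Hz) as [l Hl]. destruct (is_cderive_pow f z l n Hl) as [l' H]. now exists l'. Qed.

Lemma analytic_affine f a rho : analytic_in_disc f -> 0 < rho -> Cmod a + rho <= 1 ->
  analytic_in_disc (fun z => f (a + rho * z)%C).
Proof.
intros Hf Hr Ha.
apply (analytic_comp f (fun z => a + rho * z)%C); auto.
- apply (analytic_plus (fun _ => a) (fun z => RtoC rho * z)%C). apply analytic_const.
  apply analytic_mult; [apply analytic_const|apply analytic_id].
- intros z Hz. unfold unit_disc in *. eapply Rle_lt_trans; [apply Cmod_triangle|].
  rewrite Cmod_scal_R by lra. nra.
Qed.

Lemma expands_exists (b : nat -> C) :
  (forall r, 0 < r < 1 -> exists M, forall n, Cmod (b n) * r ^ n <= M) ->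
  exists f, expands_in_disc b f.
Proof.
intros H.
exists (fun z => epsilon (inhabits (RtoC 0)) (fun l => cseries (fun n => b n * z ^ n)%C l)).
intros z Hz. apply is_pseries_cseries, epsilon_spec.
unfold unit_disc in Hz. pose proof (Cmod_ge_0 z).
set (r := (Cmod z + 1) / 2). assert (Hr : Cmod z < r < 1) by (unfold r; lra).
destruct (H r ltac:(lra)) as [M HM].
apply (cseries_geometric _ M (Cmod z / r)).
- split. apply Rle_div_r; lra. apply Rlt_div_l; lra.
- intros n. rewrite Cmod_mult, Cmod_pow. unfold Rdiv. rewrite Rpow_mult_distr, pow_inv.
  assert (0 < r ^ n) by (apply pow_lt; lra). specialize (HM n).
  apply Rle_div_r in HM; auto. 
  apply Rle_trans with (M / r ^ n * Cmod z ^ n).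
  apply Rmult_le_compat_r; auto. apply pow_le; auto. right; field; lra.
Qed.

Lemma expands_unique a f g : expands_in_disc a f -> expands_in_disc a g ->
  forall z, unit_disc z -> f z = g z.
Proof.
intros Hf Hg z Hz. specialize (Hf z Hz). specialize (Hg z Hz).
apply is_pseries_cseries in Hf. apply is_pseries_cseries in Hg. eapply cseries_unique; eauto.
Qed.

Lemma RtoC_INR_S n : RtoC (INR (S n)) <> 0.
Proof. intros H. apply RtoC_inj in H. apply (not_0_INR (S n)) in H; auto. Qed.

Lemma analytic_primitive f : analytic_in_disc f ->
  exists F, F (RtoC 0) = RtoC 0 /\ forall z, unit_disc z -> is_cderive F z (f z).
Proof.
intros Hf. assert (Ht := taylor f Hf). set (a := taylor_coeff f) in *.
set (b := fun n => match n with O => RtoC 0 | S n => (a n / RtoC (INR (S n)))%C end).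
destruct (expands_exists b) as [F HF].
{ intros r Hr. destruct (expands_bound a f r Ht) as [M [HM Hb]]; [lra|].
  exists M. intros [|n].
  - simpl b. rewrite Cmod_0. lra.
  - change (b (S n)) with (a n / RtoC (INR (S n)))%C. specialize (Hb n). assert (0 < r ^ n) by (apply pow_lt; lra).
    eapply Rle_trans; [|apply Hb].
    rewrite Cmod_div by apply RtoC_INR_S. rewrite Cmod_R, Rabs_right by (apply Rle_ge, pos_INR).
    assert (1 <= INR (S n)) by (rewrite S_INR; pose proof (pos_INR n); lra).
    pose proof (Cmod_ge_0 (a n)).
    apply Rmult_le_compat.
    + apply Rle_div_r; lra.
    + apply pow_le; lra.
    + apply Rle_div_l; nra.
    + simpl. nra. }
destruct (power_series_derivative b F HF) as [df [H1 H2]].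
assert (E : forall z, unit_disc z -> df z = f z).
{ apply (expands_unique a); auto. intros z Hz.
  assert (X := H1 z Hz). apply is_pseries_cseries in X. apply is_pseries_cseries.
  eapply cseries_ext; [|exact X]. intros n. change (b (S n)) with (a n / RtoC (INR (S n)))%C. cbv beta. unfold b. field. apply RtoC_INR_S. }
exists (fun z => F z - F 0)%C. split; [ring|].
intros z Hz. rewrite <- E by auto. replace (df z) with (df z - 0)%C by ring.
apply is_cderive_minus; [auto|apply is_cderive_const].
Qed.

Lemma csum_shift b n : csum b (S n) = (b O + csum (fun k => b (S k)) n)%C.
Proof.
induction n. simpl. ring.
change (csum b (S (S n))) with (csum b (S n) + b (S n))%C. rewrite IHn. simpl. ring.
Qed.

Lemma expands_divide a f : expands_in_disc a f ->
  exists G, expands_in_disc (fun n => a (S n)) G /\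
    forall z, unit_disc z -> f z = (a O + z * G z)%C.
Proof.
intros Ht.
destruct (expands_exists (fun n => a (S n))) as [G HG].
{ intros r Hr. destruct (expands_bound a f r Ht) as [M [HM Hb]]; [lra|].
  exists (M / r). intros n. specialize (Hb (S n)). simpl in Hb. apply (Rle_div_r _ M r); [lra|].
  eapply Rle_trans; [|apply Hb]. right. ring. }
exists G. split; auto.
intros z Hz. specialize (Ht z Hz). specialize (HG z Hz).
apply is_pseries_cseries in Ht. apply is_pseries_cseries in HG.
apply (cseries_scal z) in HG. apply cseries_unique with (1 := Ht).
intros eps He. destruct (HG eps He) as [N HN]. exists (S N). intros [|n] Hn; [lia|].
rewrite csum_shift. specialize (HN n ltac:(lia)).
replace (csum (fun k => a (S k) * z ^ S k)%C n) with (csum (fun i => z * (a (S i) * z ^ i))%C n).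
2:{ apply csum_ext. intros k. rewrite Cpow_S. ring. }
match goal with |- Cmod ?X < _ => match type of HN with Cmod ?Y < _ => replace X with Y by (simpl; ring) end end.
exact HN.
Qed.

Lemma expands_analytic a f : expands_in_disc a f -> analytic_in_disc f.
Proof.
intros H. destruct (power_series_derivative _ _ H) as [df [_ Hd]]. intros z Hz. exists (df z); auto.
Qed.

Lemma analytic_divide f : analytic_in_disc f -> 
  exists G, analytic_in_disc G /\ forall z, unit_disc z -> f z = (f 0 + z * G z)%C.
Proof.
intros Hf. destruct (expands_divide _ _ (taylor f Hf)) as [G [HG E]].
exists G. split; [eapply expands_analytic; eauto|].
intros z Hz. rewrite (E z Hz), (E _ unit_disc_0). ring.
Qed.

(** * The maximum principle and Schwarz's lemma *)

(** Cauchy's formula for the powers of [f]: the constant of the kernel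
    disappears when the n-th root is taken. *)
Theorem maximum_principle f r M z : analytic_in_disc f -> r < 1 -> Cmod z <= r ->
  (forall w, Cmod w = r -> Cmod (f w) <= M) -> Cmod (f z) <= M.
Proof.
intros Hf Hr1 Hz HM. destruct (Rle_lt_or_eq_dec _ _ Hz) as [Hlt|Heq]; [|auto].
pose proof (Cmod_ge_0 z) as Hz0. pose proof two_PI_pos as HPI.
set (K := r / (r - Cmod z)).
assert (HK : 0 < K) by (apply Rdiv_lt_0_compat; lra).
assert (HM0 : 0 <= M).
{ eapply Rle_trans; [apply Cmod_ge_0|]. apply (HM (RtoC r)). rewrite Cmod_RtoC; lra. }
assert (HB : forall n, Cmod (f z) ^ n <= M ^ n * K).
{ intros n. assert (H := cauchy_formula (fun w => f w ^ n)%C z r (analytic_pow f n Hf) Hlt Hr1).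
  apply Rmult_le_reg_l with (2 * PI); auto.
  replace (2 * PI * Cmod (f z) ^ n) with (Cmod (RtoC (2 * PI) * f z ^ n)).
  2:{ rewrite Cmod_mult, Cmod_pow, Cmod_RtoC; lra. }
  rewrite <- H. apply circle_integral_bound; [lra| |].
  - intros w Hw. destruct (analytic_pow f n Hf w ltac:(unfold unit_disc; lra)) as [l Hl].
    eapply is_cderive_continuous.
    apply (is_cderive_mult (fun w => f w ^ n)%C (fun w => w / (w - z))%C); [exact Hl|].
    apply is_cderive_cauchy_kernel. intros ->; lra.
  - intros w Hw. assert (N : (w - z)%C <> 0) by (apply Cminus_neq_0; intros ->; lra).
    rewrite Cmod_mult, Cmod_pow, Cmod_div, Hw by auto.
    apply Rmult_le_compat.
    + apply pow_le, Cmod_ge_0.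
    + apply Rle_div_r; [now apply Cmod_gt_0|lra].
    + apply pow_incr. split; [apply Cmod_ge_0|auto].
    + unfold K. apply Rmult_le_compat_l; [lra|]. apply Rinv_le_contravar; [lra|].
      pose proof (Cmod_lt_perturb (w - z) w) as HH. replace (w - (w - z))%C with z in HH by ring. lra. }
apply Rnot_lt_le. intros Hl.
destruct (Req_dec M 0) as [E|E].
- specialize (HB 1%nat). rewrite E in *. simpl in HB. lra.
- assert (HMp : 0 < M) by lra.
  destruct (pow_unbounded (Cmod (f z) / M) K) as [n Hn].
  { apply Rlt_div_r; lra. }
  specialize (HB n). unfold Rdiv in Hn. rewrite Rpow_mult_distr, pow_inv in Hn.
  assert (0 < M ^ n) by now apply pow_lt.
  apply (Rlt_div_r K) in Hn; auto. lra.
Qed.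

Corollary minimum_principle f r m0 z : analytic_in_disc f ->
  (forall z, unit_disc z -> f z <> 0) -> r < 1 -> Cmod z <= r -> 0 < m0 ->
  (forall w, Cmod w = r -> m0 <= Cmod (f w)) -> m0 <= Cmod (f z).
Proof.
intros Hf Hn Hr Hz Hm Hmin.
assert (Hinv : forall w, unit_disc w -> Cmod (1 / f w) = / Cmod (f w)).
{ intros w Hw. rewrite Cmod_div, Cmod_1 by auto. apply Rmult_1_l. }
assert (Hzd : unit_disc z) by (unfold unit_disc; lra).
assert (H : Cmod (1 / f z) <= / m0).
{ apply (maximum_principle (fun z => 1 / f z)%C r); auto.
  - apply analytic_div; auto. apply analytic_const.
  - intros w Hw. rewrite Hinv by (unfold unit_disc; lra). apply Rinv_le_contravar; auto. }
rewrite Hinv in H by auto. specialize (Hn z Hzd). apply Cmod_gt_0 in Hn.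
apply Rnot_lt_le. intros Hl. apply Rinv_lt_contravar in Hl; [lra|]. now apply Rmult_lt_0_compat.
Qed.

(** The quotient [w z / z] is at most [1 / r] on the circle of radius [r],
    hence inside it, and [r] tends to 1. *)
Theorem schwarz (w : C -> C) : analytic_in_disc w -> w 0 = 0 ->
  (forall z, unit_disc z -> Cmod (w z) <= 1) ->
  exists G, analytic_in_disc G /\ forall z, unit_disc z -> w z = (z * G z)%C /\ Cmod (G z) <= 1.
Proof.
intros Hw H0 H1. destruct (analytic_divide w Hw) as [G [HG E]].
exists G. split; auto. intros z Hz. split. { rewrite (E z Hz), H0. ring. }
unfold unit_disc in *. pose proof (Cmod_ge_0 z).
apply Rnot_lt_le. intros Hl.
set (r := Rmax ((Cmod z + 1) / 2) ((1 + / Cmod (G z)) / 2)).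
assert (Hi : / Cmod (G z) < 1) by (rewrite <- Rinv_1; apply Rinv_lt_contravar; lra).
assert (L1 : (Cmod z + 1) / 2 <= r) by apply Rmax_l.
assert (L2 : (1 + / Cmod (G z)) / 2 <= r) by apply Rmax_r.
assert (L3 : r < 1) by (apply Rmax_lub_lt; lra).
assert (HM : Cmod (G z) <= / r).
{ apply (maximum_principle G r); auto; [lra|]. intros u Hu.
  assert (Hu1 : Cmod u < 1) by lra. specialize (H1 u Hu1). rewrite (E u Hu1), H0 in H1.
  rewrite Cplus_0_l, Cmod_mult, Hu in H1.
  rewrite <- (Rmult_1_l (/ r)). apply Rle_div_r; lra. }
assert (/ Cmod (G z) < r) by lra.
apply (Rinv_lt_contravar _ _) in H2.
rewrite Rinv_inv in H2. lra. apply Rmult_lt_0_compat; [apply Rinv_0_lt_compat; lra|lra].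
Qed.

Lemma schwarz_le (w : C -> C) z : analytic_in_disc w -> w 0 = 0 ->
  (forall z, unit_disc z -> Cmod (w z) <= 1) -> unit_disc z -> Cmod (w z) <= Cmod z.
Proof.
intros Hw H0 H1 Hz. destruct (schwarz w Hw H0 H1) as [G [_ HG]]. destruct (HG z Hz) as [-> HG1].
rewrite Cmod_mult. pose proof (Cmod_ge_0 z). nra.
Qed.

Lemma is_cderive_times_id G : analytic_in_disc G -> is_cderive (fun z => z * G z)%C (RtoC 0) (G (RtoC 0)).
Proof.
intros HG. destruct (HG _ unit_disc_0) as [l Hl].
replace (G 0) with (1 * G 0 + 0 * l)%C by ring.
apply (is_cderive_mult (fun z => z) G); auto. apply is_cderive_id.
Qed.

Lemma schwarz_derive (w : C -> C) l : analytic_in_disc w -> w 0 = 0 ->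
  (forall z, unit_disc z -> Cmod (w z) <= 1) -> is_cderive w (RtoC 0) l -> Cmod l <= 1.
Proof.
intros Hw H0 H1 Hl. destruct (schwarz w Hw H0 H1) as [G [HG1 HG]].
replace l with (G 0). apply HG, unit_disc_0.
apply (is_cderive_unique w 0); auto.
apply disc_ext with (fun z => z * G z)%C. apply unit_disc_0.
intros u Hu. symmetry. now apply HG. now apply is_cderive_times_id.
Qed.

Lemma mobius_identity a z :
  (Cmod (1 + Cconj a * z) ^ 2 - Cmod (z + a) ^ 2 = (1 - Cmod a ^ 2) * (1 - Cmod z ^ 2))%R.
Proof.
rewrite !Cmod2_alt. destruct a as [a1 a2], z as [z1 z2]. simpl. ring.
Qed.

Lemma mobius_denominator a z : Cmod a < 1 -> Cmod z <= 1 -> (1 + Cconj a * z)%C <> 0.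
Proof.
intros Ha Hz. apply Cmod_gt_0.
pose proof (Cmod_lt_perturb (1 + Cconj a * z) (RtoC 1)) as [H _].
replace (1 - (1 + Cconj a * z))%C with (- (Cconj a * z))%C in H by ring.
rewrite Cmod_opp, Cmod_1, Cmod_mult, Cmod_conj in H.
pose proof (Cmod_ge_0 a). pose proof (Cmod_ge_0 z). nra.
Qed.

Lemma mobius_le_1 a z : Cmod a < 1 -> Cmod z <= 1 -> Cmod ((z + a) / (1 + Cconj a * z)) <= 1.
Proof.
intros Ha Hz. assert (N := mobius_denominator a z Ha Hz). rewrite Cmod_div by auto.
apply Cmod_gt_0 in N. apply Rle_div_l; [auto|]. rewrite Rmult_1_l.
pose proof (mobius_identity a z). pose proof (Cmod_ge_0 a). pose proof (Cmod_ge_0 z).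
pose proof (Cmod_ge_0 (z + a)).
assert (0 <= (1 - Cmod a ^ 2) * (1 - Cmod z ^ 2)) by (apply Rmult_le_pos; nra).
apply Rnot_lt_le. intros Hl. nra.
Qed.

Lemma mobius_lt_1 a z : Cmod a < 1 -> Cmod z < 1 -> Cmod ((z + a) / (1 + Cconj a * z)) < 1.
Proof.
intros Ha Hz. assert (N := mobius_denominator a z Ha ltac:(lra)). rewrite Cmod_div by auto.
apply Cmod_gt_0 in N. apply Rlt_div_l; [auto|]. rewrite Rmult_1_l.
pose proof (mobius_identity a z). pose proof (Cmod_ge_0 a). pose proof (Cmod_ge_0 z).
pose proof (Cmod_ge_0 (z + a)).
assert (0 < (1 - Cmod a ^ 2) * (1 - Cmod z ^ 2)) by (apply Rmult_lt_0_compat; nra).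
apply Rnot_le_lt. intros Hl. nra.
Qed.

Lemma Cmult_Cconj a : (Cconj a * a)%C = RtoC (Cmod a ^ 2).
Proof. rewrite Cmod2_conj. ring. Qed.

(** Schwarz's lemma after moving [z] and its image to the origin. The image
    is first contracted by [t < 1], because it may meet the unit circle. *)
Theorem schwarz_pick Phi z : analytic_in_disc Phi ->
  (forall z, unit_disc z -> Cmod (Phi z) <= 1) -> unit_disc z ->
  Cmod (C_derive Phi z) * (1 - Cmod z ^ 2) <= 1 - Cmod (Phi z) ^ 2.
Proof.
intros HP H1 Hz. unfold unit_disc in Hz.
assert (Ht : forall t, 0 < t < 1 ->
  t * (Cmod (C_derive Phi z) * (1 - Cmod z ^ 2)) <= 1 - (t * Cmod (Phi z)) ^ 2).
{ intros t Ht.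
  set (mu := fun u => ((u + z) / (1 + Cconj z * u))%C).
  set (F := fun u => (t * Phi (mu u))%C).
  set (a := F 0).
  assert (Hmu : forall u, unit_disc u -> unit_disc (mu u)) by (intros; now apply mobius_lt_1).
  assert (Hmu0 : mu 0 = z).
  { unfold mu. field. }
  assert (HF1 : forall u, unit_disc u -> Cmod (F u) < 1).
  { intros u Hu. unfold F. rewrite Cmod_scal_R by lra.
    specialize (H1 _ (Hmu u Hu)). pose proof (Cmod_ge_0 (Phi (mu u))). nra. }
  assert (Ha : Cmod a < 1) by apply HF1, unit_disc_0.
  assert (Dmu : forall u, unit_disc u -> is_cderive mu u
     (((1 + 0) * (1 + Cconj z * u) - (u + z) * (0 + Cconj z * 1)) / ((1 + Cconj z * u) * (1 + Cconj z * u)))%C).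
  { intros u Hu. apply (is_cderive_div (fun u => u + z)%C (fun u => 1 + Cconj z * u)%C).
    apply is_cderive_plus; [apply is_cderive_id|apply is_cderive_const].
    apply is_cderive_plus; [apply is_cderive_const|apply is_cderive_scal, is_cderive_id].
    apply mobius_denominator; auto. unfold unit_disc in Hu; lra. }
  assert (AF : analytic_in_disc F).
  { apply analytic_mult. apply analytic_const. apply analytic_comp; auto.
    intros u Hu. eexists. apply Dmu; auto. }
  assert (DF : is_cderive F (RtoC 0) (RtoC t * ((1 - Cconj z * z) * C_derive Phi z))%C).
  { apply is_cderive_scal. apply is_cderive_comp.
    - rewrite Hmu0. apply analytic_C_derive_at; auto.
    - assert (D := Dmu _ unit_disc_0).
      replace (1 - Cconj z * z)%C with
       (((1 + 0) * (1 + Cconj z * 0) - (0 + z) * (0 + Cconj z * 1)) / ((1 + Cconj z * 0) * (1 + Cconj z * 0)))%C.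
      exact D. field. }
  assert (Na : Cmod (- a) < 1) by now rewrite Cmod_opp.
  assert (Hden : forall u, unit_disc u -> (1 + Cconj (- a) * F u)%C <> 0).
  { intros u Hu. apply mobius_denominator; auto. left; auto. }
  set (B := fun u => ((F u + - a) / (1 + Cconj (- a) * F u))%C).
  assert (Bd : Cmod ((t * ((1 - Cconj z * z) * C_derive Phi z)) / (1 - Cconj a * a)) <= 1).
  { apply (schwarz_derive B).
    - apply analytic_div; auto. apply analytic_plus; auto. apply analytic_const.
      apply analytic_plus. apply analytic_const. apply analytic_mult; auto. apply analytic_const.
    - unfold B. fold a. unfold Cdiv. replace (a + - a)%C with (RtoC 0) by ring. ring.
    - intros u Hu. apply mobius_le_1; auto. left; auto.
    - set (dF := (t * ((1 - Cconj z * z) * C_derive Phi z))%C) in *.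
      assert (D : is_cderive B (RtoC 0)
       (((dF + 0) * (1 + Cconj (- a) * F 0) - (F 0 + - a) * (0 + Cconj (- a) * dF)) /
        ((1 + Cconj (- a) * F 0) * (1 + Cconj (- a) * F 0)))%C).
      { apply (is_cderive_div (fun u => F u + - a)%C (fun u => 1 + Cconj (- a) * F u)%C).
        apply is_cderive_plus; [exact DF|apply is_cderive_const].
        apply is_cderive_plus; [apply is_cderive_const|apply is_cderive_scal; exact DF].
        apply Hden, unit_disc_0. }
      fold a in D.
      assert (N := Hden _ unit_disc_0). fold a in N.
      assert (Ec : Cconj (- a) = (- Cconj a)%C) by apply Copp_conj.
      rewrite Ec in D, N.
      assert (N2 : (1 - Cconj a * a)%C <> 0).
      { replace (1 - Cconj a * a)%C with (1 + - Cconj a * a)%C by ring. exact N. }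
      replace (dF / (1 - Cconj a * a))%C with
       (((dF + 0) * (1 + - Cconj a * a) - (a + - a) * (0 + - Cconj a * dF)) /
        ((1 + - Cconj a * a) * (1 + - Cconj a * a)))%C.
      exact D. field. auto. }
  rewrite !Cmult_Cconj in Bd. rewrite <- !RtoC_minus in Bd.
  assert (Pa : 0 < 1 - Cmod a ^ 2) by (pose proof (Cmod_ge_0 a); nra).
  rewrite Cmod_div in Bd by (apply RtoC_neq_0; lra).
  rewrite !Cmod_mult, !Cmod_R in Bd.
  rewrite (Rabs_right t) in Bd by lra.
  rewrite (Rabs_right (1 - Cmod a ^ 2)) in Bd by lra.
  rewrite (Rabs_right (1 - Cmod z ^ 2)) in Bd by (pose proof (Cmod_ge_0 z); nra).
  apply Rle_div_l in Bd; [|exact Pa].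
  replace (Cmod a) with (t * Cmod (Phi z)) in Bd.
  2:{ unfold a, F. rewrite Cmod_mult, Cmod_R, Rabs_right, Hmu0; lra. }
  lra. }
set (X := Cmod (C_derive Phi z) * (1 - Cmod z ^ 2)) in *.
assert (HX : 0 <= X).
{ apply Rmult_le_pos. apply Cmod_ge_0. pose proof (Cmod_ge_0 z). nra. }
pose proof (H1 z Hz) as HY. pose proof (Cmod_ge_0 (Phi z)) as HY0. set (Y := Cmod (Phi z)) in *.
apply le_epsilon. intros eps He.
(* the contraction is [t = 1 - s] *)
set (s := Rmin (1 / 2) (eps / (X + 3))).
assert (Hs : 0 < s) by (apply Rmin_glb_lt; [lra|apply Rdiv_lt_0_compat; lra]).
assert (Hs1 : s <= 1 / 2) by apply Rmin_l.
assert (Hs2 : s * (X + 3) <= eps) by (apply Rle_div_r; [lra|apply Rmin_r]).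
specialize (Ht (1 - s) ltac:(lra)).
assert (Y * Y <= 1) by nra. nra.
Qed.

(** * Mean value inequality and logarithms *)

(** The real mean value theorem is applied to the component of [f] in the
    direction of [f w - f z]. *)
Lemma mean_value_segment f (df : C -> C) z w M :
  (forall t, 0 <= t <= 1 -> is_cderive f (z + t * (w - z))%C (df (z + t * (w - z))%C)) ->
  (forall t, 0 <= t <= 1 -> Cmod (df (z + t * (w - z))%C) <= M) ->
  Cmod (f w - f z) <= M * Cmod (w - z).
Proof.
intros Hd HM. set (v := (w - z)%C) in *. set (D := (f w - f z)%C).
destruct (MVT_gen (fun s => Re (Cconj D * f (z + s * v)%C)) 0 1
   (fun s => Re (Cconj D * (v * df (z + s * v)%C)))) as [c [Hc E]].
- intros t Ht. rewrite Rmin_left, Rmax_right in Ht by lra. apply is_derive_line. apply Hd; lra.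
- intros t Ht. rewrite Rmin_left, Rmax_right in Ht by lra.
  apply derivable_continuous_pt. eexists. apply is_derive_Reals. apply is_derive_line. apply Hd; lra.
- rewrite Rmin_left, Rmax_right in Hc by lra.
  replace (z + 1 * v)%C with w in E by (unfold v; ring).
  replace (z + 0 * v)%C with z in E by ring.
  assert (E2 : Cmod D ^ 2 = Re (Cconj D * (v * df (z + c * v)%C))).
  { transitivity (Re (Cconj D * (v * df (z + c * v)%C)) * (1 - 0))%R; [rewrite <- E|ring].
    assert (E3 : Re (Cconj D * D) = (Cmod D ^ 2)%R) by (rewrite Cmult_Cconj; reflexivity).
    rewrite <- E3. unfold Rminus. rewrite <- re_opp, <- re_plus. f_equal. unfold D. ring. }
  assert (Cmod D ^ 2 <= Cmod D * (M * Cmod v)).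
  { rewrite E2. eapply Rle_trans; [apply Rle_abs|]. eapply Rle_trans; [apply re_le_Cmod|].
    rewrite !Cmod_mult, Cmod_conj. apply Rmult_le_compat_l; [apply Cmod_ge_0|].
    rewrite Rmult_comm. apply Rmult_le_compat_r; [apply Cmod_ge_0|auto]. }
  pose proof (Cmod_ge_0 D). destruct (Rle_lt_or_eq_dec _ _ H0) as [H1|H1].
  + apply Rmult_le_reg_l with (Cmod D); auto. fold D. simpl in H. lra.
  + fold D. rewrite <- H1. pose proof (Cmod_ge_0 v).
    assert (0 <= M) by (eapply Rle_trans; [apply Cmod_ge_0|apply (HM 0); lra]). nra.
Qed.

Lemma segment_le r z w t : Cmod z <= r -> Cmod w <= r -> 0 <= t <= 1 -> Cmod (z + t * (w - z)) <= r.
Proof.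
intros Hz Hw Ht. replace (z + t * (w - z))%C with (RtoC (1 - t) * z + t * w)%C
  by (rewrite RtoC_minus; ring).
eapply Rle_trans; [apply Cmod_triangle|]. rewrite !Cmod_mult, !Cmod_R, !Rabs_right by lra. nra.
Qed.

Lemma disc_lipschitz f r M z w : analytic_in_disc f -> r < 1 ->
  (forall u, Cmod u <= r -> Cmod (C_derive f u) <= M) ->
  Cmod z <= r -> Cmod w <= r -> Cmod (f w - f z) <= M * Cmod (w - z).
Proof.
intros Hf Hr HM Hz Hw. apply mean_value_segment with (C_derive f).
- intros t Ht. apply analytic_C_derive_at; auto. unfold unit_disc.
  pose proof (segment_le r z w t Hz Hw Ht). lra.
- intros t Ht. apply HM, segment_le; auto.
Qed.

Lemma derive_0_constant f : (forall z, unit_disc z -> is_cderive f z (RtoC 0)) ->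
  forall z, unit_disc z -> f z = f 0.
Proof.
intros H z Hz. apply Ceq_minus, Cmod_eq_0. apply Rle_antisym; [|apply Cmod_ge_0].
apply Rle_trans with (0 * Cmod (z - 0)); [|lra].
unfold unit_disc in *. pose proof (Cmod_ge_0 z).
apply mean_value_segment with (fun _ => RtoC 0).
- intros t Ht. apply H. 
  assert (Cmod (0 + t * (z - 0)) <= Cmod z); [|lra].
  apply segment_le; auto. rewrite Cmod_0; auto. lra.
- intros t Ht. rewrite Cmod_0; lra.
Qed.

(** A primitive [P] of [p' / p] works since [p * exp (- P)] has derivative 0. *)
Lemma analytic_log p : analytic_in_disc p -> (forall z, unit_disc z -> p z <> 0) ->
  p 0 = 1 ->
  exists P, P (RtoC 0) = RtoC 0 /\ (forall z, unit_disc z -> Cexp (P z) = p z) /\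
    forall z, unit_disc z -> is_cderive P z (C_derive p z / p z)%C.
Proof.
intros Hp Hn H0.
destruct (analytic_primitive (fun z => C_derive p z / p z)%C) as [P [P0 HP]].
{ apply analytic_div; auto. now apply analytic_derive. }
exists P. split; [auto|]. split; [|auto]. intros z Hz.
assert (E : (p z * Cexp (- P z) = 1)%C).
{ assert (X := derive_0_constant (fun z => p z * Cexp (- P z))%C). cbv beta in X.
  rewrite X; auto.
  - rewrite H0, P0. replace (- (0))%C with (RtoC 0) by ring. rewrite Cexp_0. ring.
  - intros u Hu.
    replace (RtoC 0) with (C_derive p u * Cexp (- P u) + p u * (- (C_derive p u / p u) * Cexp (- P u)))%C.
    2:{ field. auto. }
    apply (is_cderive_mult p (fun z => Cexp (- P z))%C).
    + now apply analytic_C_derive_at.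
    + apply is_cderive_comp. apply is_cderive_Cexp. apply is_cderive_opp. auto. }
rewrite Cexp_opp in E.
replace (p z) with ((p z * / Cexp (P z)) * Cexp (P z))%C. rewrite E. ring.
field. apply Cexp_neq_0.
Qed.

(** * Univalent functions *)

Definition injective_in_disc f : Prop :=
  forall z1 z2, unit_disc z1 -> unit_disc z2 -> f z1 = f z2 -> z1 = z2.

Lemma second_order_bound f r : analytic_in_disc f -> 0 <= r < 1 ->
  exists M, 0 <= M /\ forall z u, Cmod z <= r -> Cmod (z + u) <= r ->
    Cmod (f (z + u)%C - f z - u * C_derive f z) <= M * (Cmod u * Cmod u).
Proof.
intros Hf Hr. assert (Hd := analytic_derive f Hf).
destruct (disc_Cmod_max r (C_derive (C_derive f))) as [w0 [_ Hmax]]; [lra| |].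
{ intros z Hz. apply analytic_ccontinuous; [|lra]. now apply analytic_derive. }
exists (Cmod (C_derive (C_derive f) w0)). split; [apply Cmod_ge_0|].
intros z u Hz Hzu. set (M := Cmod (C_derive (C_derive f) w0)) in *.
replace (f (z + u)%C - f z - u * C_derive f z)%C with
  ((f (z + u)%C - (z + u) * C_derive f z) - (f z - z * C_derive f z))%C by ring.
replace (M * (Cmod u * Cmod u)) with ((M * Cmod u) * Cmod (z + u - z)).
2:{ replace (z + u - z)%C with u by ring. ring. }
assert (Hseg : forall t, 0 <= t <= 1 -> Cmod (z + t * (z + u - z)) <= r).
{ intros t Ht. now apply segment_le. }
apply (mean_value_segment (fun w => f w - w * C_derive f z)%C (fun w => C_derive f w - (1 * C_derive f z + w * 0))%C).
- intros t Ht. apply is_cderive_minus.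
  + apply analytic_C_derive_at; auto. unfold unit_disc. specialize (Hseg t Ht). lra.
  + apply (is_cderive_mult (fun w => w) (fun _ => C_derive f z)).
    apply is_cderive_id. apply is_cderive_const.
- intros t Ht. specialize (Hseg t Ht).
  set (p := (z + t * (z + u - z))%C) in *.
  replace (C_derive f p - (1 * C_derive f z + p * 0))%C with (C_derive f p - C_derive f z)%C by ring.
  eapply Rle_trans; [apply (disc_lipschitz (C_derive f) r M); auto; lra|].
  apply Rmult_le_compat_l; [apply Cmod_ge_0|].
  replace (p - z)%C with (t * u)%C by (unfold p; ring).
  rewrite Cmod_scal_R by lra. pose proof (Cmod_ge_0 u). nra.
Qed.

(** The order of the zero is the index of the first nonzero coefficient. *)
Lemma zero_order f : analytic_in_disc f -> (exists z, unit_disc z /\ f z <> 0) ->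
  exists k G, analytic_in_disc G /\ G 0 <> 0 /\
    forall z, unit_disc z -> f z = (z ^ k * G z)%C.
Proof.
intros Hf [z0 [Hz0 Hnz]]. assert (Ht := taylor f Hf). set (a := taylor_coeff f) in *.
assert (Hex : exists k, a k <> 0).
{ apply NNPP. intros Hn. apply Hnz. specialize (Ht z0 Hz0). apply is_pseries_cseries in Ht.
  apply cseries_unique with (1 := Ht). intros eps He. exists O. intros n _.
  rewrite (csum_ext _ (fun _ => RtoC 0)).
  2:{ intros k. replace (a k) with (RtoC 0). ring. symmetry. apply NNPP. intros E. apply Hn. now exists k. }
  replace (csum (fun _ => RtoC 0) n) with (RtoC 0). replace (0 - 0)%C with (RtoC 0) by ring. now rewrite Cmod_0.
  clear. induction n; simpl. auto. rewrite <- IHn. ring. }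
assert (Hind : forall k, (forall i, (i < k)%nat -> a i = 0) ->
  exists G, expands_in_disc (fun n => a (k + n)%nat) G /\ forall z, unit_disc z -> f z = (z ^ k * G z)%C).
{ induction k as [|k IH]; intros Hk.
  - exists f. split. exact Ht. intros z _. simpl. ring.
  - destruct IH as [G [HG E]]. { intros i Hi. apply Hk. lia. }
    destruct (expands_divide _ _ HG) as [G' [HG' E']]. exists G'. split.
    + intros z Hz. specialize (HG' z Hz). apply is_pseries_cseries in HG'. apply is_pseries_cseries.
      eapply cseries_ext; [|exact HG']. intros n. cbv beta. now rewrite Nat.add_succ_r.
    + intros z Hz. rewrite E, E', Nat.add_0_r, (Hk k) by (auto; lia). simpl. ring. }
destruct (classic (exists k, a k <> 0 /\ forall i, (i < k)%nat -> a i = 0)) as [[k [Hk Hi]]|Hno].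
- destruct (Hind k Hi) as [G [HG E]]. exists k, G. split; [eapply expands_analytic; eauto|]. split; auto.
  destruct (expands_divide _ _ HG) as [G' [_ E']]. rewrite (E' _ unit_disc_0), Nat.add_0_r.
  intros E0. apply Hk. rewrite <- E0. ring.
- exfalso. destruct Hex as [k Hk]. revert Hk. 
  induction k as [k IH] using (well_founded_induction Nat.lt_wf_0). intros Hk.
  apply Hno. exists k. split; auto. intros i Hi. apply NNPP. intros Hai. exact (IH i Hi Hai).
Qed.

Lemma C_derive_affine f a rho z : analytic_in_disc f -> unit_disc (a + RtoC rho * z)%C ->
  C_derive (fun z => f (a + RtoC rho * z)%C) z = (RtoC rho * C_derive f (a + RtoC rho * z))%C.
Proof.
intros Hf Hz. apply is_C_derive_unique.
apply (is_cderive_comp f (fun z => a + RtoC rho * z)%C).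
now apply analytic_C_derive_at.
assert (H : is_cderive (fun z => a + RtoC rho * z)%C z (0 + RtoC rho * 1)%C)
  by (apply is_cderive_plus; [apply is_cderive_const|apply is_cderive_scal, is_cderive_id]).
now replace (0 + RtoC rho * 1)%C with (RtoC rho) in H by ring.
Qed.

Lemma injective_affine f a rho : injective_in_disc f -> 0 < rho -> Cmod a + rho <= 1 ->
  injective_in_disc (fun z => f (a + rho * z)%C).
Proof.
intros Hf Hr Ha z1 z2 H1 H2 E.
assert (Hin : forall z, unit_disc z -> unit_disc (a + rho * z)%C).
{ intros z Hz. unfold unit_disc in *. eapply Rle_lt_trans; [apply Cmod_triangle|].
  rewrite Cmod_scal_R by lra. nra. }
apply Hf in E; auto.
assert (Hrho : RtoC rho <> 0) by (apply RtoC_neq_0; lra).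
replace z1 with (((a + rho * z1) - a) / rho)%C by (field; auto).
rewrite E. field; auto.
Qed.

(** Hurwitz: the difference quotients with a fixed increment have no zeros,
    hence their modulus at the centre is at least its minimum on a circle on
    which the derivative does not vanish. *)
Lemma injective_derive_0 f : analytic_in_disc f -> injective_in_disc f ->
  C_derive f 0 <> 0.
Proof.
intros Hf Hinj H0. assert (Hd := analytic_derive f Hf).
destruct (zero_order (C_derive f)) as [k [G [HG [HG0 E]]]]; auto.
{ apply NNPP. intros Hn.
  assert (Hc : forall z, unit_disc z -> f z = f 0).
  { apply derive_0_constant. intros z Hz.
    replace (RtoC 0) with (C_derive f z). now apply analytic_C_derive_at.
    apply NNPP. intros Hne. apply Hn. now exists z. }
  assert (Hh : unit_disc (RtoC (1 / 2))) by (unfold unit_disc; rewrite Cmod_RtoC; lra).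
  specialize (Hc _ Hh). apply Hinj in Hc; auto using unit_disc_0. apply RtoC_inj in Hc. lra. }
apply Cmod_gt_0 in HG0.
assert (HGc := analytic_ccontinuous G 0 HG unit_disc_0). rewrite continuous_C_iff in HGc.
destruct (HGc (Cmod (G 0) / 2)) as [eta [Heta HGn]]; [lra|].
set (e := Rmin (eta / 2) (1 / 4)).
assert (He : 0 < e) by (apply Rmin_glb_lt; lra).
assert (He1 : e <= eta / 2) by apply Rmin_l. assert (He2 : e <= 1 / 4) by apply Rmin_r.
set (dl := e ^ k * (Cmod (G 0) / 2)).
assert (Hek : 0 < e ^ k) by (apply pow_lt; lra).
assert (Hdl : 0 < dl) by (apply Rmult_lt_0_compat; lra).
assert (Hcirc : forall z, Cmod z = e -> dl <= Cmod (C_derive f z)).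
{ intros z Hz. rewrite E by (unfold unit_disc; lra). rewrite Cmod_mult, Cmod_pow, Hz.
  apply Rmult_le_compat_l; [lra|].
  specialize (HGn z). replace (z - 0)%C with z in HGn by ring. specialize (HGn ltac:(lra)).
  pose proof (Cmod_lt_perturb (G z) (G 0)).
  rewrite Cmod_minus_sym in HGn. lra. }
destruct (second_order_bound f (1 / 2) Hf) as [M [HM Hso]]; [lra|].
set (t := Rmin (1 / 4) (dl / (4 * (M + 1)))).
assert (Ht : 0 < t) by (apply Rmin_glb_lt; [lra|apply Rdiv_lt_0_compat; lra]).
assert (Ht1 : t <= 1 / 4) by apply Rmin_l.
assert (Ht2 : M * t <= dl / 4).
{ assert (t <= dl / (4 * (M + 1))) by apply Rmin_r.
  apply Rle_trans with ((M + 1) * (dl / (4 * (M + 1)))). apply Rmult_le_compat; lra.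
  right; field; lra. }
assert (Htn : RtoC t <> 0) by (apply RtoC_neq_0; lra).
set (Q := fun z => ((f (t + RtoC (1 / 2) * z) - f (0 + RtoC (1 / 2) * z)) / t)%C).
assert (HQa : analytic_in_disc Q).
{ apply analytic_div; [|apply analytic_const|auto].
  apply analytic_minus; apply (analytic_affine f); auto; try lra;
   rewrite Cmod_RtoC; lra. }
assert (HQn : forall z, unit_disc z -> Q z <> 0).
{ intros z Hz EQ. unfold unit_disc in Hz.
  assert (E1 : f (t + RtoC (1 / 2) * z)%C = f (0 + RtoC (1 / 2) * z)%C).
  { apply Ceq_minus.
    replace (f (t + (1 / 2)%R * z)%C - f (0 + (1 / 2)%R * z)%C)%C with (Q z * t)%C by (unfold Q; field; auto).
    rewrite EQ. ring. }
  assert (Hn : Cmod (RtoC (1 / 2) * z) < 1 / 2) by (rewrite Cmod_scal_R; lra).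
  apply Hinj in E1.
  - apply Htn. replace (RtoC t) with ((t + RtoC (1 / 2) * z) - RtoC (1 / 2) * z)%C by ring.
    rewrite E1. ring.
  - unfold unit_disc. eapply Rle_lt_trans; [apply Cmod_triangle|]. rewrite Cmod_RtoC; lra.
  - unfold unit_disc. rewrite Cplus_0_l. lra. }
assert (HQd : forall z, Cmod z <= 1 / 2 -> Cmod (Q z - C_derive f (RtoC (1 / 2) * z)) <= dl / 4).
{ intros z Hz. set (p := (RtoC (1 / 2) * z)%C).
  assert (Hp : Cmod p <= 1 / 4) by (unfold p; rewrite Cmod_scal_R; lra).
  assert (Hs := Hso p (RtoC t) ltac:(lra)).
  assert (Hpt : Cmod (p + t) <= 1 / 2).
  { eapply Rle_trans; [apply Cmod_triangle|]. rewrite Cmod_RtoC; lra. }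
  specialize (Hs Hpt). rewrite Cmod_R, Rabs_right in Hs by lra.
  unfold Q. fold p. rewrite Cplus_0_l, (Cplus_comm (RtoC t) p).
  replace ((f (p + t)%C - f p) / t - C_derive f p)%C with ((f (p + t)%C - f p - t * C_derive f p) / t)%C
    by (field; auto).
  rewrite Cmod_div, Cmod_R, Rabs_right by (auto; lra). apply Rle_div_l; [lra|]. nra. }
assert (Hlow : dl / 2 <= Cmod (Q 0)).
{ apply (minimum_principle Q (2 * e)); auto; try lra.
  { rewrite Cmod_0. lra. }
  intros z Hz. specialize (HQd z ltac:(lra)).
  assert (Hp : Cmod (RtoC (1 / 2) * z) = e) by (rewrite Cmod_scal_R; lra).
  specialize (Hcirc _ Hp).
  pose proof (Cmod_lt_perturb (C_derive f (RtoC (1 / 2) * z)%C) (Q z)). lra. }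
specialize (HQd 0 ltac:(rewrite Cmod_0; lra)).
replace (RtoC (1 / 2) * RtoC 0)%C with (RtoC 0) in HQd by ring. rewrite H0 in HQd.
replace (Q 0 - 0)%C with (Q 0) in HQd by ring. lra.
Qed.

Theorem injective_derive_neq_0 f a : analytic_in_disc f -> injective_in_disc f ->
  unit_disc a -> C_derive f a <> 0.
Proof.
intros Hf Hi Ha E. unfold unit_disc in Ha.
assert (H := injective_derive_0 (fun z => f (a + RtoC (1 - Cmod a) * z)%C)).
apply H.
- apply analytic_affine; auto; lra.
- apply injective_affine; auto; lra.
- assert (E0 : (a + RtoC (1 - Cmod a) * 0)%C = a) by ring.
  rewrite C_derive_affine; auto. rewrite E0, E. ring. rewrite E0. exact Ha.
Qed.

(** If [u] is omitted, [f - u] obeys the minimum principle, so [u] is not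
    nearer to the image of the centre than to the image of a circle. *)
Theorem injective_open f a rho : analytic_in_disc f -> injective_in_disc f ->
  0 < rho -> Cmod a + rho <= 1 ->
  exists dl, 0 < dl /\ forall u, Cmod (u - f a) < dl -> exists z, Cmod (z - a) < rho /\ f z = u.
Proof.
intros Hf Hi Hr Ha.
set (F := fun z => f (a + rho * z)%C).
assert (HF : analytic_in_disc F) by (apply analytic_affine; auto).
assert (HFi : injective_in_disc F) by (apply injective_affine; auto).
assert (F0 : F 0 = f a) by (unfold F; f_equal; ring).
destruct (compact_max (fun z => Cmod z = 1 / 2) (1 / 2) (fun z => - Cmod (F z - F 0)))
  as [z0 [Hz0 Hmin]].
- intros; lra.
- apply circle_closed.
- exists (RtoC (1 / 2)). rewrite Cmod_RtoC; lra.
- intros z Hz eps He.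
  assert (Hc : ccontinuous (fun z => F z - F 0)%C z).
  { apply ccontinuous_minus; [|apply ccontinuous_const]. apply analytic_ccontinuous; auto; lra. }
  destruct (ccontinuous_Cmod _ _ Hc eps He) as [d [Hd H]]. exists d. split; auto.
  intros w _ Hw. specialize (H w Hw). rewrite <- Rabs_Ropp in H.
  eapply Rle_lt_trans; [|exact H]. right. f_equal. ring.
- set (m := Cmod (F z0 - F 0)) in *.
  assert (Hm : 0 < m).
  { apply Cmod_gt_0. intros E. apply (Ceq_minus (F z0) (F 0)) in E.
    apply HFi in E; [|unfold unit_disc; lra|apply unit_disc_0].
    rewrite E, Cmod_0 in Hz0. lra. }
  exists (m / 2). split; [lra|]. intros u Hu. apply NNPP. intros Hno.
  assert (Hn : forall z, unit_disc z -> (F z - u)%C <> 0).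
  { intros z Hz E. apply Hno. exists (a + rho * z)%C. split.
    - replace (a + rho * z - a)%C with (rho * z)%C by ring.
      rewrite Cmod_scal_R by lra. unfold unit_disc in Hz. nra.
    - now apply Ceq_minus. }
  assert (m / 2 <= Cmod (F 0 - u)).
  { apply (minimum_principle (fun z => F z - u)%C (1 / 2)); auto; try lra.
    - apply analytic_minus; auto. apply analytic_const.
    - rewrite Cmod_0. lra.
    - intros z Hz. specialize (Hmin z Hz).
      replace (F z - F 0)%C with ((F z - u) + (u - F 0))%C in Hmin by ring.
      pose proof (Cmod_triangle (F z - u) (u - F 0)). rewrite F0 in *. lra. }
  rewrite Cmod_minus_sym, <- F0 in Hu. lra.
Qed.

Definition in_image f (u : C) : Prop := exists z, unit_disc z /\ f z = u.

(** The value off the image is arbitrary. *)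
Definition inverse f (u : C) : C :=
  epsilon (inhabits (RtoC 0)) (fun z => unit_disc z /\ f z = u).

Lemma inverse_spec f u : in_image f u -> unit_disc (inverse f u) /\ f (inverse f u) = u.
Proof. intros H. unfold inverse. now apply epsilon_spec. Qed.

Lemma inverse_left f z : injective_in_disc f -> unit_disc z -> inverse f (f z) = z.
Proof.
intros Hi Hz. destruct (inverse_spec f (f z)) as [H1 H2]. now exists z. now apply Hi.
Qed.

Lemma image_open f u : analytic_in_disc f -> injective_in_disc f -> in_image f u ->
  exists d, 0 < d /\ forall v, Cmod (v - u) < d -> in_image f v.
Proof.
intros Hf Hi [a [Ha <-]]. unfold unit_disc in Ha.
destruct (injective_open f a (1 - Cmod a) Hf Hi) as [d [Hd H]]; try lra.
exists d. split; auto. intros v Hv. destruct (H v Hv) as [z [Hz E]]. exists z. split; auto.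
now apply disc_near with a.
Qed.

(** Openness of [f] makes the inverse continuous; the difference quotient of
    the inverse is the reciprocal of that of [f]. *)
Theorem inverse_derive f a : analytic_in_disc f -> injective_in_disc f -> unit_disc a ->
  is_cderive (inverse f) (f a) (/ C_derive f a)%C.
Proof.
intros Hf Hi Ha. assert (Hd0 := injective_derive_neq_0 f a Hf Hi Ha).
assert (Hd := analytic_C_derive_at f a Hf Ha). set (l := C_derive f a) in *.
apply Cmod_gt_0 in Hd0 as Hl. rewrite is_cderive_iff in Hd. apply is_cderive_iff.
intros eps He.
set (eta := Rmin (Cmod l / 2) (eps * (Cmod l * Cmod l) / 2)).
assert (Heta : 0 < eta).
{ apply Rmin_glb_lt; [lra|]. apply Rdiv_lt_0_compat; [|lra]. apply Rmult_lt_0_compat; nra. }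
assert (He1 : eta <= Cmod l / 2) by apply Rmin_l.
assert (He2 : eta <= eps * (Cmod l * Cmod l) / 2) by apply Rmin_r.
destruct (Hd eta Heta) as [d [Hdp Hd']]. unfold unit_disc in Ha.
assert (Hrho : 0 < Rmin d (1 - Cmod a)) by (apply Rmin_glb_lt; lra).
destruct (injective_open f a (Rmin d (1 - Cmod a)) Hf Hi Hrho) as [dl [Hdl Hop]].
{ pose proof (Rmin_r d (1 - Cmod a)). lra. }
exists dl. split; auto. intros k Hk.
destruct (Hop (f a + k)%C) as [z [Hz Ez]].
{ replace (f a + k - f a)%C with k by ring. exact Hk. }
apply Rlt_Rmin in Hz as [Hz1 Hz2].
assert (Hzd : unit_disc z) by now apply disc_near with a.
rewrite <- Ez, !inverse_left by auto.
specialize (Hd' _ Hz1). replace (a + (z - a))%C with z in Hd' by ring. rewrite Ez in Hd'.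
replace (f a + k - f a - (z - a) * l)%C with (k - (z - a) * l)%C in Hd' by ring.
set (x := (z - a)%C) in *.
replace (x - k * / l)%C with (- ((k - x * l) / l))%C by (field; auto).
rewrite Cmod_opp, Cmod_div by auto. apply Rle_div_l; auto.
assert (Hxk : Cmod x * Cmod l <= Cmod k + eta * Cmod x).
{ rewrite <- Cmod_mult. replace (x * l)%C with (k + - (k - x * l))%C by ring.
  eapply Rle_trans; [apply Cmod_triangle|]. rewrite Cmod_opp. lra. }
pose proof (Cmod_ge_0 x).
assert (Hx2 : Cmod x * (Cmod l / 2) <= Cmod k) by nra.
apply Rle_trans with (eps * (Cmod l * Cmod l) / 2 * Cmod x).
{ eapply Rle_trans; [apply Hd'|]. apply Rmult_le_compat_r; lra. }
replace (eps * (Cmod l * Cmod l) / 2 * Cmod x) with ((eps * Cmod l) * (Cmod x * (Cmod l / 2))) by field.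
replace (eps * Cmod k * Cmod l) with ((eps * Cmod l) * Cmod k) by ring.
apply Rmult_le_compat_l; nra.
Qed.

(** * Convex functions *)

(** Let [v z] be the preimage of the point dividing the segment from [phi z]
    to [phi (c * z)] in a given ratio, where [c = w / b]. Schwarz's lemma keeps
    [v b] in the closed disc through [b], and letting the dividing point tend to [phi b] gives a
    half-plane supporting the image of that disc at [phi b]. *)
Theorem convex_support phi b w : convex_in_disc phi -> unit_disc b -> b <> 0 ->
  Cmod w <= Cmod b -> Re ((phi w - phi b) / (b * C_derive phi b)) <= 0.
Proof.
intros [Hphi [Hinj Hconv]] Hb Hb0 Hw.
assert (Hi : injective_in_disc phi) by exact Hinj.
assert (Hd0 := injective_derive_neq_0 phi b Hphi Hi Hb).
apply Cmod_gt_0 in Hb0 as Hbp.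
set (c := (w / b)%C).
assert (Hc : Cmod c <= 1).
{ unfold c. rewrite Cmod_div by auto. apply Rle_div_l; lra. }
assert (Hcz : forall z, unit_disc z -> unit_disc (c * z)%C).
{ intros z Hz. unfold unit_disc in *. rewrite Cmod_mult. pose proof (Cmod_ge_0 z). nra. }
assert (Acz : analytic_in_disc (fun z => phi (c * z)%C)).
{ apply (analytic_comp phi (fun z => c * z)%C); auto. apply analytic_mult; [apply analytic_const|apply analytic_id]. }
set (Dl := (phi w - phi b)%C).
assert (Hv : forall t, 0 <= t <= 1 -> Cmod (inverse phi (phi b + t * Dl)) <= Cmod b).
{ intros t Ht.
  set (U := fun z => (RtoC (1 - t) * phi z + t * phi (c * z))%C).
  assert (HU : forall z, unit_disc z -> in_image phi (U z)).
  { intros z Hz. apply Hconv; auto. exists z; auto. exists (c * z)%C; auto. }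
  assert (AU : analytic_in_disc U).
  { apply analytic_plus; apply analytic_mult; auto; apply analytic_const. }
  assert (S := schwarz_le (fun z => inverse phi (U z)) b).
  replace (phi b + t * Dl)%C with (U b).
  - apply S; auto.
    + intros z Hz. destruct (AU z Hz) as [l Hl]. destruct (inverse_spec _ _ (HU z Hz)) as [I1 I2].
      eexists. apply (is_cderive_comp (inverse phi) U); [|exact Hl].
      rewrite <- I2. now apply inverse_derive.
    + replace (U 0) with (phi 0). apply inverse_left; auto using unit_disc_0.
      unfold U. replace (c * 0)%C with (RtoC 0) by ring. rewrite RtoC_minus. ring.
    + intros z Hz. left. apply (inverse_spec _ _ (HU z Hz)).
  - unfold U, Dl, c. replace (w / b * b)%C with w by (field; auto). rewrite RtoC_minus. ring. }
apply Rnot_lt_le. intros Hs.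
set (s := Re (Dl / (b * C_derive phi b))) in *.
assert (Hder := inverse_derive phi b Hphi Hi Hb).
rewrite is_cderive_iff in Hder.
pose proof (Cmod_ge_0 Dl) as HDl.
(* if [s > 0], an error below this rate cannot bring [v / b], which is
   [1 + t * s] to first order, back into the disc *)
set (e := s * Cmod b / (2 * (Cmod Dl + 1))).
assert (He : 0 < e). { apply Rdiv_lt_0_compat; [|lra]. now apply Rmult_lt_0_compat. }
destruct (Hder e He) as [d [Hd H]].
set (t := Rmin 1 (d / (2 * (Cmod Dl + 1)))).
assert (Ht : 0 < t) by (apply Rmin_glb_lt; [lra|apply Rdiv_lt_0_compat; lra]).
assert (Ht1 : t <= 1) by apply Rmin_l.
assert (Ht2 : t * (2 * (Cmod Dl + 1)) <= d) by (apply Rle_div_r; [lra|apply Rmin_r]).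
specialize (H (t * Dl)%C). rewrite Cmod_mult, Cmod_R, Rabs_right in H by lra.
specialize (H ltac:(nra)). rewrite inverse_left in H by auto.
specialize (Hv t ltac:(lra)). set (v := inverse phi (phi b + t * Dl)%C) in *.
set (err := (v - b - t * Dl * / C_derive phi b)%C) in *.
assert (Ev : (v / b = 1 + (t * (Dl / (b * C_derive phi b)) + err / b))%C).
{ unfold err. field. auto. }
assert (R1 : Re (v / b) <= 1).
{ eapply Rle_trans; [apply Rle_abs|]. eapply Rle_trans; [apply re_le_Cmod|].
  rewrite Cmod_div by auto. apply Rle_div_l; lra. }
rewrite Ev, re_plus, re_plus, re_scal_l in R1. fold s in R1. simpl (Re 1) in R1.
assert (R2 : Rabs (Re (err / b)) <= e * (t * Cmod Dl) / Cmod b).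
{ eapply Rle_trans; [apply re_le_Cmod|]. rewrite Cmod_div by auto.
  apply Rmult_le_compat_r; auto. left; now apply Rinv_0_lt_compat. }
apply Rabs_le_between in R2.
assert (R3 : e * (t * Cmod Dl) / Cmod b <= t * s / 2).
{ apply Rle_trans with (t * s / 2 * (Cmod Dl / (Cmod Dl + 1))).
  right. unfold e. field. lra.
  rewrite <- (Rmult_1_r (t * s / 2)) at 2. apply Rmult_le_compat_l; [nra|].
  apply Rle_div_l; lra. }
assert (0 < t * s) by now apply Rmult_lt_0_compat. lra.
Qed.

(** By [convex_support] the real function [Re (phi (b * exp (i * t)) / (b * phi' b))]
    is maximal at [t = 0], where its second derivative is minus the number in
    question. *)
Theorem convex_curvature phi b : convex_in_disc phi -> unit_disc b ->
  0 <= Re (1 + b * C_derive (C_derive phi) b / C_derive phi b).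
Proof.
intros Hconv Hb. assert (Hphi := proj1 Hconv).
assert (Hi : injective_in_disc phi) by exact (proj1 (proj2 Hconv)).
assert (Hd0 := injective_derive_neq_0 phi b Hphi Hi Hb).
destruct (Ceq_dec b 0) as [->|Hb0].
{ replace (1 + 0 * C_derive (C_derive phi) 0 / C_derive phi 0)%C with (RtoC 1) by (field; auto).
  simpl. lra. }
apply Rnot_lt_le. intros Hneg.
set (p1 := C_derive phi b) in *. set (p2 := C_derive (C_derive phi) b) in *.
set (k := (/ (b * p1))%C).
set (E := fun s => (b * Cexp (Ci * s))%C).
assert (HE : forall t : R, Cmod (E (0 + t * 1)%C) = Cmod b).
{ intros t. unfold E. rewrite Cmod_mult, Cmod_Cexp.
  replace (Re (Ci * (0 + t * 1))) with 0 by (simpl; ring). rewrite exp_0. ring. }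
assert (HE0 : E (RtoC 0) = b). { unfold E. replace (Ci * 0)%C with (RtoC 0) by ring. rewrite Cexp_0. ring. }
assert (DE : forall s, is_cderive E s (Ci * E s)%C).
{ intros s. unfold E. replace (Ci * (b * Cexp (Ci * s)))%C with (b * ((Ci * 1) * Cexp (Ci * s)))%C by ring.
  apply is_cderive_scal. apply is_cderive_comp. apply is_cderive_Cexp.
  apply is_cderive_scal, is_cderive_id. }
set (G1 := fun s => (Ci * E s * C_derive phi (E s))%C).
assert (DG : forall t : R, is_cderive (fun s => phi (E s)) (0 + t * 1)%C (G1 (0 + t * 1)%C)).
{ intros t. unfold G1. apply (is_cderive_comp phi E); auto.
  apply analytic_C_derive_at; auto. unfold unit_disc. now rewrite HE. }
assert (DG1 : is_cderive G1 (RtoC 0) (- (b * p1 + b * b * p2))%C).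
{ assert (D : is_cderive G1 (RtoC 0)
     ((Ci * (Ci * E 0)) * C_derive phi (E 0) + (Ci * E 0) * ((Ci * E 0) * p2))%C).
  { unfold G1. apply (is_cderive_mult (fun s => Ci * E s)%C (fun s => C_derive phi (E s))).
    - apply is_cderive_scal. auto.
    - apply (is_cderive_comp (C_derive phi) E); auto. rewrite HE0.
      apply analytic_C_derive_at; auto. now apply analytic_derive. }
  rewrite HE0 in D. fold p1 in D.
  replace (- (b * p1 + b * b * p2))%C with ((Ci * Ci) * (b * p1 + b * b * p2))%C.
  - replace (Ci * Ci * (b * p1 + b * b * p2))%C with
     (Ci * (Ci * b) * p1 + Ci * b * (Ci * b * p2))%C by ring. exact D.
  - replace (Ci * Ci)%C with (- RtoC 1)%C
      by (unfold Ci, Cmult, RtoC, Copp; simpl; f_equal; ring). ring. }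
set (g1 := fun t : R => Re (k * G1 (0 + t * 1)%C)).
assert (Dg1 : derivable_pt_lim g1 0 (- Re (1 + b * p2 / p1))).
{ apply is_derive_Reals.
  replace (- Re (1 + b * p2 / p1)) with (Re (k * (1 * - (b * p1 + b * b * p2)))).
  - apply (is_derive_line k G1 0 (RtoC 1) 0).
    replace (0 + 0 * 1)%C with (RtoC 0) by ring. exact DG1.
  - rewrite <- re_opp. f_equal. unfold k. field. auto. }
assert (g10 : g1 0 = 0).
{ unfold g1, G1. replace (0 + 0 * 1)%C with (RtoC 0) by ring. rewrite HE0. fold p1.
  replace (k * (Ci * b * p1))%C with Ci by (unfold k; field; auto). reflexivity. }
set (p := - Re (1 + b * p2 / p1)) in *. assert (Hp : 0 < p) by (unfold p; lra).
destruct (Dg1 (p / 2)) as [d Hd]; [lra|].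
assert (Hdp := cond_pos d). set (t := d / 2).
assert (Ht : 0 < t < d) by (unfold t; lra).
destruct (MVT_cor2 (fun s => Re (k * phi (E (0 + s * 1)%C))) g1 0 t) as [c [Ec Hc]]; [lra| |].
{ intros c _. apply is_derive_Reals.
  replace (g1 c) with (Re (k * (1 * G1 (0 + c * 1)%C))).
  apply (is_derive_line k (fun s => phi (E s)) (RtoC 0) (RtoC 1) c). apply DG.
  unfold g1. f_equal. ring. }
specialize (Hd c ltac:(lra) ltac:(rewrite Rabs_right; lra)).
rewrite Rplus_0_l, g10 in Hd. apply Rabs_lt_between in Hd.
assert (Hg1c : 0 < g1 c).
{ replace (g1 c) with ((g1 c - 0) / c * c) by (field; lra). apply Rmult_lt_0_compat; lra. }
assert (Hsup := convex_support phi b (E (0 + t * 1)%C) Hconv Hb Hb0).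
rewrite HE in Hsup. specialize (Hsup (Rle_refl _)). fold p1 in Hsup.
replace (RtoC 0 + RtoC 0 * RtoC 1)%C with (RtoC 0) in Ec by ring. rewrite HE0 in Ec.
replace ((phi (E (0 + t * 1)%C) - phi b) / (b * p1))%C with
 (k * phi (E (0 + t * 1)%C) - k * phi b)%C in Hsup by (unfold k; field; auto).
unfold Cminus in Hsup. rewrite re_plus, re_opp in Hsup.
assert (0 < g1 c * (t - 0)) by (apply Rmult_lt_0_compat; lra). lra.
Qed.

(** * Derivatives at extrema on discs *)

(** Moving from [z0] to [z0 * (1 + t * lam)] stays in the disc for small [t]. *)
Lemma max_Re_direction F z0 l lam : is_cderive F z0 l ->
  (forall z, Cmod z <= Cmod z0 -> Re (F z) <= Re (F z0)) ->
  Re lam < 0 -> Re (lam * (z0 * l)) <= 0.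
Proof.
intros HF Hmax Hlam. apply Rnot_lt_le. intros Hs. set (s := Re (lam * (z0 * l))) in *.
rewrite is_cderive_iff in HF. pose proof (Cmod_ge_0 (lam * z0)) as Hv. set (v := Cmod (lam * z0)) in *.
destruct (HF (s / (2 * (v + 1)))) as [d [Hd H]]. { apply Rdiv_lt_0_compat; lra. }
assert (Hl2 : 0 <= Cmod lam ^ 2) by apply pow2_ge_0.
set (t := Rmin (d / (2 * (v + 1))) (- 2 * Re lam / (Cmod lam ^ 2 + 1))).
assert (Ht : 0 < t) by (apply Rmin_glb_lt; apply Rdiv_lt_0_compat; lra).
assert (Ht1 : t * (2 * (v + 1)) <= d) by (apply Rle_div_r; [lra|apply Rmin_l]).
assert (Ht2 : t * (Cmod lam ^ 2 + 1) <= - 2 * Re lam) by (apply Rle_div_r; [lra|apply Rmin_r]).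
specialize (H (t * (lam * z0))%C). rewrite Cmod_mult, Cmod_R, Rabs_right in H by lra. fold v in H.
specialize (H ltac:(nra)).
assert (Hin : Cmod (z0 + t * (lam * z0)) <= Cmod z0).
{ replace (z0 + t * (lam * z0))%C with ((1 + t * lam) * z0)%C by ring.
  rewrite Cmod_mult. rewrite <- (Rmult_1_l (Cmod z0)) at 2.
  apply Rmult_le_compat_r; [apply Cmod_ge_0|].
  assert (E : Cmod (1 + t * lam) ^ 2 = 1 + t * (2 * Re lam + t * Cmod lam ^ 2)).
  { rewrite !Cmod2_alt. destruct lam as [x y]. simpl. ring. }
  assert (t * (2 * Re lam + t * Cmod lam ^ 2) <= 0).
  { apply Rmult_le_0_l; [lra|]. nra. }
  pose proof (Cmod_ge_0 (1 + t * lam)). nra. }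
specialize (Hmax _ Hin).
set (err := (F (z0 + t * (lam * z0))%C - F z0 - t * (lam * z0) * l)%C) in *.
assert (E : Re err = Re (F (z0 + t * (lam * z0))%C) - Re (F z0) - t * s).
{ unfold err, s, Cminus. rewrite !re_plus, !re_opp, <- re_scal_l.
  replace (t * (lam * z0) * l)%C with (t * (lam * (z0 * l)))%C by ring. ring. }
assert (HR := re_le_Cmod err). apply Rabs_le_between in HR.
assert (s / (2 * (v + 1)) * (t * v) <= t * s / 2).
{ apply Rle_trans with (t * s / 2 * (v / (v + 1))). right; field; lra.
  rewrite <- (Rmult_1_r (t * s / 2)) at 2. apply Rmult_le_compat_l; [nra|]. apply Rle_div_l; lra. }
assert (0 < t * s) by now apply Rmult_lt_0_compat. lra.
Qed.

(** The directions are [-1], which is radial, and nearly tangential ones that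
    would detect a nonzero imaginary part. *)
Theorem max_Re_derive F z0 l : is_cderive F z0 l ->
  (forall z, Cmod z <= Cmod z0 -> Re (F z) <= Re (F z0)) ->
  0 <= Re (z0 * l) /\ Im (z0 * l) = 0.
Proof.
intros HF Hmax. assert (H := fun lam => max_Re_direction F z0 l lam HF Hmax).
set (c := (z0 * l)%C) in *. clearbody c. split.
- specialize (H (- 1)%C ltac:(simpl; lra)). rewrite re_mult in H. simpl in H.
  change (fst c) with (Re c) in H. lra.
- apply NNPP. intros Hy.
  set (x := Re c) in *. set (y := Im c) in *.
  set (dl := y * y / (2 * (Rabs x + 1))). pose proof (Rabs_pos x) as Hx.
  assert (Hyy : 0 < y * y) by nra.
  assert (Hdl : 0 < dl) by (apply Rdiv_lt_0_compat; lra).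
  specialize (H (- dl, - y) ltac:(simpl; lra)). rewrite re_mult in H. simpl in H.
  change (fst c) with x in H. change (snd c) with y in H.
  assert (dl * x <= y * y / 2).
  { apply Rle_trans with (dl * (Rabs x + 1)). apply Rmult_le_compat_l; [lra|]. pose proof (Rle_abs x). lra.
    right. unfold dl. field. lra. }
  fold x y in H. lra.
Qed.

Theorem max_Cmod_derive f z0 l : is_cderive f z0 l -> f z0 <> 0 ->
  (forall z, Cmod z <= Cmod z0 -> Cmod (f z) <= Cmod (f z0)) ->
  exists k, 0 <= k /\ (z0 * l)%C = (k * f z0)%C.
Proof.
intros Hf Hn Hmax. apply Cmod_gt_0 in Hn as Hp.
destruct (max_Re_derive (fun z => / f z0 * f z)%C z0 (/ f z0 * l)%C) as [H1 H2].
- now apply is_cderive_scal.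
- intros z Hz. rewrite (Cinv_l (f z0)) by auto.
  eapply Rle_trans; [apply Rle_abs|]. eapply Rle_trans; [apply re_le_Cmod|].
  rewrite Cmod_mult, Cmod_inv by auto. simpl (Re 1).
  rewrite <- (Rinv_l (Cmod (f z0))) by lra. apply Rmult_le_compat_l; auto.
  left; now apply Rinv_0_lt_compat.
- exists (Re (z0 * (/ f z0 * l))). split; auto.
  assert (E : (z0 * (/ f z0 * l))%C = RtoC (Re (z0 * (/ f z0 * l)))).
  { set (c := (z0 * (/ f z0 * l))%C) in *. destruct c as [x y]. simpl in H2 |- *. now rewrite H2. }
  rewrite <- E. field. auto.
Qed.

(** At a minimum of [Re T] on a disc, [z * T'] is real and at most 0, so
    [A * T] is real and at least 1. *)
Theorem positive_real_part (T A : C -> C) : analytic_in_disc T ->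
  (forall z, unit_disc z -> 0 < Re (A z)) ->
  (forall z, unit_disc z -> (1 - z * C_derive T z = A z * T z)%C) ->
  forall z, unit_disc z -> 0 < Re (T z).
Proof.
intros HT HA HE z Hz. unfold unit_disc in Hz.
destruct (disc_max (Cmod z) (fun w => Re (0 - T w))) as [z0 [Hz0 Hmax]].
{ apply Cmod_ge_0. }
{ intros w Hw. apply (ccontinuous_Re (fun w => 0 - T w)%C). apply ccontinuous_minus.
  apply ccontinuous_const. apply analytic_ccontinuous; auto; lra. }
assert (Hz0d : unit_disc z0) by (unfold unit_disc; lra).
destruct (max_Re_derive (fun w => 0 - T w)%C z0 (0 - C_derive T z0)%C) as [H1 H2].
- apply is_cderive_minus. apply is_cderive_const. now apply analytic_C_derive_at.
- intros w Hw. apply Hmax. lra.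
- assert (H3 := Hmax z (Rle_refl _)).
  change (0 - Re (T z) <= 0 - Re (T z0)) in H3.
  apply Rlt_le_trans with (Re (T z0)); [|lra].
  specialize (HA z0 Hz0d). specialize (HE z0 Hz0d).
  assert (E1 : (1 + z0 * (0 - C_derive T z0) = A z0 * T z0)%C) by (rewrite <- HE; ring).
  set (c := (z0 * (0 - C_derive T z0))%C) in *.
  assert (ER := f_equal Re E1). assert (EI := f_equal Im E1).
  rewrite re_plus, re_mult in ER. rewrite im_plus, im_mult, H2 in EI. simpl (Re 1) in ER. simpl (Im 1) in EI.
  set (x := Re (A z0)) in *. set (y := Im (A z0)) in *. set (u := Re (T z0)) in *. set (v := Im (T z0)) in *.
  assert (u * (x * x + y * y) = x * (1 + Re c)).
  { replace (u * (x * x + y * y)) with (x * (x * u - y * v) + y * (x * v + y * u)) by ring.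
    rewrite <- ER, <- EI. ring. }
  assert (0 < x * (1 + Re c)) by (apply Rmult_lt_0_compat; lra).
  apply Rnot_le_lt. intros Hu. assert (0 <= x * x + y * y) by nra. nra.
Qed.

Lemma Re_inv_pos z : 0 < Re z -> 0 < Re (/ z).
Proof.
intros H. destruct z as [x y]. simpl in *.
assert (0 < x * (x * 1) + y * (y * 1)) by nra. now apply Rdiv_lt_0_compat.
Qed.

(** * The Briot-Bouquet differential equation *)

(** This eliminates [phi'] when [psi' / (psi * phi')] is differentiated. *)
Lemma ode_derive phi psi : analytic_in_disc psi -> solves_ode phi psi ->
  forall z, unit_disc z ->
  (psi z * psi z * C_derive phi z =
   z * (C_derive (C_derive psi) z * psi z - C_derive psi z * C_derive psi z)
   + psi z * C_derive psi z * (1 + psi z))%C.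
Proof.
intros Hpsi Hode z Hz. destruct (Hode z Hz) as [Hn _].
assert (D1 := analytic_C_derive_at psi z Hpsi Hz).
assert (D2 := analytic_C_derive_at _ z (analytic_derive psi Hpsi) Hz).
set (p1 := C_derive psi z) in *. set (p2 := C_derive (C_derive psi) z) in *.
assert (E : C_derive phi z = (p1 + (((1 * p1 + z * p2) * psi z - (z * p1) * p1) / (psi z * psi z)))%C).
{ apply is_C_derive_unique. apply disc_ext with (fun z => psi z + z * C_derive psi z / psi z)%C; auto.
  - intros w Hw. now apply Hode.
  - apply is_cderive_plus; [exact D1|].
    apply (is_cderive_div (fun z => z * C_derive psi z)%C psi); auto.
    apply (is_cderive_mult (fun z => z) (C_derive psi)); auto. apply is_cderive_id. }
rewrite E. field. auto.
Qed.

Lemma ode_Re_pos phi psi : analytic_in_disc psi -> solves_ode phi psi ->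
  (forall z, unit_disc z -> 0 < Re (phi z)) -> forall z, unit_disc z -> 0 < Re (psi z).
Proof.
intros Hpsi Hode Hpos z Hz.
assert (H : 0 < Re (1 / psi z)).
{ apply (positive_real_part (fun z => 1 / psi z)%C phi); auto.
  - apply analytic_div; auto. apply analytic_const. intros w Hw; apply (Hode w Hw).
  - intros w Hw. destruct (Hode w Hw) as [Hn <-].
    assert (D := is_C_derive_unique (fun z : C => 1 / psi z)%C w _
      (is_cderive_div (fun _ => RtoC 1) psi w _ _
        (is_cderive_const _ _) (analytic_C_derive_at psi w Hpsi Hw) Hn)).
    rewrite D. field. auto. }
destruct (Hode z Hz) as [Hn _]. apply Re_inv_pos in H.
now replace (/ (1 / psi z))%C with (psi z) in H by (field; auto).
Qed.

(** Differentiating [psi + z * T * phi' = phi], where [psi' = T * psi * phi'],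
    and dividing by [phi'] yields [1 - z * T' = (1 + z * phi'' / phi' + psi) * T]. *)
Lemma ode_close_to_convex phi psi : convex_in_disc phi -> analytic_in_disc psi -> solves_ode phi psi ->
  (forall z, unit_disc z -> 0 < Re (phi z)) -> forall z, unit_disc z ->
  0 < Re (C_derive psi z / (psi z * C_derive phi z)).
Proof.
intros Hconv Hpsi Hode Hpos.
assert (Hphi := proj1 Hconv). assert (Hi : injective_in_disc phi) by exact (proj1 (proj2 Hconv)).
assert (Hn : forall z, unit_disc z -> psi z <> 0) by (intros z Hz; apply (Hode z Hz)).
assert (Hn1 : forall z, unit_disc z -> C_derive phi z <> 0)
  by (intros; now apply injective_derive_neq_0).
apply (positive_real_part (fun z => C_derive psi z / (psi z * C_derive phi z))%C
   (fun z => (1 + z * C_derive (C_derive phi) z / C_derive phi z) + psi z)%C).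
- apply analytic_div. now apply analytic_derive. apply analytic_mult; auto. now apply analytic_derive.
  intros z Hz. apply Cmult_neq_0; auto.
- intros z Hz. rewrite re_plus. pose proof (convex_curvature phi z Hconv Hz).
  pose proof (ode_Re_pos phi psi Hpsi Hode Hpos z Hz). lra.
- intros z Hz. assert (E := ode_derive phi psi Hpsi Hode z Hz).
  assert (D1 := analytic_C_derive_at psi z Hpsi Hz).
  assert (D2 := analytic_C_derive_at _ z (analytic_derive psi Hpsi) Hz).
  assert (F2 := analytic_C_derive_at _ z (analytic_derive phi Hphi) Hz).
  specialize (Hn z Hz). specialize (Hn1 z Hz).
  assert (D := is_cderive_div (C_derive psi) (fun z => psi z * C_derive phi z)%C z _ _ D2
     (is_cderive_mult psi (C_derive phi) z _ _ D1 F2) (Cmult_neq_0 _ _ Hn Hn1)).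
  rewrite (is_C_derive_unique (fun z : C => C_derive psi z / (psi z * C_derive phi z))%C _ _ D).
  set (p0 := psi z) in *. set (p1 := C_derive psi z) in *. set (p2 := C_derive (C_derive psi) z) in *.
  set (f1 := C_derive phi z) in *. set (f2 := C_derive (C_derive phi) z) in *.
  transitivity ((p0 * p0 * f1) / (p0 * p0 * f1) - z * ((p2 * (p0 * f1) - p1 * (p1 * f1 + p0 * f2)) / (p0 * f1 * (p0 * f1))))%C.
  { field. auto. }
  rewrite E at 1. field. auto.
Qed.

(** * Lifting through a close-to-convex function *)

(** The inner product of the increments of [Psi] and [phi] is positive: this
    is the Noshiro-Warschawski argument on the convex image of [phi]. *)
Lemma close_to_convex_injective phi Psi (T : C -> C) : convex_in_disc phi -> analytic_in_disc Psi ->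
  (forall z, unit_disc z -> C_derive Psi z = (T z * C_derive phi z)%C /\ 0 < Re (T z)) ->
  injective_in_disc Psi.
Proof.
intros Hconv HPsi HT z1 z2 Hz1 Hz2 E.
assert (Hphi := proj1 Hconv). assert (Hi : injective_in_disc phi) by exact (proj1 (proj2 Hconv)).
apply Hi; auto. apply NNPP. intros Hne.
set (D := (phi z2 - phi z1)%C).
assert (HD : 0 < Cmod D).
{ apply Cmod_gt_0. intros ED. apply Hne. symmetry. now apply Ceq_minus. }
assert (Him : forall t, 0 <= t <= 1 -> in_image phi (phi z1 + t * D)%C).
{ intros t Ht. destruct Hconv as [_ [_ Hc]].
  replace (phi z1 + t * D)%C with (RtoC (1 - t) * phi z1 + t * phi z2)%C
    by (unfold D; rewrite RtoC_minus; ring).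
  apply Hc; auto. now exists z1. now exists z2. }
destruct (MVT_cor2 (fun t => Re (Cconj D * Psi (inverse phi (phi z1 + t * D)%C)))
  (fun t => Re (Cconj D * (D * T (inverse phi (phi z1 + t * D)%C)))) 0 1) as [c [Ec Hc]]; [lra| |].
- intros t Ht. apply is_derive_Reals.
  apply (is_derive_line (Cconj D) (fun u => Psi (inverse phi u)) (phi z1) D t).
  destruct (inverse_spec _ _ (Him t Ht)) as [I1 I2]. set (a := inverse phi (phi z1 + t * D)%C) in *.
  replace (T a) with (/ C_derive phi a * C_derive Psi a)%C.
  + apply (is_cderive_comp Psi (inverse phi)).
    * now apply analytic_C_derive_at.
    * rewrite <- I2. now apply inverse_derive.
  + rewrite (proj1 (HT a I1)). field. now apply injective_derive_neq_0.
- replace (phi z1 + 1 * D)%C with (phi z2) in Ec by (unfold D; ring).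
  replace (phi z1 + 0 * D)%C with (phi z1) in Ec by ring.
  rewrite !inverse_left, E in Ec by auto.
  destruct (inverse_spec _ _ (Him c ltac:(lra))) as [I1 _].
  assert (HTc := proj2 (HT _ I1)). set (Tc := T (inverse phi (phi z1 + c * D)%C)) in *.
  rewrite Cmult_assoc, Cmult_Cconj, re_scal_l in Ec.
  assert (0 < Cmod D ^ 2 * Re Tc) by (apply Rmult_lt_0_compat; [nra|auto]). lra.
Qed.

(** Let [omega] be the lift of [P] through [Psi]. At a maximum of
    [Cmod (omega z / z)] on a disc, [z * omega' / omega] is real and at least 1.
    If that maximum exceeded [c], then [z * V z] would be closer to 0 than
    [omega z], while by the differential equations [phi (z * V z)] would lie
    beyond the line supporting the image of the disc through [omega z] at
    [phi (omega z)]. *)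
Lemma lift_bound phi Psi (T P V : C -> C) c : convex_in_disc phi ->
  analytic_in_disc Psi -> Psi 0 = 0 ->
  (forall z, unit_disc z -> C_derive Psi z = (T z * C_derive phi z)%C /\ 0 < Re (T z)) ->
  (forall z, unit_disc z -> (z * C_derive Psi z = phi z - Cexp (Psi z))%C) ->
  analytic_in_disc P -> P 0 = 0 ->
  analytic_in_disc V -> c <= 1 -> (forall z, unit_disc z -> Cmod (V z) <= c) ->
  (forall z, unit_disc z -> (z * C_derive P z = phi (z * V z) - Cexp (P z))%C) ->
  (forall z, unit_disc z -> in_image Psi (P z)) ->
  forall z, unit_disc z -> Cmod (inverse Psi (P z)) <= c * Cmod z.
Proof.
intros Hconv HPsi HPsi0 HT EPsi HP HP0 HV Hc HVc EP Him z1 Hz1.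
assert (Hphi := proj1 Hconv). assert (Hi : injective_in_disc phi) by exact (proj1 (proj2 Hconv)).
assert (HPi := close_to_convex_injective phi Psi T Hconv HPsi HT).
set (om := fun z => inverse Psi (P z)).
assert (Hom : forall z, unit_disc z -> unit_disc (om z) /\ Psi (om z) = P z).
{ intros z Hz. apply inverse_spec; auto. }
assert (Aom : analytic_in_disc om).
{ intros z Hz. destruct (Hom z Hz) as [I1 I2]. destruct (HP z Hz) as [l Hl].
  eexists. apply (is_cderive_comp (inverse Psi) P); [|exact Hl].
  rewrite <- I2. now apply inverse_derive. }
assert (Hom0 : om 0 = 0).
{ unfold om. replace (P 0) with (Psi 0) by congruence.
  apply inverse_left; auto using unit_disc_0. }
destruct (analytic_divide om Aom) as [B [HB EB]].
assert (EB' : forall z, unit_disc z -> om z = (z * B z)%C).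
{ intros z Hz. rewrite (EB z Hz), Hom0. ring. }
assert (Dom : forall z, unit_disc z -> is_cderive om z (1 * B z + z * C_derive B z)%C).
{ intros z Hz. apply disc_ext with (fun z => z * B z)%C; auto. intros w Hw; now rewrite EB'.
  apply (is_cderive_mult (fun z => z) B). apply is_cderive_id. now apply analytic_C_derive_at. }
assert (DP : forall z, unit_disc z ->
  C_derive P z = ((1 * B z + z * C_derive B z) * C_derive Psi (om z))%C).
{ intros z Hz. apply is_C_derive_unique. apply disc_ext with (fun z => Psi (om z)); auto.
  intros w Hw; now apply Hom. apply (is_cderive_comp Psi om); auto.
  apply analytic_C_derive_at; auto. now apply Hom. }
fold (om z1). apply Rnot_lt_le. intros Hbad. unfold unit_disc in Hz1.
destruct (disc_Cmod_max (Cmod z1) B) as [z0 [Hz0 Hmax]].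
{ apply Cmod_ge_0. }
{ intros w Hw. apply analytic_ccontinuous; auto; lra. }
assert (Hz0d : unit_disc z0) by (unfold unit_disc; lra).
assert (HB0 : c < Cmod (B z0)).
{ apply Rlt_le_trans with (Cmod (B z1)); [|apply Hmax; lra].
  rewrite EB', Cmod_mult, Rmult_comm in Hbad by auto. pose proof (Cmod_ge_0 z1). nra. }
destruct (Ceq_dec z0 0) as [E0|N0].
- (* at the origin [B] is [omega' 0]; differentiating both equations once
     there gives [2 * P' = phi' * V] and [2 * Psi' = phi'] *)
  subst z0. 
  assert (Dz : forall F, analytic_in_disc F -> is_cderive (fun z => z * C_derive F z)%C (RtoC 0) (C_derive F (RtoC 0))).
  { intros F HF. apply is_cderive_times_id. now apply analytic_derive. }
  assert (Q1 : C_derive Psi 0 = (C_derive phi 0 - C_derive Psi 0 * Cexp (Psi 0))%C).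
  { apply (is_cderive_unique (fun z => z * C_derive Psi z)%C 0); auto.
    apply disc_ext with (fun z => phi z - Cexp (Psi z))%C. apply unit_disc_0.
    intros w Hw; now rewrite EPsi.
    apply is_cderive_minus. apply analytic_C_derive_at; auto.
    apply is_cderive_comp. apply is_cderive_Cexp. apply analytic_C_derive_at; auto. }
  assert (Q2 : C_derive P 0 = (V 0 * C_derive phi 0 - C_derive P 0 * Cexp (P 0))%C).
  { apply (is_cderive_unique (fun z => z * C_derive P z)%C 0); auto.
    apply disc_ext with (fun z => phi (z * V z)%C - Cexp (P z))%C. apply unit_disc_0.
    intros w Hw; now rewrite EP.
    apply is_cderive_minus.
    - apply (is_cderive_comp phi (fun z => z * V z)%C). replace (0 * V 0)%C with (RtoC 0) by ring.
      apply analytic_C_derive_at; auto. now apply is_cderive_times_id.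
    - apply is_cderive_comp. apply is_cderive_Cexp. apply analytic_C_derive_at; auto. }
  rewrite HPsi0, Cexp_0 in Q1. rewrite HP0, Cexp_0 in Q2.
  rewrite (DP _ Hz0d), Hom0 in Q2.
  assert (HT0 := HT _ Hz0d). destruct HT0 as [HT1 HT2].
  assert (Nphi := injective_derive_neq_0 phi _ Hphi Hi Hz0d).
  assert (NPsi : C_derive Psi 0 <> 0) by now apply injective_derive_neq_0.
  assert (Q1' : C_derive phi 0 = (2 * C_derive Psi 0)%C).
  { transitivity ((C_derive phi 0 - C_derive Psi 0 * 1) + C_derive Psi 0)%C. ring. rewrite <- Q1. ring. }
  rewrite Q1' in Q2.
  assert (EV : B 0 = V 0).
  { assert (Q3 : (2 * C_derive Psi 0 * B 0 = 2 * C_derive Psi 0 * V 0)%C).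
    { set (X := ((1 * B 0 + 0 * C_derive B 0) * C_derive Psi 0)%C) in *.
      transitivity (X + X)%C. unfold X; ring. rewrite Q2 at 1. ring. }
    assert (N2 : (2 * C_derive Psi 0)%C <> 0).
    { apply Cmult_neq_0; auto. apply RtoC_neq_0; lra. }
    replace (B 0) with ((2 * C_derive Psi 0 * B 0) / (2 * C_derive Psi 0))%C.
    rewrite Q3. field. auto. field. auto. }
  specialize (HVc _ Hz0d). rewrite EV in HB0. lra.
- destruct (max_Cmod_derive B z0 (C_derive B z0)) as [k [Hk Ek]].
  + now apply analytic_C_derive_at.
  + apply Cmod_gt_0. eapply Rle_lt_trans; [|exact HB0].
    eapply Rle_trans; [apply Cmod_ge_0|apply (HVc _ Hz0d)].
  + intros w Hw. apply Hmax. lra.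
  + destruct (Hom z0 Hz0d) as [I1 I2]. set (o := om z0) in *.
    assert (Eo : o = (z0 * B z0)%C) by now apply EB'.
    assert (HoW : Cmod (z0 * V z0) < Cmod o).
    { rewrite Eo, !Cmod_mult. apply Cmod_gt_0 in N0. specialize (HVc z0 Hz0d).
      apply Rmult_lt_compat_l; lra. }
    assert (No : o <> 0).
    { apply Cmod_gt_0. eapply Rle_lt_trans; [apply Cmod_ge_0|exact HoW]. }
    destruct (HT o I1) as [HT1 HT2].
    assert (Nphi := injective_derive_neq_0 phi o Hphi Hi I1).
    assert (Q : (phi (z0 * V z0)%C - phi o = RtoC k * (o * (T o * C_derive phi o)))%C).
    { assert (A1 := EP z0 Hz0d). rewrite (DP z0 Hz0d) in A1. fold o in A1. rewrite <- I2 in A1.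
      assert (A2 := EPsi o I1).
      replace (z0 * ((1 * B z0 + z0 * C_derive B z0) * C_derive Psi o))%C with
        ((z0 * B z0 + z0 * (z0 * C_derive B z0)) * C_derive Psi o)%C in A1 by ring.
      rewrite Ek in A1.
      replace ((z0 * B z0 + z0 * (k * B z0)) * C_derive Psi o)%C with
        (o * C_derive Psi o + k * (o * C_derive Psi o))%C in A1 by (rewrite Eo; ring).
      rewrite <- HT1.
      replace (phi (z0 * V z0)%C - phi o)%C with
        ((phi (z0 * V z0)%C - Cexp (Psi o)) - (phi o - Cexp (Psi o)))%C by ring.
      rewrite <- A1, <- A2. ring. }
    assert (Sup := convex_support phi o (z0 * V z0)%C Hconv I1 No (Rlt_le _ _ HoW)).
    rewrite Q in Sup.
    replace (k * (o * (T o * C_derive phi o)) / (o * C_derive phi o))%C with (k * T o)%C in Sup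
      by (field; auto).
    rewrite re_scal_l in Sup.
    assert (k = 0).
    { destruct (Rle_lt_or_eq_dec _ _ Hk) as [Hk'|]; auto.
      assert (0 < k * Re (T o)) by now apply Rmult_lt_0_compat. lra. }
    subst k. assert (EQ : phi (z0 * V z0)%C = phi o).
    { apply Ceq_minus. rewrite Q. ring. }
    apply Hi in EQ; auto. rewrite EQ in HoW. lra.
    unfold unit_disc in *. lra.
Qed.

(** Openness of the image is uniform on compact sets, so that the radius up
    to which [P] takes its values in the image of [Psi] can be increased by
    fixed steps: at each step the lift stays in the same compact disc. *)
Theorem lift_exists phi Psi (T P V : C -> C) : convex_in_disc phi ->
  analytic_in_disc Psi -> Psi 0 = 0 ->
  (forall z, unit_disc z -> C_derive Psi z = (T z * C_derive phi z)%C /\ 0 < Re (T z)) ->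
  (forall z, unit_disc z -> (z * C_derive Psi z = phi z - Cexp (Psi z))%C) ->
  analytic_in_disc P -> P 0 = 0 ->
  analytic_in_disc V -> (forall z, unit_disc z -> Cmod (V z) <= 1) ->
  (forall z, unit_disc z -> (z * C_derive P z = phi (z * V z) - Cexp (P z))%C) ->
  forall z, unit_disc z -> exists zeta, Cmod zeta <= Cmod z /\ Psi zeta = P z.
Proof.
intros Hconv HPsi HPsi0 HT EPsi HP HP0 HV HV1 EP.
assert (HPi := close_to_convex_injective phi Psi T Hconv HPsi HT).
assert (Hlift : forall rho, 0 < rho <= 1 -> (forall z, Cmod z < rho -> in_image Psi (P z)) ->
   forall z, Cmod z < rho -> exists zeta, Cmod zeta <= Cmod z /\ Psi zeta = P z).
{ intros rho Hrho Him z Hz.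
  assert (Hrn : RtoC rho <> 0) by (apply RtoC_neq_0; lra).
  assert (Hsc : forall u, unit_disc u -> unit_disc (0 + rho * u)%C).
  { intros u Hu. unfold unit_disc in *. rewrite Cplus_0_l, Cmod_scal_R by lra.
    pose proof (Cmod_ge_0 u). nra. }
  assert (Ha : Cmod 0 + rho <= 1) by (rewrite Cmod_0; lra).
  set (u := (z / rho)%C).
  assert (Hzu : z = (0 + rho * u)%C) by (unfold u; field; auto).
  assert (Hu : unit_disc u).
  { unfold unit_disc, u. rewrite Cmod_div, Cmod_R, Rabs_right by (auto; lra). apply Rlt_div_l; lra. }
  assert (L := lift_bound phi Psi T (fun u => P (0 + rho * u)%C)
     (fun u => RtoC rho * V (0 + rho * u))%C rho Hconv HPsi HPsi0 HT EPsi).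
  exists (inverse Psi (P z)). split.
  - assert (L' : Cmod (inverse Psi (P (0 + rho * u)%C)) <= rho * Cmod u).
    { apply L; auto; clear L.
      - apply (analytic_affine P); auto; lra.
      - transitivity (P 0); [f_equal; ring|exact HP0].
      - apply analytic_mult. apply analytic_const. apply (analytic_affine V); auto; lra.
      - lra.
      - intros w Hw. rewrite Cmod_scal_R by lra.
        specialize (HV1 _ (Hsc w Hw)). nra.
      - intros w Hw. rewrite C_derive_affine by auto.
        replace (w * (rho * C_derive P (0 + rho * w)))%C with ((0 + rho * w) * C_derive P (0 + rho * w))%C by ring.
        rewrite EP by auto. f_equal. f_equal. ring.
      - intros w Hw. apply Him. unfold unit_disc in Hw.
        rewrite Cplus_0_l, Cmod_scal_R by lra. nra. }
    rewrite <- Hzu in L'. eapply Rle_trans; [exact L'|]. right.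
    rewrite Hzu, Cplus_0_l, Cmod_scal_R; lra.
  - apply inverse_spec, Him, Hz. }
assert (Hall : forall sg, 0 < sg < 1 -> forall z, Cmod z < sg -> in_image Psi (P z)).
{ intros sg Hsg.
  destruct (compact_uniform sg (fun a e => forall v, Cmod (v - Psi a) < e -> in_image Psi v)) as [eta [Heta Hop]].
  - intros a e e' _ Hle H v Hv. apply H. lra.
  - intros a Ha.
    destruct (image_open Psi (Psi a) HPsi HPi) as [d [Hd H]].
    { exists a. split; auto. unfold unit_disc. lra. }
    assert (Hc := analytic_ccontinuous Psi a HPsi ltac:(lra)). rewrite continuous_C_iff in Hc.
    destruct (Hc (d / 2)) as [e1 [He1 H1]]; [lra|].
    exists (Rmin e1 (d / 2)). split; [apply Rmin_glb_lt; lra|].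
    intros z _ Hz v Hv. apply H.
    replace (v - Psi a)%C with ((v - Psi z) + (Psi z - Psi a))%C by ring.
    eapply Rle_lt_trans; [apply Cmod_triangle|].
    apply Rlt_Rmin in Hz as [Hz _]. apply Rlt_Rmin in Hv as [_ Hv]. specialize (H1 z Hz). lra.
  - destruct (disc_uniform_continuity sg P) with (eps := eta) as [dl [Hdl Huc]]; auto.
    { intros z Hz. apply analytic_ccontinuous; auto. lra. }
    (* a point of the next radius is moved inwards by 3/4 of the modulus of
       continuity: more than the step 1/2, less than the whole *)
    assert (Hn : forall n : nat, forall z, Cmod z < sg -> Cmod z < INR n * (dl / 2) -> in_image Psi (P z)).
    { induction n as [|n IH]; intros z Hz1 Hz2.
      - simpl in Hz2. pose proof (Cmod_ge_0 z). lra.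
      - rewrite S_INR in Hz2. 
        assert (Hstep : exists z', Cmod z' <= sg /\ Cmod (z - z') < dl /\
           exists zeta, Cmod zeta <= sg /\ Psi zeta = P z').
        { destruct (Rle_or_lt (Cmod z) (3 / 4 * dl)) as [Hs|Hs].
          - exists 0. rewrite Cmod_0. split; [lra|]. split.
            replace (z - 0)%C with z by ring. lra.
            exists 0. rewrite Cmod_0. split; [lra|]. now rewrite HPsi0, HP0.
          - set (s := 1 - 3 / 4 * dl / Cmod z).
            assert (Hzp : 0 < Cmod z) by lra.
            assert (Hs1 : s * Cmod z = Cmod z - 3 / 4 * dl) by (unfold s; field; lra).
            assert (Hs0 : 0 < s).
            { apply Rmult_lt_reg_r with (Cmod z); auto. lra. }
            assert (Hz' : Cmod (s * z) = Cmod z - 3 / 4 * dl).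
            { rewrite Cmod_scal_R by lra. exact Hs1. }
            exists (s * z)%C. split; [lra|]. split.
            + replace (z - s * z)%C with (RtoC (1 - s) * z)%C by (rewrite RtoC_minus; ring).
              assert (1 - s = 3 / 4 * dl / Cmod z) by (unfold s; ring).
              assert (0 < 3 / 4 * dl / Cmod z) by (apply Rdiv_lt_0_compat; lra).
              rewrite Cmod_scal_R by lra.
              replace ((1 - s) * Cmod z) with (3 / 4 * dl) by (unfold s; field; lra). lra.
            + destruct (Hlift (Rmin sg (INR n * (dl / 2)))) with (z := (s * z)%C) as [zeta [Hze Eze]].
              * split; [|eapply Rle_trans; [apply Rmin_l|lra]]. apply Rmin_glb_lt; [lra|].
                pose proof (Cmod_ge_0 (s * z)). lra.
              * intros w Hw. apply Rlt_Rmin in Hw as [Hw1 Hw2]. now apply IH.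
              * rewrite Hz'. apply Rmin_glb_lt; lra.
              * exists zeta. split; [lra|auto]. }
        destruct Hstep as [z' [H1 [H2 [zeta [H3 H4]]]]].
        apply (Hop zeta H3). rewrite H4. apply Huc; auto. lra. }
    intros z Hz. destruct (archimed_cor1 (dl / 2)) as [N [HN1 HN2]]; [lra|].
    apply (Hn N); auto.
    assert (0 < INR N) by now apply lt_0_INR.
    apply Rlt_trans with 1; [lra|].
    apply Rmult_lt_reg_l with (/ INR N). now apply Rinv_0_lt_compat.
    rewrite Rmult_1_r, <- Rmult_assoc, Rinv_l, Rmult_1_l by lra. exact HN1. }
intros z Hz. unfold unit_disc in Hz. apply (Hlift 1); try lra.
intros w Hw. pose proof (Cmod_ge_0 w). apply (Hall ((Cmod w + 1) / 2)); lra.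
Qed.

(** * Subordination for the class of [phi] *)

Lemma expands_at_0 a f : expands_in_disc a f -> f 0 = a O.
Proof.
intros H. destruct (expands_divide _ _ H) as [G [_ E]]. rewrite (E _ unit_disc_0). ring.
Qed.

Lemma class_A_intro f : analytic_in_disc f -> f 0 = 0 ->
  C_derive f 0 = 1 -> class_A f.
Proof.
intros Hf H0 H1. split; auto. exists (taylor_coeff f). assert (Ht := taylor f Hf).
split; [|split]; auto.
- now rewrite <- (expands_at_0 _ _ Ht).
- destruct (expands_divide _ _ Ht) as [G [HG E]].
  rewrite <- (expands_at_0 _ _ HG), <- H1. symmetry. apply is_C_derive_unique.
  apply disc_ext with (fun z => z * G z)%C. apply unit_disc_0.
  + intros w Hw. rewrite (E w Hw), <- (expands_at_0 _ _ Ht), H0. ring.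
  + apply is_cderive_times_id. eapply expands_analytic; eauto.
Qed.

(** The Miller-Mocanu subordination of [z * f' / f] to [psi], multiplied by
    [f]. The logarithm of [z * f' / f] is lifted through that of [psi];
    [z * f' / f] is analytic because its reciprocal [q] has positive real
    part. *)
Theorem class_C_subordination phi psi f : convex_in_disc phi ->
  (forall z, unit_disc z -> 0 < Re (phi z)) ->
  analytic_in_disc psi -> psi 0 = 1 -> solves_ode phi psi -> class_C phi f ->
  forall z, unit_disc z -> exists zeta, Cmod zeta <= Cmod z /\ (f z * psi zeta = z * C_derive f z)%C.
Proof.
intros Hconv Hpos Hpsi Hpsi0 Hode [[Hf [a [Ha0 [_ Ha]]]] [Hf1 [w [Hw [Hw0 Hsub]]]]].
assert (Hphi := proj1 Hconv). assert (Hi : injective_in_disc phi) by exact (proj1 (proj2 Hconv)).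
assert (Hpn : forall z, unit_disc z -> psi z <> 0) by (intros z Hz; apply (Hode z Hz)).
assert (Hf0 : f 0 = 0) by (rewrite (expands_at_0 _ _ Ha); auto).
destruct (schwarz w Hw Hw0) as [V [HV HVw]]. { intros z Hz. left. apply (Hsub z Hz). }
destruct (analytic_divide f Hf) as [F [HF EF]].
assert (Hf' := analytic_derive f Hf).
set (q := fun z => (F z / C_derive f z)%C).
assert (Hq : analytic_in_disc q) by (apply analytic_div; auto).
assert (DfF : forall z, unit_disc z -> C_derive f z = (F z + z * C_derive F z)%C).
{ intros z Hz. apply is_C_derive_unique. apply disc_ext with (fun z => z * F z)%C; auto.
  - intros u Hu. rewrite (EF u Hu), Hf0. ring.
  - replace (F z + z * C_derive F z)%C with (1 * F z + z * C_derive F z)%C by ring.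
    apply (is_cderive_mult (fun z => z) F). apply is_cderive_id. now apply analytic_C_derive_at. }
assert (Eq : forall z, unit_disc z -> (1 - z * C_derive q z = phi (z * V z) * q z)%C).
{ intros z Hz. destruct (HVw z Hz) as [Ew _]. destruct (Hsub z Hz) as [_ Eu].
  rewrite <- Ew, <- Eu. specialize (Hf1 z Hz).
  assert (D := is_cderive_div F (C_derive f) z _ _ (analytic_C_derive_at F z HF Hz)
     (analytic_C_derive_at _ z Hf' Hz) Hf1).
  rewrite (is_C_derive_unique q z _ D). unfold q.
  assert (E := DfF z Hz). 
  set (f1 := C_derive f z) in *. set (f2 := C_derive (C_derive f) z) in *.
  set (F0 := F z) in *. set (F1 := C_derive F z) in *.
  transitivity (((f1 - z * F1) / f1 + z * (F0 * f2) / (f1 * f1)))%C. field; auto.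
  rewrite E at 1. replace (F0 + z * F1 - z * F1)%C with F0 by ring. field; auto. }
assert (Hqpos : forall z, unit_disc z -> 0 < Re (q z)).
{ apply (positive_real_part q (fun z => phi (z * V z)%C)); auto.
  intros z Hz. apply Hpos. destruct (HVw z Hz) as [<- _]. apply (Hsub z Hz). }
assert (Hqn : forall z, unit_disc z -> q z <> 0).
{ intros z Hz E. specialize (Hqpos z Hz). rewrite E in Hqpos. simpl in Hqpos. lra. }
set (p := fun z => (1 / q z)%C).
assert (Hp : analytic_in_disc p) by (apply analytic_div; auto; apply analytic_const).
assert (Hpn' : forall z, unit_disc z -> p z <> 0).
{ intros z Hz E. apply C1_nz. replace (RtoC 1) with (p z * q z)%C by (unfold p; field; auto).
  rewrite E. ring. }
assert (Hp0 : p 0 = 1).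
{ unfold p, q. assert (E := DfF _ unit_disc_0). specialize (Hf1 _ unit_disc_0).
  assert (E' : F 0 = C_derive f 0) by (rewrite E; ring).
  rewrite E'. field. auto. }
destruct (analytic_log psi Hpsi Hpn Hpsi0) as [Psi [Psi0 [EPsi DPsi]]].
destruct (analytic_log p Hp Hpn' Hp0) as [P [P0 [EP DP]]].
assert (L := lift_exists phi Psi (fun z => C_derive psi z / (psi z * C_derive phi z))%C P V Hconv).
intros z Hz. destruct L with (z := z) as [zeta [Hz1 Hz2]]; auto; clear L.
- intros u Hu. eexists. apply DPsi; auto.
- intros u Hu. rewrite (is_C_derive_unique _ _ _ (DPsi u Hu)). split.
  + field. split; auto. now apply injective_derive_neq_0.
  + now apply ode_close_to_convex.
- intros u Hu. rewrite (is_C_derive_unique _ _ _ (DPsi u Hu)), EPsi by auto.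
  destruct (Hode u Hu) as [Hn <-]. field; auto.
- intros u Hu. eexists. apply DP; auto.
- intros u Hu. apply (HVw u Hu).
- intros u Hu. rewrite (is_C_derive_unique _ _ _ (DP u Hu)), EP by auto.
  assert (Nq := Hqn u Hu).
  assert (D := is_C_derive_unique p u _ (is_cderive_div (fun _ => RtoC 1) q u _ _ (is_cderive_const _ _)
     (analytic_C_derive_at q u Hq Hu) Nq)).
  rewrite D. unfold p. 
  transitivity (((1 - u * C_derive q u) - 1) / q u)%C. field; auto.
  rewrite Eq by auto. field; auto.
- exists zeta. split; auto.
  assert (Hzeta : unit_disc zeta) by (unfold unit_disc in *; lra).
  rewrite <- (EPsi zeta Hzeta), Hz2, (EP z Hz), (EF z Hz), Hf0. unfold p, q.
  specialize (Hqn z Hz). unfold q in Hqn. specialize (Hf1 z Hz).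
  field. split; auto. intros E. apply Hqn. rewrite E. field; auto.
Qed.

(** * The minimum modulus of [psi] on circles *)

Lemma min_modulus_disc psi r m0 z : analytic_in_disc psi ->
  (forall z, unit_disc z -> psi z <> 0) -> 0 <= r < 1 ->
  is_min_modulus psi r m0 -> Cmod z <= r -> 0 < m0 /\ m0 <= Cmod (psi z).
Proof.
intros Hpsi Hn Hr [[z0 [Hz0 Em]] Hmin] Hz.
assert (Hm : 0 < m0). { rewrite <- Em. apply Cmod_gt_0, Hn. unfold unit_disc; lra. }
split; auto.
apply (minimum_principle psi r); auto; lra.
Qed.

(** Moving a minimum point radially from one circle to the other costs at
    most the Lipschitz constant of [psi]. *)
Lemma min_modulus_lipschitz psi (m : R -> R) rho : analytic_in_disc psi -> 0 <= rho < 1 ->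
  (forall r, 0 <= r < 1 -> is_min_modulus psi r (m r)) ->
  exists L, 0 <= L /\ forall r s, 0 <= r <= rho -> 0 <= s <= rho -> Rabs (m r - m s) <= L * Rabs (r - s).
Proof.
intros Hpsi Hrho Hm.
destruct (disc_Cmod_max rho (C_derive psi)) as [w0 [_ Hmax]]; [lra| |].
{ intros z Hz. apply analytic_ccontinuous; [|lra]. now apply analytic_derive. }
set (L := Cmod (C_derive psi w0)) in *. exists L. split; [apply Cmod_ge_0|].
assert (H : forall r s, 0 <= r <= rho -> 0 <= s <= rho -> m s <= m r + L * Rabs (r - s)).
{ intros r s Hr Hs. destruct (Hm r ltac:(lra)) as [[z [Hz Ez]] _].
  destruct (Hm s ltac:(lra)) as [_ Hmin].
  assert (Hz' : exists z', Cmod z' = s /\ Cmod (z' - z) = Rabs (r - s)).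
  { destruct (Req_dec r 0) as [E|E].
    - exists (RtoC s). rewrite E in Hz. apply Cmod_eq_0 in Hz. subst z r.
      replace (s - 0)%C with (RtoC s) by ring. rewrite Cmod_R.
      rewrite Rminus_0_l, Rabs_Ropp, Rabs_right; lra.
    - exists (RtoC (s / r) * z)%C. rewrite Cmod_mult, Cmod_R, Hz, Rabs_right.
      split. field; auto.
      replace (RtoC (s / r) * z - z)%C with (RtoC (s / r - 1) * z)%C by (rewrite RtoC_minus; ring).
      rewrite Cmod_mult, Cmod_R, Hz. rewrite <- (Rabs_right r) at 2 by lra. rewrite <- Rabs_mult.
      rewrite (Rabs_minus_sym r s). f_equal. field; auto.
      apply Rle_ge, Rle_div_r; lra. }
  destruct Hz' as [z' [H1 H2]]. specialize (Hmin z' H1).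
  assert (HL : Cmod (psi z' - psi z) <= L * Cmod (z' - z)).
  { apply (disc_lipschitz psi rho); auto; lra. }
  pose proof (Cmod_lt_perturb (psi z) (psi z')). rewrite H2 in HL. lra. }
intros r s Hr Hs. pose proof (H r s Hr Hs). pose proof (H s r Hs Hr).
rewrite (Rabs_minus_sym s r) in H1. apply Rabs_le_between. lra.
Qed.

Definition majorization_gap (m : R -> R) (r : R) : R := (1 - r ^ 2) * m r - 2 * r.

(** By the minimum principle [m] is nonincreasing. *)
Lemma majorization_gap_decreasing psi (m : R -> R) r s : analytic_in_disc psi ->
  (forall z, unit_disc z -> psi z <> 0) ->
  (forall r, 0 <= r < 1 -> is_min_modulus psi r (m r)) ->
  0 <= r < s -> s < 1 -> majorization_gap m s < majorization_gap m r.
Proof.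
intros Hpsi Hn Hm Hr Hs.
destruct (Hm r ltac:(lra)) as [[z [Hz Ez]] _].
destruct (min_modulus_disc psi s (m s) z Hpsi Hn ltac:(lra) (Hm s ltac:(lra)) ltac:(lra)) as [H1 H2].
rewrite Ez in H2. unfold majorization_gap.
assert ((1 - s ^ 2) * m s <= (1 - r ^ 2) * m r) by (apply Rmult_le_compat; nra). lra.
Qed.

(** The gap tends to 1 at 0 and is negative at 1/2 because [m <= m 0 = 1].
    Nothing is known of [m] to the left of 0, so the intermediate value
    theorem starts at a positive [r0]. *)
Lemma majorization_root psi (m : R -> R) : analytic_in_disc psi -> psi 0 = 1 ->
  (forall z, unit_disc z -> psi z <> 0) ->
  (forall r, 0 <= r < 1 -> is_min_modulus psi r (m r)) ->
  exists r, 0 < r < 1 /\ majorization_gap m r = 0.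
Proof.
intros Hpsi H0 Hn Hm.
assert (Em0 : m 0 = 1).
{ destruct (Hm 0 ltac:(lra)) as [[z [Hz Ez]] _]. apply Cmod_eq_0 in Hz. subst z.
  rewrite <- Ez, H0. apply Cmod_1. }
destruct (min_modulus_lipschitz psi m (3 / 4) Hpsi ltac:(lra) Hm) as [L [HL HLip]].
assert (Hm1 : forall r, 0 <= r < 1 -> 0 < m r <= 1).
{ intros r Hr. destruct (min_modulus_disc psi r (m r) (RtoC 0) Hpsi Hn Hr (Hm r Hr)) as [A B].
  rewrite Cmod_0; lra. rewrite H0, Cmod_1 in B. lra. }
set (r0 := Rmin (1 / 8) (/ (4 * (L + 1)))).
assert (Hr0 : 0 < r0) by (apply Rmin_glb_lt; [lra|apply Rinv_0_lt_compat; lra]).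
assert (Hr1 : r0 <= 1 / 8) by apply Rmin_l.
assert (Hr2 : L * r0 <= 1 / 4).
{ apply Rle_trans with ((L + 1) * / (4 * (L + 1))). apply Rmult_le_compat; try lra. apply Rmin_r.
  right; field; lra. }
destruct (IVT_interv (fun r => - majorization_gap m r) r0 (1 / 2)) as [r [Hr Er]].
- intros a Ha. unfold majorization_gap.
  assert (Cm : continuity_pt m a).
  { intros eps He. exists (Rmin (Rmin (r0 / 2) (1 / 4)) (eps / (L + 1))).
    assert (0 < eps / (L + 1)) by (apply Rdiv_lt_0_compat; lra).
    split. { repeat apply Rmin_glb_lt; lra. }
    intros x [_ Hx]. simpl in Hx. unfold R_dist in Hx. simpl. unfold R_dist.
    apply Rlt_Rmin in Hx as [X1 X2]. apply Rlt_Rmin in X1 as [X3 X4].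
    apply Rabs_lt_between in X3 as X5. apply Rabs_lt_between in X4 as X6.
    eapply Rle_lt_trans; [apply HLip; lra|]. apply Rlt_div_r in X2; [|lra].
    pose proof (Rabs_pos (x - a)). nra. }
  apply continuity_pt_opp. apply continuity_pt_minus.
  + apply continuity_pt_mult; auto. apply derivable_continuous_pt. reg.
  + apply derivable_continuous_pt. reg.
- lra.
- assert (Hb : Rabs (m r0 - m 0) <= L * Rabs (r0 - 0)) by (apply HLip; lra).
  rewrite Em0, Rminus_0_r, (Rabs_right r0) in Hb by lra. apply Rabs_le_between in Hb.
  unfold majorization_gap. assert (3 / 4 <= m r0) by lra.
  assert ((1 - 1 / 64) * (3 / 4) <= (1 - r0 ^ 2) * m r0) by (apply Rmult_le_compat; nra). lra.
- destruct (Hm1 (1 / 2) ltac:(lra)). unfold majorization_gap. nra.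
- exists r. split; [lra|]. lra.
Qed.

(** * The majorization estimate and its sharpness *)

(** [|g'| <= |Phi'| * |f| + |Phi| * |f'|], and with [y = |Phi|] the first term
    is at most [(1 - y ^ 2) / (1 - r ^ 2) * r / m0 * |f'| <= (1 - y) * |f'|]. *)
Lemma majorized_derivative_bound (psi f g : C -> C) (m0 : R) z : 
  analytic_in_disc f -> majorized_by g f -> unit_disc z -> 0 < m0 ->
  2 * Cmod z <= (1 - Cmod z ^ 2) * m0 -> 
  (exists zeta, m0 <= Cmod (psi zeta) /\ (f z * psi zeta = z * C_derive f z)%C) ->
  Cmod (C_derive g z) <= Cmod (C_derive f z).
Proof.
intros Hf [Phi [HPhi Hmaj]] Hz Hm Hr [zeta [Hz1 Hz2]].
assert (Dg : C_derive g z = (C_derive Phi z * f z + Phi z * C_derive f z)%C).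
{ apply is_C_derive_unique. apply disc_ext with (fun z => Phi z * f z)%C; auto.
  - intros w Hw. symmetry. now apply Hmaj.
  - apply is_cderive_mult; now apply analytic_C_derive_at. }
assert (SP := schwarz_pick Phi z HPhi (fun w Hw => proj1 (Hmaj w Hw)) Hz).
assert (HY := proj1 (Hmaj z Hz)). unfold unit_disc in Hz.
apply (f_equal Cmod) in Hz2. rewrite !Cmod_mult in Hz2.
rewrite Dg. eapply Rle_trans; [apply Cmod_triangle|]. rewrite !Cmod_mult.
pose proof (Cmod_ge_0 z). pose proof (Cmod_ge_0 (f z)). pose proof (Cmod_ge_0 (C_derive Phi z)).
pose proof (Cmod_ge_0 (Phi z)). pose proof (Cmod_ge_0 (C_derive f z)).
set (r := Cmod z) in *. set (X := Cmod (f z)) in *. set (A := Cmod (C_derive Phi z)) in *.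
set (y := Cmod (Phi z)) in *. set (D := Cmod (C_derive f z)) in *.
assert (HX : X * m0 <= r * D).
{ rewrite <- Hz2. apply Rmult_le_compat_l; auto. }
assert (Hr2 : 0 < 1 - r ^ 2) by nra.
assert (E : A * X <= (1 - y) * D).
{ apply Rmult_le_reg_l with ((1 - r ^ 2) * m0). now apply Rmult_lt_0_compat.
  apply Rle_trans with ((1 - y ^ 2) * (r * D)).
  { replace ((1 - r ^ 2) * m0 * (A * X)) with ((A * (1 - r ^ 2)) * (X * m0)) by ring.
    apply Rmult_le_compat; auto; nra. }
  apply Rle_trans with ((2 * r) * ((1 - y) * D)).
  { replace ((1 - y ^ 2) * (r * D)) with ((1 + y) * (r * ((1 - y) * D))) by ring.
    rewrite Rmult_assoc. apply Rmult_le_compat_r; [|lra].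
    apply Rmult_le_pos; auto. apply Rmult_le_pos; lra. }
  apply Rmult_le_compat_r; auto. apply Rmult_le_pos; lra. }
lra.
Qed.

(** [f = z * exp H] with [H' = (psi - 1) / z] solves [z * f' / f = psi], so that
    [1 + z * f'' / f'] is [phi] itself. *)
Lemma extremal_function phi psi : analytic_in_disc psi -> psi 0 = 1 ->
  solves_ode phi psi ->
  exists f, class_C phi f /\
    forall z, unit_disc z -> (f z * psi z = z * C_derive f z)%C.
Proof.
intros Hpsi H0 Hode.
assert (Hn : forall z, unit_disc z -> psi z <> 0) by (intros z Hz; apply (Hode z Hz)).
destruct (analytic_divide psi Hpsi) as [G [HG EG]]. rewrite H0 in EG.
destruct (analytic_primitive G HG) as [H [HH0 HH]].
set (f := fun z => (z * Cexp (H z))%C).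
assert (De : forall z, unit_disc z -> is_cderive (fun z => Cexp (H z)) z (G z * Cexp (H z))%C).
{ intros z Hz. apply is_cderive_comp; auto. apply is_cderive_Cexp. }
assert (Df : forall z, unit_disc z -> is_cderive f z (psi z * Cexp (H z))%C).
{ intros z Hz. rewrite (EG z Hz).
  replace ((1 + z * G z) * Cexp (H z))%C with (1 * Cexp (H z) + z * (G z * Cexp (H z)))%C by ring.
  apply (is_cderive_mult (fun z => z) (fun z => Cexp (H z))); auto. apply is_cderive_id. }
assert (Cf : forall z, unit_disc z -> C_derive f z = (psi z * Cexp (H z))%C).
{ intros z Hz. apply is_C_derive_unique. auto. }
assert (Hf : analytic_in_disc f) by (intros z Hz; eexists; apply Df; auto).
assert (Cf2 : forall z, unit_disc z -> C_derive (C_derive f) z =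
   (C_derive psi z * Cexp (H z) + psi z * (G z * Cexp (H z)))%C).
{ intros z Hz. apply is_C_derive_unique. apply disc_ext with (fun z => psi z * Cexp (H z))%C; auto.
  - intros w Hw. symmetry; auto.
  - apply (is_cderive_mult psi (fun z => Cexp (H z))); auto. now apply analytic_C_derive_at. }
exists f. split; [split; [|split]|].
- apply class_A_intro; auto.
  + unfold f. ring.
  + rewrite Cf, H0, HH0, Cexp_0 by apply unit_disc_0. ring.
- intros z Hz. rewrite Cf by auto. apply Cmult_neq_0; auto. apply Cexp_neq_0.
- exists (fun z => z). split; [apply analytic_id|]. split; auto. intros z Hz. split; auto.
  rewrite Cf, Cf2 by auto. destruct (Hode z Hz) as [Np <-].
  pose proof (Cexp_neq_0 (H z)).
  transitivity ((1 + z * G z) + z * C_derive psi z / psi z)%C. field; auto.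
  now rewrite <- EG.
- intros z Hz. rewrite Cf by auto. unfold f. ring.
Qed.

(** The multiplier is the involution of the disc that exchanges 0 and [c];
    the inequality holds for every [c] close enough to 1. *)
Lemma extremal_majorization (psi f : C -> C) (r m0 : R) : analytic_in_disc f -> 0 < r < 1 -> 0 < m0 ->
  (1 - r ^ 2) * m0 < 2 * r -> psi (RtoC (- r)) = RtoC m0 ->
  C_derive f (RtoC (- r)) <> 0 ->
  (f (RtoC (- r)) * psi (RtoC (- r)) = RtoC (- r) * C_derive f (RtoC (- r)))%C ->
  exists g, analytic_in_disc g /\ majorized_by g f /\
    Cmod (C_derive f (RtoC (- r))) < Cmod (C_derive g (RtoC (- r))).
Proof.
intros Hf Hr Hm Hgap Hpsi Hn Ef. rewrite Hpsi in Ef.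
set (gap := 2 * r - (1 - r ^ 2) * m0). assert (Hg : 0 < gap) by (unfold gap; lra).
assert (Hg2 : gap < 2). { unfold gap. assert (0 < (1 - r ^ 2) * m0) by (apply Rmult_lt_0_compat; nra). lra. }
(* the inequality to be proved is affine in [c] and reads [gap > 0] at
   [c = 1] *)
set (c := 1 - gap / 4). assert (Hc : 1 / 2 < c < 1) by (unfold c; lra).
assert (Hcm : Cmod (RtoC c) < 1) by (rewrite Cmod_RtoC; lra).
set (Phi := fun z => ((- z + c) / (1 + Cconj (RtoC c) * - z))%C).
assert (Hden : forall z, unit_disc z -> (1 + Cconj (RtoC c) * - z)%C <> 0).
{ intros z Hz. apply mobius_denominator; auto. rewrite Cmod_opp. left; exact Hz. }
assert (DPhi : forall z, unit_disc z -> is_cderive Phi z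
   (((- (1) + 0) * (1 + Cconj (RtoC c) * - z) - (- z + c) * (0 + Cconj (RtoC c) * - (1)))
    / ((1 + Cconj (RtoC c) * - z) * (1 + Cconj (RtoC c) * - z)))%C).
{ intros z Hz. apply (is_cderive_div (fun z => - z + c)%C (fun z => 1 + Cconj (RtoC c) * - z)%C); auto.
  - apply is_cderive_plus; [|apply is_cderive_const]. apply is_cderive_opp, is_cderive_id.
  - apply is_cderive_plus; [apply is_cderive_const|]. apply is_cderive_scal, is_cderive_opp, is_cderive_id. }
assert (HPhi : analytic_in_disc Phi) by (intros z Hz; eexists; apply DPhi; auto).
exists (fun z => Phi z * f z)%C. split; [now apply analytic_mult|]. split.
{ exists Phi. split; auto. intros z Hz. split; auto. apply mobius_le_1; auto.
  rewrite Cmod_opp. left; exact Hz. }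
assert (Hrd : unit_disc (RtoC (- r))) by (unfold unit_disc; rewrite Cmod_R, Rabs_Ropp, Rabs_right; lra).
rewrite (is_C_derive_unique (fun z : C => Phi z * f z)%C _ _ (is_cderive_mult Phi f _ _ _ (DPhi _ Hrd) (analytic_C_derive_at f _ Hf Hrd))).
set (D := C_derive f (RtoC (- r))) in *.
assert (Nm : RtoC m0 <> 0) by (apply RtoC_neq_0; lra).
assert (Ef' : f (RtoC (- r)) = (RtoC (- r) * D / m0)%C).
{ rewrite <- Ef. field. auto. }
assert (Hcr : 0 < 1 + c * r) by nra.
(* the quotient of the two derivatives at [-r] *)
set (K := (1 - c ^ 2) * r / ((1 + c * r) * (1 + c * r) * m0) + (c + r) / (1 + c * r)).
assert (Ec : Cconj (RtoC c) = RtoC c) by (unfold Cconj, RtoC; simpl; f_equal; ring).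
match goal with |- _ < Cmod ?X => replace X with (K * D)%C end.
- rewrite Cmod_mult, Cmod_R. apply Cmod_gt_0 in Hn.
  rewrite <- (Rmult_1_l (Cmod D)) at 1. apply Rmult_lt_compat_r; auto.
  apply Rlt_le_trans with K; [|apply Rle_abs].
  assert (HK : K - 1 = (1 - c) * ((1 + c) * r - m0 * (1 - r) * (1 + c * r)) / ((1 + c * r) * (1 + c * r) * m0)).
  { unfold K. field. lra. }
  assert (0 < (1 - c) * ((1 + c) * r - m0 * (1 - r) * (1 + c * r)) / ((1 + c * r) * (1 + c * r) * m0)).
  { apply Rdiv_lt_0_compat; [|repeat apply Rmult_lt_0_compat; lra].
    apply Rmult_lt_0_compat; [lra|].
    replace ((1 + c) * r - m0 * (1 - r) * (1 + c * r)) with (gap - (1 - c) * (r - m0 * (1 - r) * r)).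
    2:{ unfold gap. ring. }
    assert ((1 - c) * (r - m0 * (1 - r) * r) <= (1 - c) * 1).
    { apply Rmult_le_compat_l; [lra|]. 
      assert (0 < m0 * (1 - r) * r) by (repeat apply Rmult_lt_0_compat; lra). lra. }
    assert (1 - c = gap / 4) by (unfold c; field). lra. }
  lra.
- unfold Phi. rewrite Ef', Ec.
  assert (Nd : (1 + c * r)%C <> 0).
  { rewrite <- RtoC_mult, <- RtoC_plus. apply RtoC_neq_0; lra. }
  assert (EK : RtoC K = ((1 - c * c) * r / ((1 + c * r) * (1 + c * r) * m0)
     + (c + r) / (1 + c * r))%C).
  { assert (N1 : (1 + c * r) * (1 + c * r) * m0 <> 0)
      by (apply Rgt_not_eq; repeat apply Rmult_lt_0_compat; lra).
    unfold K. rewrite RtoC_plus, RtoC_div, RtoC_div by (auto; lra).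
    rewrite !RtoC_mult, !RtoC_plus, RtoC_minus, RtoC_pow, !RtoC_mult. field. auto. }
  rewrite EK, !RtoC_opp. field. split; auto.
  replace (1 + c * - - r)%C with (1 + c * r)%C by ring. auto.
Qed.

Theorem theorem2p1
    (phi psi : C -> C) (m : R -> R)
    (phi_convex : convex_in_disc phi)
    (phi_real : real_coefficients phi)
    (phi_pos : forall z : C, unit_disc z -> (0 < Re (phi z))%R)
    (phi_0 : phi (RtoC 0) = RtoC 1)
    (psi_analytic : analytic_in_disc psi)
    (psi_0 : psi (RtoC 0) = RtoC 1)
    (psi_ode : solves_ode phi psi)
    (m_min : forall r : R, (0 <= r < 1)%R -> is_min_modulus psi r (m r)) :
  exists r_psi : R,
    least_positive_root m r_psi /\
    (forall f g : C -> C,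
        class_C phi f -> analytic_in_disc g -> majorized_by g f ->
        derivative_bound f g r_psi) /\
    ((forall r : R, (0 < r < 1)%R -> RtoC (m r) = psi (RtoC (- r))) ->
     forall rho : R, (r_psi < rho)%R ->
       exists f g : C -> C,
         class_C phi f /\ analytic_in_disc g /\ majorized_by g f /\
         exists z : C, unit_disc z /\ (Cmod z <= rho)%R /\
           (Cmod (C_derive f z) < Cmod (C_derive g z))%R).
Proof.
assert (psi_n : forall z, unit_disc z -> psi z <> 0) by (intros z Hz; apply (psi_ode z Hz)).
destruct (majorization_root psi m psi_analytic psi_0 psi_n m_min) as [r1 [Hr1 Er1]].
assert (Hdec := fun r s => majorization_gap_decreasing psi m r s psi_analytic psi_n m_min).
assert (Hmpos : forall r, 0 <= r < 1 -> 0 < m r).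
{ intros r Hr. apply (min_modulus_disc psi r (m r) (RtoC 0)); auto. rewrite Cmod_0; lra. }
exists r1. split; [|split].
- split; [split; [lra|exact Er1]|]. intros s [Hs Es].
  apply Rnot_lt_le. intros Hl. specialize (Hdec s r1 ltac:(lra) ltac:(lra)).
  unfold majorization_gap in *. lra.
- intros f g Hf Hg Hmaj z Hz Hzr.
  pose proof (Cmod_ge_0 z). 
  assert (Hz1 : 0 <= Cmod z < 1) by (unfold unit_disc in Hz; lra).
  apply (majorized_derivative_bound psi f g (m (Cmod z))); auto.
  + apply Hf.
  + destruct (Rle_lt_or_eq_dec _ _ Hzr) as [Hl|E].
    * specialize (Hdec (Cmod z) r1 ltac:(lra) ltac:(lra)). unfold majorization_gap in *. lra.
    * rewrite E. unfold majorization_gap in Er1. lra.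
  + destruct (class_C_subordination phi psi f phi_convex phi_pos psi_analytic psi_0 psi_ode Hf z Hz)
      as [zeta [H1 H2]].
    exists zeta. split; auto.
    apply (min_modulus_disc psi (Cmod z) (m (Cmod z)) zeta); auto.
- intros Hreal rho Hrho.
  destruct (extremal_function phi psi psi_analytic psi_0 psi_ode) as [f [Hf Ef]].
  set (r := (r1 + Rmin rho 1) / 2).
  assert (r1 < Rmin rho 1) by (apply Rmin_glb_lt; lra).
  assert (Rmin rho 1 <= rho) by apply Rmin_l. assert (Rmin rho 1 <= 1) by apply Rmin_r.
  assert (Hr : r1 < r < 1 /\ r < rho) by (unfold r; lra).
  assert (Hcr : Cmod (RtoC (- r)) = r) by (rewrite Cmod_R, Rabs_Ropp, Rabs_right; lra).
  assert (Hrd : unit_disc (RtoC (- r))) by (unfold unit_disc; lra).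
  destruct (extremal_majorization psi f r (m r)) as [g [Hg [Hmaj Hlt]]].
  + apply Hf.
  + lra.
  + apply Hmpos; lra.
  + specialize (Hdec r1 r ltac:(lra) ltac:(lra)). unfold majorization_gap in *. lra.
  + symmetry. apply Hreal. lra.
  + apply Hf; auto.
  + auto.
  + exists f, g. split; [|split; [|split]]; auto.
    exists (RtoC (- r)). split; [|split]; auto. lra.
Qed.
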